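(* Let $a$ and $d\ge 2$ be coprime integers. Then $$\gamma(d,a)=\gamma_1(d,a)-\sum_{p\equiv a\ (\mathrm{mod}\ d)}\frac{\log p}{p(p-1)}+\sum_{n\equiv a\ (\mathrm{mod}\ d)}\frac{(1+\mu(n))\Lambda(n)}{n},$$ where $$\gamma_1(d,a)=\frac{1}{\varphi(d)}\Bigl(\gamma+\sum_{p\mid d}\frac{\log p}{p-1}+\sum_{\chi\ne\chi_0}\overline{\chi}(a)\frac{L'}{L}(1,\chi)\Bigr).$$
   Context: The letter $p$ always denotes a prime number, and $n$ runs over positive integers. $\mu$ is the Möbius function, $\Lambda$ the von Mangoldt function, $\varphi$ Euler's totient function, and $\gamma$ is Euler's constant $0.5772\ldots$. The sum over $\chi\ne\chi_0$ runs over all non-principal Dirichlet characters modulo $d$, $\chi_0$ is the principal character modulo $d$, $L(s,\chi)$ is the Dirichlet $L$-function of $\chi$ (as a character modulo $d$), and $\frac{L'}{L}(s,\chi)$ means $L'(s,\chi)/L(s,\chi)$ with the derivative taken in $s$. For coprime $a,d$ and $\Re(s)>1$ define $$\zeta_{d,a}(s)=\prod_{p\equiv a\ (\mathrm{mod}\ d)}\frac{1}{1-p^{-s}},$$ and define the Euler constant $$\gamma(d,a)=\lim_{s\to 1^+}\Bigl(\frac{\zeta_{d,a}'(s)}{\zeta_{d,a}(s)}+\frac{1}{\varphi(d)(s-1)}\Bigr).$$ *)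

(* Defs.v *)
From HB Require Import structures.
From mathcomp Require Import all_boot all_order all_algebra.
From mathcomp Require Import complex.
From mathcomp Require Import all_classical all_reals all_analysis.

Set Implicit Arguments.
Unset Strict Implicit.
Unset Printing Implicit Defensive.

Import Order.TTheory GRing.Theory Num.Theory.
Import numFieldNormedType.Exports.

Local Open Scope classical_set_scope.
Local Open Scope ring_scope.
Local Open Scope complex_scope.

(* Complex numbers are [R[i]]. The alias [R[i]^o] is what carries the topology
   and the normed [R[i]]-module structure, so that limits, [derivable] and
   [derive1] on it are the complex ones. The operators [lim], [limn]
   and [derive1] are total. *)

Definition congruent_to (a : int) (d n : nat) : bool :=
  (n%:Z == a %[mod d%:Z])%Z.

Definition moebius (n : nat) : int :=
  if all (fun p => logn p n == 1%N) (primes n)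
  then (-1) ^+ size (primes n) else 0.

(* [primes n] is a singleton [:: p] exactly when n = p ^ k with p prime and
   k >= 1. *)
Definition vonMangoldt (R : realType) (n : nat) : R :=
  if primes n is [:: p] then ln p%:R else 0.

Definition euler_gamma (R : realType) : R :=
  limn (fun n => \sum_(1 <= k < n.+1) k%:R^-1 - ln n%:R).

Definition cexp (R : realType) (z : R[i]) : R[i] :=
  (expR (complex.Re z))%:C * (cos (complex.Im z) +i* sin (complex.Im z)).

(* n ^ (- s), for n >= 1 *)
Definition npowN (R : realType) (n : nat) (s : R[i]) : R[i] :=
  cexp (- s * (ln n%:R)%:C).

Definition zeta_ap (R : realType) (d : nat) (a : int) (s : R[i]^o) : R[i]^o :=
  limn (fun N => (\prod_(1 <= p < N | prime p && congruent_to a d p)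
                    (1 - npowN p s)^-1) : R[i]^o).

Definition zeta_ap_quot (R : realType) (d : nat) (a : int) (s : R) : R[i]^o :=
  derive1 (zeta_ap d a) s%:C / zeta_ap d a s%:C
  + (((totient d)%:R * (s - 1))^-1)%:C.

Definition gamma_ap (R : realType) (d : nat) (a : int) : R[i]^o :=
  lim (@zeta_ap_quot R d a s @[s --> (1 : R)^'+]).

(* Dirichlet characters modulo d as functions on the integers; chi 1 = 1
   follows from the first and last clauses. *)
Definition dirichlet_character (R : realType) (d : nat) (chi : int -> R[i]) :=
  [/\ forall m n : int, chi (m * n) = chi m * chi n,
      forall m n : int, (m = n %[mod d%:Z])%Z -> chi m = chi n
    & forall n : int, (chi n != 0) = coprimez n d%:Z].

Definition principal_character (R : realType) (d : nat) (n : int) : R[i] :=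
  (coprimez n d%:Z)%:R.

Definition nonprincipal (R : realType) (d : nat) : set (int -> R[i]) :=
  [set chi | dirichlet_character d chi /\ chi <> principal_character R d].

Arguments nonprincipal R d : clear implicits.

(* For a nonprincipal chi the Dirichlet series converges (in the natural order
   of summation) to L(s, chi) on the whole half-plane Re s > 0, in particular
   near s = 1. *)
Definition dirichletL (R : realType) (chi : int -> R[i]) (s : R[i]^o) : R[i]^o :=
  limn (fun N => (\sum_(1 <= n < N) chi n%:Z * npowN n s) : R[i]^o).

(* [nonprincipal R d] is a finite set for d >= 1, so the [\sum_(_ \in _)] below
   is the ordinary finite sum. *)
Definition gamma1_ap (R : realType) (d : nat) (a : int) : R[i] :=
  ((totient d)%:R)^-1 *
  ((euler_gamma R + \sum_(p <- primes d) ln p%:R / (p%:R - 1))%:C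
   + \sum_(chi \in nonprincipal R d)
       (chi a)^* * (derive1 (dirichletL chi) 1 / dirichletL chi 1)).

Definition prime_series (R : realType) (d : nat) (a : int) (N : nat) : R :=
  \sum_(1 <= p < N | prime p && congruent_to a d p)
    ln p%:R / (p%:R * (p%:R - 1)).

Definition mangoldt_series (R : realType) (d : nat) (a : int) (N : nat) : R :=
  \sum_(1 <= n < N | congruent_to a d n)
    (1 + (moebius n)%:~R) * vonMangoldt R n / n%:R.

(* Main.v *)
Require Import Defs.
From mathcomp Require Import all_boot all_fingroup all_solvable all_field all_character.
From mathcomp Require Import all_boot all_order all_algebra.
From mathcomp Require Import complex.
From mathcomp Require Import all_classical all_reals all_analysis.
From mathcomp Require Import zify ring lra.

Set Implicit Arguments.
Unset Strict Implicit.
Unset Printing Implicit Defensive.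

Import Order.TTheory GRing.Theory Num.Theory.
Import numFieldNormedType.Exports.
Import ComplexField.Normc.

Local Open Scope classical_set_scope.
Local Open Scope ring_scope.
Local Open Scope complex_scope.

(** Write [w = p^(-s)] for a prime [p].  Logarithmic differentiation of the
    Euler product shows that [- zeta_{d,a}'/zeta_{d,a}] at [s] is the sum of
    [log p * w / (1 - w)] over the primes [p] congruent to [a]: all powers of
    such a prime contribute, whatever their own residue.  The series
    [M(s) = \sum_(n = a mod d) Lambda(n) n^(-s)], in which it is the prime power
    that lies in the class of [a], has the same terms at the primes.  Since
    [mu(n) Lambda(n)] is [- log n] at primes and [0] elsewhere,
    [(1 + mu(n)) Lambda(n)] is [Lambda(n)] deprived of the primes, so that
    [- zeta_{d,a}'/zeta_{d,a}(s) = M(s) - \sum_n (1 + mu(n)) Lambda(n) n^(-s)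
    + \sum_p log p * w^2 / (1 - w)], both sums being over the class of [a]
    ([logderiv_split]).  The last two series converge absolutely at [s = 1],
    where they are those of the theorem, and their limits are taken term by
    term ([highpow_ap_cvg], [prime_tail_ap_cvg]).  It remains to see that
    [M(s) - 1 / (phi(d) (s - 1))] tends to [- gamma_1(d,a)]
    ([mangoldt_ap_cvg]).

    Orthogonality of characters writes [phi(d) M(s)] as the sum over [chi] of
    [conj(chi a) S(chi, s)] with [S(chi, s) = \sum_n chi(n) Lambda(n) n^(-s)].
    For the principal character, [S] is [- zeta'/zeta] without the Euler
    factors at the primes dividing [d]; the expansions
    [zeta(1 + e) = 1/e + gamma + O(e)] and [zeta'(1 + e) = - 1/e^2 + O(1)] give
    its constant term ([principal_cvg]).  For the other characters, the
    convolution [Lambda * 1 = log] gives [S(chi, s) = - L'(s, chi) / L(s, chi)],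
    which tends to its value at [1] as soon as [L(1, chi) <> 0]
    ([logderiv_cvg]).

    Nonvanishing ([nonvanishing]) follows from the residues of the [S(chi, s)].
    The inverse [\sum_n mu(n) chi(n) n^(-s)] of [L] is bounded by
    [zeta(s) ~ 1 / (s - 1)], so a zero of [L] at [1] is simple
    ([Dseries_ln_neq0]), and then [(s - 1) S(chi, s)] tends to [-1].  It tends
    to [1] for the principal character and to [0] in the absence of a zero.
    The sum of these limits over all characters is [>= 0], because it is the
    limit of [phi(d) (s - 1)] times a series with nonnegative terms (the case
    [a = 1]).  Hence at most one [L] vanishes at [1]; as [L(1, conj chi)] is the
    conjugate of [L(1, chi)], its character is real.  For real characters the
    proof is Monsky's: if [\sum_n chi(n)/n] were [0], the Lambert series
    [\sum_n chi(n) x^n / (1 - x^n)] would stay bounded as [x] tends to [1],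
    whereas it dominates [\sum_m x^(m^2)] ([real_char_nonvanishing]).

    No complex function theory enters.  Abel summation against the weights
    [n^(-1) g(log n)], with bounds uniform in [g] ([tame_test]), gives quadratic
    remainders for [L] at [1], and a quadratic remainder is all that a complex
    derivative requires ([deriv_quadP]); the Euler product is handled by the
    same principle ([eprod_quad]). *)

(** * Complex limits and dominated series *)

Section Base.
Variable R : realType.
Local Notation C := (R[i]^o).
Implicit Types (z w : R[i]).

Lemma norm_normc z : `|z| = (normc z)%:C. Proof. by []. Qed.

Lemma normc_ge0 z : 0 <= normc z.
Proof. by rewrite -lecR -norm_normc normr_ge0. Qed.

Lemma normcB z w : normc (z - w) <= normc z + normc w.
Proof. by rewrite -(normcN w) le_normcD. Qed.

Lemma normcBC z w : normc (z - w) = normc (w - z).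
Proof. by rewrite -normcN opprB. Qed.

Lemma normc_real (x : R) : normc x%:C = `|x|.
Proof. by rewrite /= expr0n addr0 sqrtr_sqr. Qed.

Lemma normcX z n : normc (z ^+ n) = normc z ^+ n.
Proof. by elim: n => [|n IH]; rewrite ?expr0 ?normc1 // !exprS normcM IH. Qed.

Lemma normc_sum (I : Type) (r : seq I) (P : pred I) (F : I -> R[i]) :
  normc (\sum_(i <- r | P i) F i) <= \sum_(i <- r | P i) normc (F i).
Proof.
elim/big_ind2: _ => // [|x a y b xa yb]; first by rewrite normc0.
by rewrite (le_trans (le_normcD _ _)) // lerD.
Qed.

Lemma normc_eq0 z : (normc z == 0) = (z == 0).
Proof. by apply/eqP/eqP => [/eq0_normc|->] //; rewrite normc0. Qed.

Lemma normc_gt0 z : (0 < normc z) = (z != 0).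
Proof. by rewrite lt_def normc_ge0 andbT normc_eq0. Qed.

Lemma normc_conj z : normc z^* = normc z.
Proof. by case: z => a b /=; rewrite sqrrN. Qed.

Lemma ler_normc_Re z : `|complex.Re z| <= normc z.
Proof. by rewrite -lecR -norm_normc normc_ge_Re. Qed.

Lemma ler_normc_Im z : `|complex.Im z| <= normc z.
Proof.
case: z => a b /=; rewrite -sqrtr_sqr ler_wsqrtr // lerDr sqr_ge0 //.
Qed.

Lemma ler_normc_ReIm z : normc z <= `|complex.Re z| + `|complex.Im z|.
Proof.
rewrite {1}[z]complexE (le_trans (le_normcD _ _)) // normc_real lerD2l.
by rewrite normcM normc_real /= expr0n add0r expr1n sqrtr1 mul1r.
Qed.

(** Reduces limits in the complex plane, whose neighbourhoods are indexed by
    positive complex numbers, to limits of real functions. *)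
Lemma cvgC_norm (T : Type) (F : set_system T) {FF : Filter F} (f : T -> C) (l : C) :
  f x @[x --> F] --> l <-> normc (f x - l) @[x --> F] --> (0 : R).
Proof.
split => [/cvgrPdist_lt H|/cvgrPdist_lt H].
  apply/cvgrPdist_lt => e e0.
  have e0' : (0 : R[i]) < e%:C by rewrite ltcR.
  near=> x.
  rewrite sub0r normrN ger0_norm ?normc_ge0 // -ltcR -norm_normc distrC.
  by near: x; exact: H.
apply/cvgrPdist_lt => e e0.
have e1 : e = (complex.Re e)%:C by rewrite RRe_real // gtr0_real.
have e2 : 0 < complex.Re e by move: e0; rewrite e1 ltcR.
near=> x.
rewrite e1 distrC norm_normc ltcR -[normc _]ger0_norm ?normc_ge0 // -normrN -sub0r.
by near: x; exact: H.
Unshelve. all: by end_near. Qed.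

Lemma cvgC_bound (T : Type) (F : set_system T) {FF : Filter F} (f : T -> C)
  (l : C) (g : T -> R) :
  (\forall x \near F, normc (f x - l) <= g x) -> g x @[x --> F] --> (0 : R) ->
  f x @[x --> F] --> l.
Proof.
move=> fg g0; apply/cvgC_norm.
apply: (@squeeze_cvgr _ _ FF _ (fun=> 0) g) => //; last exact: cvg_cst.
by apply: filterS fg => x ->; rewrite normc_ge0.
Qed.

Lemma cvgC_real (T : Type) (F : set_system T) {FF : Filter F} (f : T -> R) (l : R) :
  f x @[x --> F] --> l -> ((f x)%:C : C) @[x --> F] --> (l%:C : C).
Proof.
move=> fl; apply/cvgC_norm.
under eq_fun do rewrite -[_ - _](rmorphB (real_complex R)) normc_real.
rewrite -(normr0 R) -(subrr l); apply: cvg_norm; apply: cvgB fl _; exact: cvg_cst.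
Qed.

Lemma cvgC_Re (T : Type) (F : set_system T) {FF : Filter F} (f : T -> C) (l : C) :
  f x @[x --> F] --> l -> complex.Re (f x) @[x --> F] --> complex.Re l.
Proof.
move=> /cvgC_norm fl; apply/cvgrPdist_lt => e e0.
move/cvgrPdist_lt : fl => /(_ e e0); apply: filterS => x.
rewrite sub0r normrN ger0_norm ?normc_ge0 //; apply: le_lt_trans.
have -> : complex.Re l - complex.Re (f x) = complex.Re (l - f x).
  by case: l (f x) => a b [].
by rewrite normcBC ler_normc_Re.
Qed.

Lemma cvgC_ReIm (T : Type) (F : set_system T) {FF : Filter F} (f : T -> C) (a b : R) :
  complex.Re (f x) @[x --> F] --> a -> complex.Im (f x) @[x --> F] --> b ->
  f x @[x --> F] --> (a +i* b : C).
Proof.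
move=> fa fb.
apply: (@cvgC_bound _ _ _ _ _
  (fun x => `|complex.Re (f x) - a| + `|complex.Im (f x) - b|)).
  apply: nearW => x; case: (f x) => u v.
  exact: le_trans (ler_normc_ReIm _) _.
rewrite -(addr0 (0 : R)) -(normr0 R) -{1}(subrr a) -(subrr b).
by apply: cvgD; apply: cvg_norm; apply: cvgB => //; exact: cvg_cst.
Qed.

Lemma ler_dist_normc z w : `|normc z - normc w| <= normc (z - w).
Proof.
rewrite ler_norml; apply/andP; split.
  rewrite lerNl opprB lerBlDr (normcBC z) -{1}(subrK z w).
  by rewrite le_normcD.
by rewrite lerBlDr -{1}(subrK w z) le_normcD.
Qed.

Lemma cvgC_normc (T : Type) (F : set_system T) {FF : Filter F} (f : T -> C) (l : C) :
  f x @[x --> F] --> l -> normc (f x) @[x --> F] --> normc l.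
Proof.
move=> /cvgC_norm fl; apply/cvgrPdist_lt => e e0.
move/cvgrPdist_lt : fl => /(_ e e0); apply: filterS => x.
rewrite sub0r normrN ger0_norm ?normc_ge0 //; apply: le_lt_trans.
by rewrite normcBC ler_dist_normc.
Qed.

Lemma cvgC_le (T : Type) (F : set_system T) {FF : ProperFilter F} (f : T -> C)
  (l : C) (B : R) :
  f x @[x --> F] --> l -> (\forall x \near F, normc (f x) <= B) -> normc l <= B.
Proof.
move=> /cvgC_normc fl fB; rewrite -(cvg_lim _ fl) //; apply: limr_le => //.
by apply/cvg_ex; eexists; exact: fl.
Qed.

(** The index [n = 0] is left out because [0^(-s)] has no meaning; this is also
    the range of summation of the series in the theorem. *)
Definition psum (V : zmodType) (u : nat -> V) (N : nat) := \sum_(1 <= n < N) u n.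

Lemma psumS (V : zmodType) (u : nat -> V) N : (0 < N)%N ->
  psum u N.+1 = psum u N + u N.
Proof. by move=> N0; rewrite /psum big_nat_recr. Qed.

(** A quantitative form of the convergence of a series with nonnegative terms:
    [B] is kept explicit because it ends up in the error terms. *)
Definition sumle (M : nat -> R) (B : R) :=
  (forall n, (0 < n)%N -> 0 <= M n) /\ forall N, psum M N <= B.

Lemma psum_nd (M : nat -> R) : (forall n, (0 < n)%N -> 0 <= M n) ->
  {homo psum M : n m / (n <= m)%N >-> n <= m}.
Proof.
move=> M0; apply/nondecreasing_seqP => -[|n].
  by rewrite /psum !big_geq.
by rewrite [leRHS]psumS // lerDl M0.
Qed.

Lemma sumle_cvg (M : nat -> R) (B : R) : sumle M B -> cvgn (psum M).
Proof.
case=> M0 MB; apply: nondecreasing_is_cvgn; first exact: psum_nd.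
by exists B => _ [n _ <-].
Qed.

Lemma sumle_lim (M : nat -> R) (B : R) : sumle M B -> limn (psum M) <= B.
Proof. by move=> MB; apply: limr_le; [exact: sumle_cvg MB|apply: nearW; case: MB]. Qed.

(** [u] is the difference of [M + u] and [M], whose partial sums are monotone
    and bounded. *)
Lemma dom_cvgR (M u : nat -> R) (B : R) : sumle M B ->
  (forall n, (0 < n)%N -> `|u n| <= M n) -> cvgn (psum u).
Proof.
move=> [M0 MB] uM.
have c1 : cvgn (psum (fun n => M n + u n)).
  apply: (@sumle_cvg _ (B + B)); split=> [n n0|N].
    by have := uM n n0; rewrite ler_norml => /andP[+ _]; rewrite lerNl -subr_ge0 opprK.
  rewrite (le_trans _ (lerD (MB N) (MB N))) //.
  rewrite /psum -big_split /=; apply: ler_sum_nat => n /andP[n1 _].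
  by rewrite lerD2l (le_trans (ler_norm _)) // uM.
have c2 : cvgn (psum M) by apply: sumle_cvg (conj M0 MB).
rewrite (_ : psum u = psum (fun n => M n + u n) - psum M); first exact: is_cvgB.
apply/funext => N; rewrite !fctE /psum -sumrB; apply: eq_bigr => i _.
by rewrite addrAC subrr add0r.
Qed.

Lemma dom_cvgC (M : nat -> R) (u : nat -> R[i]) (B : R) : sumle M B ->
  (forall n, (0 < n)%N -> normc (u n) <= M n) ->
  exists l : C, [/\ (psum u N : C) @[N --> \oo] --> l & normc l <= B].
Proof.
move=> MB uM.
have ReE N : complex.Re (psum u N) = psum (fun n => complex.Re (u n)) N.
  by apply: (big_ind2 (fun z x => complex.Re z = x)) => // [[a b] x [c d] y] /= -> ->.
have ImE N : complex.Im (psum u N) = psum (fun n => complex.Im (u n)) N.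
  by apply: (big_ind2 (fun z x => complex.Im z = x)) => // [[a b] x [c d] y] /= -> ->.
have /cvg_ex[a ca] : cvgn (psum (fun n => complex.Re (u n))).
  by apply: dom_cvgR MB _ => n n0; rewrite (le_trans (ler_normc_Re _)) ?uM.
have /cvg_ex[b cb] : cvgn (psum (fun n => complex.Im (u n))).
  by apply: dom_cvgR MB _ => n n0; rewrite (le_trans (ler_normc_Im _)) ?uM.
have cu : (psum u N : C) @[N --> \oo] --> (a +i* b : C).
  apply: cvgC_ReIm; first by under eq_fun do rewrite ReE.
  by under eq_fun do rewrite ImE.
exists (a +i* b); split => //.
apply: (cvgC_le cu); apply: nearW => N.
rewrite (le_trans (normc_sum _ _ _)) // (le_trans _ (MB.2 N)) //.
by apply: ler_sum_nat => n /andP[n1 _]; exact: uM.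
Qed.

End Base.

(** * The complex exponential near zero *)

Section Exp.
Variable R : realType.
Local Notation C := (R[i]^o).
Implicit Types (x y : R) (z w : R[i]).

Lemma cexpD z w : cexp (z + w) = cexp z * cexp w.
Proof.
case: z w => a b [c d]; rewrite /cexp /= expRD cosD sinD.
apply/eqP; rewrite eq_complex /=; apply/andP; split; apply/eqP; ring.
Qed.

Lemma cexp_real x : cexp x%:C = (expR x)%:C.
Proof. by rewrite /cexp /= cos0 sin0 complexr0 mulr1. Qed.

Lemma cexp0 : cexp (0 : R[i]) = 1.
Proof. by rewrite -[0]/(0%:C) cexp_real expR0. Qed.

Lemma normc_cexp z : normc (cexp z) = expR (complex.Re z).
Proof.
by rewrite /cexp normcM normc_real /= cos2Dsin2 sqrtr1 mulr1 ger0_norm ?expR_ge0.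
Qed.

Lemma expR_sub1_le x : `|expR x - 1| <= `|x| * expR `|x|.
Proof.
have h1 := expR_ge1Dx x; have h2 := expR_ge1Dx (- x).
have h3 : expR x * expR (- x) = 1 by rewrite -expRD subrr expR0.
have p := expR_gt0 x.
have p1 := expR_ge1Dx `|x|.
have [x0|x0] := ger0P x.
  rewrite ger0_norm; last lra.
  nra.
rewrite ltr0_norm ?subr_lt0 ?expR_lt1 //.
have : 1 <= expR (- x) by lra.
by nra.
Qed.

Lemma expR_sub1x_le x : 0 <= expR x - 1 - x <= x ^+ 2 * expR `|x|.
Proof.
have h1 := expR_ge1Dx x; have h2 := expR_ge1Dx (- x).
have h3 : expR x * expR (- x) = 1 by rewrite -expRD subrr expR0.
have p := expR_gt0 x.
apply/andP; split; first lra.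
have k : expR x - 1 - x <= x * (expR x - 1) by nra.
apply: (le_trans k).
apply: (le_trans (ler_norm _)); rewrite normrM -(real_normK (num_real x)) expr2 -mulrA.
by rewrite ler_wpM2l // expR_sub1_le.
Qed.

Lemma sin_le y : `|sin y| <= `|y|.
Proof.
wlog y0 : y / 0 < y.
  move=> H; have [/H//|y0|<-] := ltgtP 0 y; last by rewrite sin0.
  by have := H (- y); rewrite oppr_gt0 y0 sinN !normrN; apply.
have D (t : R) : t \in `]0, y[ -> is_derive t 1 (sin) ((cos) t).
  by move=> _; exact: is_derive_sin.
have K : {within `[0, y], continuous (sin)}.
  by apply: continuous_subspaceT => t; exact: continuous_sin.
have [c] := @MVT R _ _ 0 y y0 D K.
move=> _; rewrite sin0 !subr0 => ->.
by rewrite normrM ler_piMl // ler_norml cos_geN1 cos_le1.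
Qed.

Lemma cos_sub1_le y : `|cos y - 1| <= `|y|.
Proof.
wlog y0 : y / 0 < y.
  move=> H; have [/H//|y0|<-] := ltgtP 0 y; last by rewrite cos0 subrr.
  by have := H (- y); rewrite oppr_gt0 y0 cosN !normrN; apply.
have D (t : R) : t \in `]0, y[ -> is_derive t 1 (cos) ((fun x => - sin x) t).
  by move=> _; exact: is_derive_cos.
have K : {within `[0, y], continuous (cos)}.
  by apply: continuous_subspaceT => t; exact: continuous_cos.
have [c] := @MVT R _ _ 0 y y0 D K.
move=> _; rewrite cos0 !subr0 => ->.
by rewrite normrM normrN ler_piMl // ler_norml sin_geN1 sin_le1.
Qed.

Lemma sin_sub_le y : `|sin y - y| <= y ^+ 2.
Proof.
wlog y0 : y / 0 < y.
  move=> H; have [/H//|y0|<-] := ltgtP 0 y; last by rewrite sin0 subrr normr0 expr0n.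
  by have := H (- y); rewrite oppr_gt0 y0 sinN -opprD sqrrN !normrN; apply.
have D (t : R) : t \in `]0, y[ -> is_derive t 1 (fun x => sin x - x) ((fun x => cos x - 1) t).
  by move=> _; apply: is_deriveB.
have K : {within `[0, y], continuous (fun x => sin x - x)}.
  apply: continuous_subspaceT => t; apply: cvgB; [exact: continuous_sin|exact: cvg_id].
have [c] := @MVT R _ _ 0 y y0 D K.
rewrite in_itv /= => /andP[c0 cy]; rewrite sin0 !subr0 => ->.
rewrite normrM expr2 [`|y|]gtr0_norm // ler_wpM2r ?(ltW y0) //.
by rewrite (le_trans (cos_sub1_le _)) // gtr0_norm // ltW.
Qed.

Lemma cos_sub1_le2 y : `|cos y - 1| <= y ^+ 2.
Proof.
wlog y0 : y / 0 < y.
  move=> H; have [/H//|y0|<-] := ltgtP 0 y; last by rewrite cos0 subrr normr0 expr0n.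
  by have := H (- y); rewrite oppr_gt0 y0 cosN sqrrN; apply.
have D (t : R) : t \in `]0, y[ -> is_derive t 1 (cos) ((fun x => - sin x) t).
  by move=> _; exact: is_derive_cos.
have K : {within `[0, y], continuous (cos)}.
  by apply: continuous_subspaceT => t; exact: continuous_cos.
have [c] := @MVT R _ _ 0 y y0 D K.
rewrite in_itv /= => /andP[c0 cy]; rewrite cos0 !subr0 => ->.
rewrite normrM normrN expr2 [`|y|]gtr0_norm // ler_wpM2r ?(ltW y0) //.
by rewrite (le_trans (sin_le _)) // gtr0_norm // ltW.
Qed.

Lemma cexp_split w : cexp w = (expR (complex.Re w))%:C *
  (1 + ((cos (complex.Im w) - 1) +i* sin (complex.Im w))).
Proof. by rewrite /cexp; congr (_ * _); apply/eqP; rewrite eq_complex /= addrC subrK add0r !eqxx. Qed.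

Lemma cis_sub1_le y : normc ((cos y - 1) +i* sin y) <= 2 * `|y|.
Proof.
apply: (le_trans (ler_normc_ReIm _)) => /=.
by rewrite mulr_natl mulr2n lerD ?cos_sub1_le ?sin_le.
Qed.

Lemma cexp_sub1_le w : normc (cexp w - 1) <= 3 * (normc w * expR (normc w)).
Proof.
have hx := ler_normc_Re w; have hy := ler_normc_Im w.
set x := complex.Re w in hx *; set y := complex.Im w in hy *.
have -> : cexp w - 1 = (expR x - 1)%:C + (expR x)%:C * ((cos y - 1) +i* sin y).
  by rewrite cexp_split -/x -/y rmorphB /=; ring.
apply: (le_trans (le_normcD _ _)); rewrite normcM !normc_real.
have e1 : expR x <= expR (normc w) by rewrite ler_expR (le_trans (ler_norm _)).
have e2 : expR `|x| <= expR (normc w) by rewrite ler_expR.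
rewrite [`|expR x|]ger0_norm ?expR_ge0 //.
have -> : 3 * (normc w * expR (normc w)) =
  normc w * expR (normc w) + expR (normc w) * (2 * normc w) by ring.
apply: lerD.
  by rewrite (le_trans (expR_sub1_le _)) // ler_pM ?expR_ge0.
by rewrite ler_pM ?expR_ge0 ?normc_ge0 // (le_trans (cis_sub1_le _)) // ler_pM2l.
Qed.

Lemma cexp_sub1w_le w : normc (cexp w - 1 - w) <= 5 * (normc w ^+ 2 * expR (normc w)).
Proof.
have hx := ler_normc_Re w; have hy := ler_normc_Im w.
set x := complex.Re w in hx *; set y := complex.Im w in hy *.
have E0 := expR_gt0 (normc w).
have e2 : expR `|x| <= expR (normc w) by rewrite ler_expR.
have e3 : 1 <= expR (normc w).
  by rewrite (le_trans _ (expR_ge1Dx _)) // lerDl normc_ge0.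
have n0 := normc_ge0 w.
have -> : cexp w - 1 - w = (expR x - 1 - x)%:C +
   (expR x - 1)%:C * ((cos y - 1) +i* sin y) + ((cos y - 1) +i* (sin y - y)).
  have Ew : w = x +i* y by rewrite /x /y; case: (w).
  rewrite cexp_split -/x -/y {}Ew; move: (x) (y) => a b.
  by apply/eqP; rewrite eq_complex /=; apply/andP; split; apply/eqP; ring.
apply: (le_trans (le_normcD _ _)).
have -> : 5 * (normc w ^+ 2 * expR (normc w)) =
  normc w ^+ 2 * expR (normc w) + (normc w * expR (normc w)) * (2 * normc w) +
  (normc w ^+ 2 * expR (normc w) + normc w ^+ 2 * expR (normc w)) by ring.
have x2 : x ^+ 2 <= normc w ^+ 2 by rewrite -(real_normK (num_real _)) lerXn2r ?nnegrE.
have y2 : y ^+ 2 <= normc w ^+ 2 * expR (normc w).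
  have : y ^+ 2 <= normc w ^+ 2 by rewrite -(real_normK (num_real _)) lerXn2r ?nnegrE.
  by move=> /le_trans; apply; rewrite ler_peMr // exprn_ge0.
apply: lerD.
  apply: (le_trans (le_normcD _ _)); apply: lerD.
    rewrite normc_real; have /andP[p1 p2] := expR_sub1x_le x.
    by rewrite ger0_norm // (le_trans p2) // ler_pM ?expR_ge0 ?sqr_ge0.
  rewrite normcM normc_real ler_pM ?normc_ge0 //.
    by rewrite (le_trans (expR_sub1_le _)) // ler_pM ?expR_ge0.
  by rewrite (le_trans (cis_sub1_le _)) // ler_pM2l.
apply: (le_trans (ler_normc_ReIm _)) => /=.
by rewrite lerD // (le_trans _ y2) // ?cos_sub1_le2 ?sin_sub_le.
Qed.

End Exp.

(** * Abel summation, double series, term-by-term limits, infinite products *)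

Section SeriesTools.
Variable R : realType.
Local Notation C := (R[i]^o).

Lemma psum1 (V : zmodType) (u : nat -> V) : psum u 1 = 0.
Proof. by rewrite /psum big_geq. Qed.

Lemma psum0 (V : zmodType) (u : nat -> V) : psum u 0 = 0.
Proof. by rewrite /psum big_geq. Qed.

Lemma sumleM (M : nat -> R) (A B : R) : 0 <= A -> sumle M B ->
  sumle (fun n => A * M n) (A * B).
Proof.
move=> A0 [M0 MB]; split => [n n0|N]; first by rewrite mulr_ge0 ?M0.
by rewrite /psum -mulr_sumr ler_wpM2l ?MB.
Qed.

Lemma sumle_dom (M M' : nat -> R) (B : R) : sumle M B ->
  (forall n, (0 < n)%N -> 0 <= M' n <= M n) -> sumle M' B.
Proof.
move=> [M0 MB] H; split=> [n /H/andP[]//|N].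
by rewrite (le_trans _ (MB N)) //; apply: ler_sum_nat => n /andP[/H/andP[]].
Qed.

Lemma sumle_ge0 (M : nat -> R) B : sumle M B -> 0 <= B.
Proof. by case=> _ /(_ 0%N); rewrite psum0. Qed.

Lemma cvgC_mul0 (f g : nat -> R[i]) (A : R) :
  (forall n, normc (f n) <= A) -> (g n : C) @[n --> \oo] --> (0 : C) ->
  (f n * g n : C) @[n --> \oo] --> (0 : C).
Proof.
move=> fA /cvgC_norm g0.
apply: (@cvgC_bound _ _ _ _ _ _ (fun n => A * normc (g n - 0))).
  by apply: nearW => n; rewrite !subr0 normcM ler_wpM2r ?normc_ge0.
by rewrite -(mulr0 A); apply: cvgM => //; exact: cvg_cst.
Qed.

(** Summation by parts: the partial sums of [c n * phi n] are, up to a boundary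
    term that vanishes in the limit, those of [psum c n.+1 * (phi n - phi n.+1)],
    which are dominated by [A * M]. *)
Lemma bv_test (c phi : nat -> R[i]) (A B : R) (M : nat -> R) :
  (forall N, normc (psum c N) <= A) -> sumle M B ->
  (forall n, (0 < n)%N -> normc (phi n - phi n.+1) <= M n) ->
  (phi n : C) @[n --> \oo] --> (0 : C) ->
  exists l : C, [/\ (psum (fun n => c n * phi n) N : C) @[N --> \oo] --> l &
                    normc l <= A * B].
Proof.
move=> cA MB phiM phi0.
have A0 : 0 <= A by rewrite (le_trans _ (cA 0%N)) ?normc_ge0.
pose v n := psum c n.+1 * (phi n - phi n.+1).
have [n n0|l [vl lB]] := @dom_cvgC _ (fun n => A * M n) v (A * B) (sumleM A0 MB).
  by rewrite normcM ler_pM ?normc_ge0 ?phiM.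
exists l; split; last exact: lB.
have E N : psum (fun n => c n * phi n) N = psum c N * phi N + psum v N.
  elim: N => [|[|N] IH]; first by rewrite !psum0 mul0r add0r.
    by rewrite !psum1 mul0r add0r.
  by rewrite psumS // IH [psum v N.+2]psumS // /v [psum c N.+2]psumS //; ring.
under eq_fun do rewrite E.
rewrite -(add0r l); apply: cvgD; last exact: vl.
exact: cvgC_mul0 cA phi0.
Qed.

(** The [k]-th term of a double series rearranged along the hyperbolas
    [n * m = k]: a Dirichlet convolution when [u n m = a n * b m]. *)
Definition divisor_sum (V : zmodType) (u : nat -> nat -> V) (k : nat) : V :=
  \sum_(1 <= n < k.+1 | (n %| k)%N) u n (k %/ n)%N.

Lemma psum_divisor_sum (V : zmodType) (u : nat -> nat -> V) N :
  psum (divisor_sum u) N = \sum_(1 <= n < N) \sum_(1 <= m < N | (n * m < N)%N) u n m.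
Proof.
rewrite /psum.
transitivity (\sum_(1 <= k < N) \sum_(1 <= n < N) \sum_(1 <= m < N | k == (n * m)%N) u n m).
  apply: eq_big_nat => k /andP[k1 kN].
  rewrite /divisor_sum (big_nat_widen _ _ N) // big_mkcond /=.
  apply: eq_big_nat => n /andP[n1 nN].
  have [/dvdnP[q kq]|ndv] := boolP (n %| k)%N; last first.
    rewrite /= big1_seq // => m /andP[/eqP km _].
    by move: ndv; rewrite km dvdn_mulr.
  have q0 : (0 < q)%N by move: k1; rewrite kq; case: (q).
  have nk : (n <= k)%N by rewrite kq leq_pmull.
  rewrite /= ltnS nk kq mulnK // (eq_bigl (fun m => m == q)); last first.
    by move=> m; rewrite mulnC eqn_pmul2l // eq_sym.
  rewrite big_nat1_eq ifT // q0 /= (leq_trans _ kN) // ltnS kq.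
  by rewrite leq_pmulr.
rewrite exchange_big /=; apply: eq_big_nat => n /andP[n1 nN].
rewrite (exchange_big_dep predT) //= [RHS]big_mkcond /=.
apply: eq_big_nat => m /andP[m1 mN].
rewrite big_nat1_eq muln_gt0 n1 m1 /=; by case: ifP.
Qed.

Definition square_sum (V : zmodType) (u : nat -> nat -> V) N :=
  \sum_(1 <= n < N) \sum_(1 <= m < N) u n m.

Lemma square_sum_split (V : zmodType) (u : nat -> nat -> V) N :
  square_sum u N = psum (divisor_sum u) N + \sum_(1 <= n < N) \sum_(1 <= m < N | (N <= n * m)%N) u n m.
Proof.
rewrite psum_divisor_sum -big_split /=; apply: eq_bigr => n _.
rewrite (bigID (fun m => (n * m < N)%N)) /=; congr (_ + _).
by apply: eq_bigl => m; rewrite -leqNgt.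
Qed.

(** The square and the hyperbolic partial sums of order [N] differ by pairs with
    [N <= n * m].  When [K * K <= N] none of these lies in the square of side
    [K], so their contribution is at most a tail of the absolutely convergent
    double series. *)
Lemma hyperbola_cvg (u : nat -> nat -> R[i]) (B : R) (l : C) :
  (forall N, square_sum (fun n m => normc (u n m)) N <= B) ->
  (square_sum u N : C) @[N --> \oo] --> l ->
  (psum (divisor_sum u) N : C) @[N --> \oo] --> l.
Proof.
move=> uB ul.
set s := square_sum (fun n m => normc (u n m)) in uB.
have u0 n m : 0 <= normc (u n m) by exact: normc_ge0.
have sE N : s N = psum (fun n => psum (fun m => normc (u n m)) N) N by [].
have snd : {homo s : n m / (n <= m)%N >-> n <= m}.
  move=> N K NK; rewrite !sE.
  apply: (@le_trans _ _ (psum (fun n => psum (fun m => normc (u n m)) K) N)).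
    by apply: ler_sum => n _; exact: psum_nd.
  by apply: psum_nd => // n _; apply: sumr_ge0.
have diff N K : (0 < K)%N -> (K * K <= N)%N ->
    \sum_(1 <= n < N) \sum_(1 <= m < N | (N <= n * m)%N) normc (u n m) <= s N - s K.
  move=> K0 KN; rewrite lerBrDr.
  have KN' : (K <= N)%N by rewrite (leq_trans _ KN) // leq_pmulr.
  rewrite {2}/s square_sum_split addrC lerD2r psum_divisor_sum sE.
  apply: (@le_trans _ _ (\sum_(1 <= n < K) \sum_(1 <= m < N | (n * m < N)%N) normc (u n m))).
    apply: ler_sum_nat => n /andP[n1 nK].
    rewrite /psum (big_nat_widen _ _ N) // big_mkcond [leRHS]big_mkcond /=.
    apply: ler_sum => m _; case: ifP => mK; last by case: ifP.
    by rewrite ifT // (leq_trans _ KN) // ltn_mul.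
  by apply: psum_nd => // n _; apply: sumr_ge0.
have cs : cvgn s.
  by apply: nondecreasing_is_cvgn => //; exists B => _ [n _ <-].
apply/cvgC_norm; apply/cvgrPdist_lt => e e0.
have e20 : 0 < e / 2 by rewrite divr_gt0.
have /cvgrPdist_lt/(_ _ e20)[K _ HK] := cs.
have /cvgC_norm/cvgrPdist_lt/(_ _ e20)[N0 _ HN] := ul.
(* [N0] controls the square sums, and [K.+1] the tail of the sums of norms. *)
exists (maxn N0 (K.+1 * K.+1)) => // N /=; rewrite geq_max => /andP[N1 N2].
rewrite sub0r normrN ger0_norm ?normc_ge0 //.
have := HN N N1; rewrite /= sub0r normrN ger0_norm ?normc_ge0 // => h1.
have := HK K.+1 (leqnSn K); rewrite ger0_norm ?subr_ge0 ?nondecreasing_cvgn_le // => h2.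
have h3 := nondecreasing_cvgn_le snd cs N.
have h4 := diff N K.+1 isT N2.
have -> : psum (divisor_sum u) N - l = (square_sum u N - l) -
  \sum_(1 <= n < N) \sum_(1 <= m < N | (N <= n * m)%N) u n m.
  by rewrite square_sum_split; ring.
apply: (le_lt_trans (normcB _ _)).
have h5 : normc (\sum_(1 <= n < N) \sum_(1 <= m < N | (N <= n * m)%N) u n m) <=
  \sum_(1 <= n < N) \sum_(1 <= m < N | (N <= n * m)%N) normc (u n m).
  apply: (le_trans (normc_sum _ _ _)); apply: ler_sum => n _; exact: normc_sum.
lra.
Qed.

Lemma dirichlet_product (a b : nat -> R[i]) (A B : R) (la lb : C) :
  (forall N, psum (fun n => normc (a n)) N <= A) ->
  (forall N, psum (fun n => normc (b n)) N <= B) ->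
  (psum a N : C) @[N --> \oo] --> la ->
  (psum b N : C) @[N --> \oo] --> lb ->
  (psum (divisor_sum (fun n m => a n * b m)) N : C) @[N --> \oo] --> (la * lb : C).
Proof.
move=> aA bB al bl.
have sqE (V : comNzRingType) (f g : nat -> V) N :
    square_sum (fun n m => f n * g m) N = psum f N * psum g N.
  by rewrite /psum mulr_suml; apply: eq_bigr => n _; rewrite mulr_sumr.
apply: (@hyperbola_cvg _ (A * B)).
  move=> N; rewrite (_ : square_sum _ N = psum (fun n => normc (a n)) N * psum (fun n => normc (b n)) N).
    by rewrite ler_pM ?sumr_ge0 // => *; exact: normc_ge0.
  by rewrite -sqE; apply: eq_bigr => n _; apply: eq_bigr => m _; rewrite normcM.
under eq_fun do rewrite sqE.
exact: (cvgM al bl).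
Qed.

Lemma cvg_psum (K : numFieldType) (V : normedModType K) (T : Type) (F : set_system T)
  {FF : Filter F} (u : T -> nat -> V) (v : nat -> V) (N : nat) :
  (forall n, (0 < n)%N -> u x n @[x --> F] --> v n) ->
  psum (u x) N @[x --> F] --> psum v N.
Proof.
move=> uv; elim: N => [|[|N] IH].
- by rewrite psum0; under eq_fun do rewrite psum0; exact: cvg_cst.
- by rewrite psum1; under eq_fun do rewrite psum1; exact: cvg_cst.
rewrite psumS //; under eq_fun do rewrite psumS //.
by apply: cvgD => //; exact: uv.
Qed.

Lemma dom_tail (M u : nat -> R) (B : R) (N : nat) : sumle M B ->
  (forall n, (0 < n)%N -> `|u n| <= M n) ->
  `|limn (psum u) - psum u N| <= limn (psum M) - psum M N.
Proof.
move=> MB uM.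
have cM := sumle_cvg MB; have cu := dom_cvgR MB uM.
have c1 : (fun K => `|psum u K - psum u N|) @ \oo --> `|limn (psum u) - psum u N|.
  by apply: cvg_norm; apply: cvgB cu _; exact: cvg_cst.
have c2 : (fun K => psum M K - psum M N) @ \oo --> limn (psum M) - psum M N.
  by apply: cvgB cM _; exact: cvg_cst.
apply: (ler_cvg_to c1 c2); exists (maxn 1 N) => // K /=; rewrite geq_max => /andP[K1 NK].
have [N0|N0] := posnP N.
  rewrite N0 !psum0 !subr0 (le_trans (ler_norm_sum _ _ _)) //.
  by apply: ler_sum_nat => n /andP[n1 _]; exact: uM.
have E (v : nat -> R) : psum v K - psum v N = \sum_(N <= n < K) v n.
  by rewrite /psum (big_cat_nat _ (n := N)) //= addrAC subrr add0r.
rewrite !E (le_trans (ler_norm_sum _ _ _)) //.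
by apply: ler_sum_nat => n /andP[n1 _]; apply: uM; rewrite (leq_trans N0).
Qed.

(** Tannery's theorem: beyond a fixed rank the domination makes both series small
    uniformly in [x], and the finitely many other terms converge. *)
Lemma tannery (T : Type) (F : set_system T) {FF : ProperFilter F}
  (u : T -> nat -> R) (v M : nat -> R) (B : R) :
  sumle M B ->
  (\forall x \near F, forall n, (0 < n)%N -> `|u x n| <= M n) ->
  (forall n, (0 < n)%N -> u x n @[x --> F] --> v n) ->
  cvgn (psum v) /\ limn (psum (u x)) @[x --> F] --> limn (psum v).
Proof.
move=> MB uM uv.
have vM n : (0 < n)%N -> `|v n| <= M n.
  move=> n0; have c : `|u x n| @[x --> F] --> `|v n| by apply: cvg_norm; exact: uv.
  rewrite -(cvg_lim _ c) //; apply: limr_le; first by apply/cvg_ex; eexists; exact: c.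
  by apply: filterS uM => x; exact.
split; first exact: dom_cvgR MB vM.
apply/cvgrPdist_lt => e e0.
have e30 : 0 < e / 3 by rewrite divr_gt0.
have /cvgrPdist_lt/(_ _ e30)[N _ /(_ N (leqnn N)) HN] := sumle_cvg MB.
have /cvgrPdist_lt/(_ _ e30) cN : psum (u x) N @[x --> F] --> psum v N.
  exact: cvg_psum.
near=> x.
have Hx : forall n, (0 < n)%N -> `|u x n| <= M n by near: x.
have h1 := dom_tail N MB Hx.
have h2 := dom_tail N MB vM.
have h3 : `|psum v N - psum (u x) N| < e / 3 by near: x.
have h4 := le_lt_trans (ler_norm _) HN.
have -> : limn (psum v) - limn (psum (u x)) = (limn (psum v) - psum v N) +
  (psum v N - psum (u x) N) - (limn (psum (u x)) - psum (u x) N) by ring.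
apply: (le_lt_trans (ler_normB _ _)).
apply: (le_lt_trans (lerD (ler_normD _ _) (lexx _))).
lra.
Unshelve. all: by end_near. Qed.

(** Expanding the product gives [1], then the sum of the [e n], then products of
    several of them; these are dominated by the corresponding terms in the
    expansion of the exponential of the sum of the [M n]. *)
Lemma prod_sub1_le (e : nat -> R[i]) (M : nat -> R) (N : nat) :
  (forall n, (0 < n)%N -> normc (e n) <= M n) ->
  let P := \prod_(1 <= n < N) (1 + e n) in
  normc (P - 1) <= expR (psum M N) - 1 /\
  normc (P - 1 - psum e N) <= expR (psum M N) - 1 - psum M N.
Proof.
move=> eM; elim: N => [|[|N] IH].
- by rewrite /= !psum0 big_geq // subrr subr0 normc0 expR0 subrr subr0.
- by rewrite /= !psum1 big_geq // subrr subr0 normc0 expR0 subrr subr0.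
rewrite big_nat_recr //= [psum e N.+2]psumS // [psum M N.+2]psumS //.
move: IH => /=.
set P := \prod_(_ <= _ < _) _; set S := psum e _; set T := psum M _ => -[h1 h2].
have eN := eM N.+1 isT; set f := e N.+1 in eN *; set m := M N.+1 in eN *.
have f0 := normc_ge0 f; have m0 : 0 <= m := le_trans f0 eN.
have k : expR T * (1 + m) <= expR (T + m).
  by rewrite expRD ler_pM2l ?expR_gt0 // expR_ge1Dx.
have p0 := normc_ge0 (P - 1).
have h3 : normc (f * (P - 1)) <= m * (expR T - 1) by rewrite normcM ler_pM ?normc_ge0.
split.
  have -> : P * (1 + f) - 1 = (P - 1) + f * (P - 1) + f by ring.
  apply: (le_trans (le_normcD _ _)).
  apply: (le_trans (lerD (le_normcD _ _) (lexx _))).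
  lra.
have -> : P * (1 + f) - 1 - (S + f) = (P - 1 - S) + f * (P - 1) by ring.
apply: (le_trans (le_normcD _ _)).
lra.
Qed.

(** The partial products [P n] are bounded by [expR B], so their increments
    [P n * e n] are summable. *)
Lemma prod_cvg (e : nat -> R[i]) (M : nat -> R) (B : R) :
  sumle M B -> (forall n, (0 < n)%N -> normc (e n) <= M n) ->
  exists l : C, (\prod_(1 <= n < N) (1 + e n) : C) @[N --> \oo] --> l.
Proof.
move=> MB eM.
pose P N := \prod_(1 <= n < N) (1 + e n).
have PB N : normc (P N) <= expR B.
  have [h _] := prod_sub1_le N eM.
  rewrite -(subrK 1 (P N)) (le_trans (le_normcD _ _)) // normc1.
  by rewrite -lerBrDr (le_trans h) // lerB // ler_expR; case: MB.
have [n n0|l [vl _]] := @dom_cvgC _ (fun n => expR B * M n) (fun n => P n * e n)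
    (expR B * B) (sumleM (expR_ge0 _) MB).
  by rewrite normcM ler_pM ?normc_ge0 ?eM.
exists (1 + l).
have E N : \prod_(1 <= n < N) (1 + e n) = 1 + psum (fun n => P n * e n) N.
  elim: N => [|[|N] IH]; first by rewrite psum0 big_geq // addr0.
    by rewrite psum1 big_geq // addr0.
  by rewrite psumS // big_nat_recr //= IH /P {}IH; ring.
under eq_fun do rewrite E.
by apply: cvgD; [exact: cvg_cst|exact: vl].
Qed.

End SeriesTools.

(** * The weights n^(-s) and Abel summation against them *)

Section Weights.
Variable R : realType.
Local Notation C := (R[i]^o).
Implicit Types (n : nat) (x s : R).

(** The real restriction of [npowN], on which order arguments are made. *)
Definition npw n s : R := expR (- s * ln n%:R).

Lemma npw_gt0 n s : 0 < npw n s. Proof. exact: expR_gt0. Qed.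
Lemma npw_ge0 n s : 0 <= npw n s. Proof. exact: expR_ge0. Qed.

Lemma npowN_real n s : npowN n s%:C = (npw n s)%:C.
Proof.
by rewrite /npowN -(rmorphN (real_complex R)) -(rmorphM (real_complex R)) cexp_real.
Qed.

Lemma npwD n s t : npw n (s + t) = npw n s * npw n t.
Proof. by rewrite /npw -expRD -mulrDl opprD. Qed.

Lemma npw1 n : (0 < n)%N -> npw n 1 = n%:R^-1.
Proof. by move=> n0; rewrite /npw mulN1r expRN lnK // posrE ltr0n. Qed.

Lemma npwM n m s : (0 < n)%N -> (0 < m)%N -> npw (n * m) s = npw n s * npw m s.
Proof. by move=> n0 m0; rewrite /npw natrM lnM ?posrE ?ltr0n // mulrDr expRD. Qed.

Lemma npw_1n s : npw 1 s = 1.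
Proof. by rewrite /npw ln1 mulr0 expR0. Qed.

Lemma lnn_ge0 n : 0 <= ln (n%:R : R).
Proof. by case: n => [|n]; [rewrite ln0|rewrite ln_ge0 // ler1n]. Qed.

Lemma le_npw n s t : s <= t -> npw n t <= npw n s.
Proof. by move=> st; rewrite ler_expR ler_wpM2r ?lnn_ge0 // lerN2. Qed.

(** The step of [ln n], which plays the role of [dx] in the comparison of sums
    over [n] with integrals in [x = ln n]. *)
Definition dln n : R := ln n.+1%:R - ln n%:R.

Lemma dlnE n : ln n.+1%:R = ln n%:R + dln n :> R.
Proof. by rewrite /dln addrC subrK. Qed.

Lemma dln_bounds n : (0 < n)%N -> (n.+1%:R^-1 : R) <= dln n <= (n%:R^-1 : R).
Proof.
move=> n0; have n0' : (0 : R) < n%:R by rewrite ltr0n.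
have n1' : (0 : R) < n.+1%:R by rewrite ltr0n.
have E : (n.+1%:R : R) = n%:R + 1 by rewrite -natr1.
rewrite /dln; apply/andP; split.
  rewrite -opprB -ln_div ?posrE // lerNr.
  have -> : (n%:R / n.+1%:R : R) = 1 + - n.+1%:R^-1.
    by rewrite E; field; rewrite -E gt_eqF.
  by apply: le_ln1Dx; rewrite ltrNr opprK invf_lt1 // ltr1n.
rewrite -ln_div ?posrE //.
have -> : (n.+1%:R / n%:R : R) = 1 + n%:R^-1 by rewrite E; field; rewrite gt_eqF.
by apply: le_ln1Dx; rewrite (lt_trans (ltrN10 R)) // invr_gt0.
Qed.

Lemma dln_ge0 n : (0 < n)%N -> 0 <= dln n.
Proof. by move=> /dln_bounds/andP[+ _]; apply: le_trans; rewrite invr_ge0. Qed.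

Lemma dln_le1 n : (0 < n)%N -> dln n <= 1.
Proof.
move=> n0; have /andP[_ h] := dln_bounds n0; apply: (le_trans h).
by rewrite invf_le1 ?ltr0n // ler1n.
Qed.

Lemma invS_sub n : (0 < n)%N -> n%:R^-1 - n.+1%:R^-1 <= (n%:R^-1) ^+ 2 :> R.
Proof.
move=> n0; have n0' : (0 : R) < n%:R by rewrite ltr0n.
have n1' : (0 : R) < n.+1%:R by rewrite ltr0n.
have -> : n%:R^-1 - n.+1%:R^-1 = n%:R^-1 * n.+1%:R^-1 :> R.
  by rewrite -natr1; field; rewrite natr1 !gt_eqF.
by rewrite expr2 ler_pM2l ?invr_gt0 // lef_pV2 ?posrE // ler_nat.
Qed.

Lemma dln_inv n : (0 < n)%N -> 0 <= n%:R^-1 - dln n <= (n%:R^-1) ^+ 2.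
Proof.
move=> n0; have /andP[h1 h2] := dln_bounds n0.
by rewrite subr_ge0 h2 /= (le_trans _ (invS_sub n0)) // lerD2l lerN2.
Qed.

(** With [s = 1 + t], the term [(n+1)^(-1-t)] is at most a constant times
    [n^(-t) - (n+1)^(-t)], and these differences telescope. *)
Lemma sum_npw s : 1 < s -> exists B, sumle (fun n => npw n s) B.
Proof.
move=> s1; pose t := s - 1; have t0 : 0 < t by rewrite /t; lra.
have sE : s = 1 + t by rewrite /t; lra.
have step n : (0 < n)%N -> npw n.+1 s <= (1 + t) / t * (npw n t - npw n.+1 t).
  move=> n0; have /andP[h1 _] := dln_bounds n0.
  have n1' : (0 : R) < n.+1%:R by rewrite ltr0n.
  have E : npw n t = npw n.+1 t * expR (t * dln n).
    by rewrite /npw -expRD; congr expR; rewrite dlnE; ring.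
  have e := expR_ge1Dx (t * dln n).
  have p := npw_gt0 n.+1 t.
  rewrite sE npwD npw1 // E.
  have -> : (1 + t) / t * (npw n.+1 t * expR (t * dln n) - npw n.+1 t) =
    npw n.+1 t * ((1 + t) * ((expR (t * dln n) - 1) / t)) by field; lra.
  rewrite mulrC ler_pM2l //.
  have : dln n <= (expR (t * dln n) - 1) / t by rewrite ler_pdivlMr // mulrC; lra.
  move=> h2; apply: (le_trans h1); apply: (le_trans h2).
  apply: ler_peMl; last by rewrite lerDl ltW.
  by apply: le_trans h2; rewrite dln_ge0.
exists (1 + (1 + t) / t); split => [n _|N]; first exact: npw_ge0.
case: N => [|[|N]].
- by rewrite psum0 addr_ge0 // divr_ge0 // ?ltW // addr_gt0.
- by rewrite psum1 addr_ge0 // divr_ge0 // ?ltW // addr_gt0.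
have c0 : 0 <= (1 + t) / t by rewrite divr_ge0 // ?ltW // addr_gt0.
apply: (@le_trans _ _ (1 + (1 + t) / t * (1 - npw N.+1 t))); last first.
  by rewrite lerD2l ler_piMr // gerBl npw_ge0.
elim: N => [|N IH].
  by rewrite psumS // psum1 add0r !npw_1n subrr mulr0 addr0.
rewrite psumS //; have := step N.+1 isT.
move: IH; set a := psum _ _; set c := _ / t; move: (npw _ s) => b.
by lra.
Qed.

Lemma le_1x_expR x (e : R) : 0 < e -> 0 <= x -> 1 + x <= (1 + e^-1) * expR (e * x).
Proof.
move=> e0 x0; have h := expR_ge1Dx (e * x).
have h1 : 1 <= expR (e * x) by rewrite (le_trans _ h) // lerDl mulr_ge0 // ltW.
have h2 : x <= e^-1 * expR (e * x).
  by rewrite ler_pdivlMl //; lra.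
lra.
Qed.

(** A power of the logarithm is absorbed by [n^e] with [e] so small that half of
    the margin [s - 1] remains. *)
Lemma sum_ln_npw (k : nat) s : 1 < s ->
  exists B, sumle (fun n => (1 + ln n%:R) ^+ k * npw n s) B.
Proof.
move=> s1.
have k0 : (0 : R) < k.+1%:R by rewrite ltr0n.
(* [k.+1] rather than [k], so that [e] is defined for [k = 0]. *)
pose e := (s - 1) / 2 / k.+1%:R.
have e0 : 0 < e by rewrite !divr_gt0 // subr_gt0.
have [|B HB] := @sum_npw ((1 + s) / 2); first lra.
exists ((1 + e^-1) ^+ k * B).
apply: sumle_dom (sumleM _ HB) _.
  by rewrite exprn_ge0 // addr_ge0 // invr_ge0 ltW.
move=> n n0; have l0 := lnn_ge0 n.
have l1 : 0 <= 1 + ln (n%:R : R) by rewrite addr_ge0.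
rewrite mulr_ge0 ?npw_ge0 ?exprn_ge0 //=.
apply: (@le_trans _ _ (((1 + e^-1) * expR (e * ln n%:R)) ^+ k * npw n s)).
  rewrite ler_wpM2r ?npw_ge0 // lerXn2r ?nnegrE ?le_1x_expR //.
  by rewrite mulr_ge0 ?expR_ge0 // addr_ge0 // invr_ge0 ltW.
rewrite exprMn -mulrA ler_wpM2l ?exprn_ge0 ?addr_ge0 // ?invr_ge0 ?(ltW e0) //.
rewrite -expRM_natl /npw -expRD ler_expR.
have : k%:R * e <= (s - 1) / 2.
  rewrite /e mulrCA ler_piMr //; first lra.
  by rewrite ler_pdivrMr // mul1r ler_nat.
move: (k%:R) => K.
nra.
Qed.

Lemma npw_cvg0 s : 0 < s -> npw n s @[n --> \oo] --> (0 : R).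
Proof.
move=> s0; apply/cvgrPdist_lt => e e0.
exists (Num.bound (expR (- ln e / s))).+1 => // n /= Hn.
rewrite sub0r normrN ger0_norm ?npw_ge0 // /npw.
have h : expR (- ln e / s) < n%:R.
  apply: (lt_le_trans (archi_boundP (expR_ge0 _))).
  by rewrite ler_nat (leq_trans (leqnSn _)).
have n0 : (0 : R) < n%:R by apply: lt_trans h; exact: expR_gt0.
rewrite -[ltRHS]lnK ?posrE // ltr_expR mulNr ltrNl mulrC -ltr_pdivrMr //.
by rewrite -ltr_expR lnK // posrE.
Qed.

(** Conditions on [g] under which the weights [n^(-1) g(ln n)] have summable
    variation.  With [x = ln n] the factor [expR (x / 4)] is [n^(1/4)], and the
    steps [v <= 1] cover the increments [ln n.+1 - ln n <= 1/n]. *)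
Definition tame (g : R -> R[i]) (K : R) :=
  (forall x, 0 <= x -> normc (g x) <= K * expR (x / 4)) /\
  (forall x v, 0 <= x -> 0 <= v <= 1 ->
     normc (g (x + v) - g x) <= K * (v * expR (x / 4))).

(** The variation of [n^(-1) g(ln n)] between [n] and [n+1] is at most
    [2 K n^(-7/4)].  The bound on the sum is linear in [K] with a factor [B0]
    independent of [g]: a family of weights whose constants [K] tend to zero
    gives sums that tend to zero at the same rate. *)
Lemma tame_test : exists B0 : R, forall (c : nat -> R[i]) (A K : R) (g : R -> R[i]),
  (forall N, normc (psum c N) <= A) -> tame g K ->
  exists l : C, [/\ (psum (fun n => c n * (n%:R^-1%:C * g (ln n%:R))) N : C) @[N --> \oo] --> l
                  & normc l <= A * (K * B0)].
Proof.
have [|B HB] := @sum_npw (7 / 4); first lra.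
exists (2 * B) => c A K g cA [g1 g2].
have K0 : 0 <= K.
  by have := g1 0 (lexx _); rewrite mul0r expR0 mulr1; apply: le_trans; exact: normc_ge0.
have -> : K * (2 * B) = (2 * K) * B by ring.
have E1 n : (0 < n)%N -> npw n (3/4) = n%:R^-1 * expR (ln n%:R / 4).
  by move=> n0; rewrite -(npw1 n0) /npw -expRD; congr expR; field.
have E2 n : (0 < n)%N -> npw n (7/4) = n%:R^-1 ^+ 2 * expR (ln n%:R / 4).
  by move=> n0; rewrite -(npw1 n0) /npw -expRM_natl -expRD; congr expR; field.
apply: (@bv_test _ c _ A (2 * K * B) (fun n => 2 * K * npw n (7/4))) => //.
- by apply: sumleM => //; rewrite mulr_ge0.
- move=> n n0; have n0' : (0 : R) < n%:R by rewrite ltr0n.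
  have /andP[h1 h2] := dln_bounds n0.
  have -> : n%:R^-1%:C * g (ln n%:R) - n.+1%:R^-1%:C * g (ln n.+1%:R) =
     (n%:R^-1 - n.+1%:R^-1)%:C * g (ln n%:R) -
      n.+1%:R^-1%:C * (g (ln n%:R + dln n) - g (ln n%:R)).
    by rewrite dlnE rmorphB /=; ring.
  apply: (le_trans (normcB _ _)); rewrite !normcM !normc_real.
  have -> : 2 * K * npw n (7 / 4) = n%:R^-1 ^+ 2 * (K * expR (ln n%:R / 4)) +
     n%:R^-1 * (K * (n%:R^-1 * expR (ln n%:R / 4))).
    by rewrite E2 //; ring.
  apply: lerD.
    have h5 : n.+1%:R^-1 <= (n%:R^-1 : R) by apply: le_trans h1 h2.
    rewrite ler_pM ?normc_ge0 // ?g1 ?lnn_ge0 // ger0_norm ?subr_ge0 //.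
    exact: invS_sub.
  rewrite ler_pM ?normc_ge0 //.
    by rewrite ger0_norm ?invr_ge0 // lef_pV2 ?posrE ?ltr0n // ler_nat.
  apply: (le_trans (g2 _ _ (lnn_ge0 n) _)); first by rewrite dln_ge0 // dln_le1.
  by rewrite ler_wpM2l // ler_wpM2r ?expR_ge0.
- apply: (@cvgC_bound _ _ _ _ _ _ (fun n => K * npw n (3/4))); last first.
    rewrite -(mulr0 K); apply: cvgM; first exact: cvg_cst.
    by apply: npw_cvg0; lra.
  exists 1%N => // n /= n0; rewrite subr0 normcM normc_real E1 // mulrCA.
  by rewrite ler_pM ?normc_ge0 ?g1 ?lnn_ge0 // ger0_norm // invr_ge0.
Qed.

Lemma sqr_le_exp x : 0 <= x -> x ^+ 2 <= 16 * 16 * expR (x / 8).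
Proof.
move=> x0; have h := expR_ge1Dx (x / 16).
have -> : expR (x / 8) = expR (x / 16) ^+ 2 by rewrite -expRM_natl; congr expR; field.
have : x <= 16 * expR (x / 16) by lra.
by nra.
Qed.

Lemma lin_le_exp x : 0 <= x -> x <= 8 * expR (x / 8).
Proof. by move=> x0; have := expR_ge1Dx (x / 8); lra. Qed.

End Weights.

(** * Exponential weights and their Taylor remainders *)

Section AtOne.
Variable R : realType.
Local Notation C := (R[i]^o).
Implicit Types (n : nat) (x v : R) (h : R[i]).

Lemma expR_ge1 x : 0 <= x -> 1 <= expR x.
Proof. by move=> x0; rewrite -[leLHS]expR0 ler_expR. Qed.

Lemma exp_quarter x : expR (x / 8) * expR (x / 8) = expR (x / 4) :> R.
Proof. by rewrite -expRD; congr expR; field. Qed.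

Lemma exp_8_4 x : 0 <= x -> expR (x / 8) <= expR (x / 4) :> R.
Proof. by move=> x0; rewrite ler_expR; lra. Qed.

Lemma normc_hx h x : 0 <= x -> normc (- h * x%:C) = normc h * x.
Proof. by move=> x0; rewrite normcM normcN normc_real ger0_norm. Qed.

Lemma exp_hx h x : 0 <= x -> normc h <= 8^-1 -> expR (normc h * x) <= expR (x / 8).
Proof. by move=> x0 h8; rewrite ler_expR mulrC ler_wpM2l. Qed.

Lemma normc_cexp_le (w : R[i]) : normc (cexp w) <= expR (normc w).
Proof. by rewrite normc_cexp ler_expR (le_trans (ler_norm _)) ?ler_normc_Re. Qed.

(** For [normc h <= 1/8] the exponential is at most [expR (x / 8)], and the other
    half of [expR (x / 4)] absorbs the polynomial factors in [x] that come with
    each power of [h]. *)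
Lemma tame_quad : exists K : R, 0 <= K /\ forall h, normc h <= 8^-1 ->
  tame (fun x => cexp (- h * x%:C) - 1 + h * x%:C) (normc h ^+ 2 * K).
Proof.
exists (5 * (16 * 16) + (5 * expR 1 + 24)); split.
  by rewrite !addr_ge0 // mulr_ge0 // expR_ge0.
move=> h h8; set m := normc h in h8 *.
have m0 : 0 <= m := normc_ge0 h.
have E1 := expR_gt0 (1 : R).
split=> [x x0|x v x0 /andP[v0 v1]].
  have -> : cexp (- h * x%:C) - 1 + h * x%:C = cexp (- h * x%:C) - 1 - (- h * x%:C) by ring.
  apply: (le_trans (cexp_sub1w_le _)); rewrite normc_hx // -/m exprMn.
  have h1 := exp_hx x0 h8; have h2 := sqr_le_exp x0; rewrite -exp_quarter.
  have h3 := expR_gt0 (x / 8).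
  have h4 : x ^+ 2 * expR (m * x) <= (16 * 16 * expR (x / 8)) * expR (x / 8).
    by rewrite ler_pM ?sqr_ge0 ?expR_ge0.
  have -> : 5 * (m ^+ 2 * x ^+ 2 * expR (m * x)) = m ^+ 2 * (5 * (x ^+ 2 * expR (m * x))) by ring.
  rewrite -[leRHS]mulrA ler_wpM2l ?sqr_ge0 //.
  have p : 0 <= expR (x / 8) * expR (x / 8) by rewrite mulr_ge0 ?ltW.
  have q : 0 <= expR 1 * (expR (x / 8) * expR (x / 8)) by apply: mulr_ge0 => //; exact: ltW.
  move: q p h4; rewrite -(mulrA (16 * 16)); move: (expR (x / 8) * _) (_ * expR (m * x)) (expR 1) => a b e p q r.
  lra.
have -> : cexp (- h * (x + v)%:C) - 1 + h * (x + v)%:C - (cexp (- h * x%:C) - 1 + h * x%:C)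
   = cexp (- h * x%:C) * (cexp (- h * v%:C) - 1 - (- h * v%:C)) + (- h * v%:C) * (cexp (- h * x%:C) - 1).
  by rewrite rmorphD /= mulrDr cexpD; ring.
apply: (le_trans (le_normcD _ _)); rewrite normcM [normc (- h * v%:C * _)]normcM (normc_hx _ v0) -/m.
have h1 := exp_hx x0 h8; have h1' := exp_hx v0 h8.
have hx := lin_le_exp x0; have hp := expR_gt0 (x / 8).
have -> : m ^+ 2 * ((5 * (16 * 16)) + (5 * expR 1 + 24)) * (v * expR (x / 4)) =
  m ^+ 2 * (5 * (16 * 16)) * (v * expR (x / 4)) + (expR (x / 4) * (5 * (m ^+ 2 * v * expR 1)) +
   (m * v) * (3 * (m * (8 * expR (x / 4))))) by ring.
rewrite ler_wpDl ?mulr_ge0 ?sqr_ge0 ?expR_ge0 //.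
apply: lerD.
  rewrite ler_pM ?normc_ge0 //.
    apply: (le_trans (normc_cexp_le _)); rewrite normc_hx // (le_trans h1) //.
    exact: exp_8_4.
  apply: (le_trans (cexp_sub1w_le _)); rewrite normc_hx // -/m exprMn ler_pM2l //.
  rewrite -[leLHS]mulrA -[leRHS]mulrA ler_wpM2l ?sqr_ge0 // expr2 -mulrA ler_wpM2l //.
  rewrite -[leRHS]mul1r ler_pM ?expR_ge0 // (le_trans h1') // ler_expR; lra.
rewrite ler_wpM2l ?mulr_ge0 //.
apply: (le_trans (cexp_sub1_le _)); rewrite normc_hx // -/m ler_pM2l //.
rewrite -!mulrA ler_wpM2l // -exp_quarter mulrA ler_pM ?expR_ge0 //.
Qed.

Lemma tame_exp : exists K : R, 0 <= K /\ forall h, normc h <= 8^-1 ->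
  tame (fun x => cexp (- h * x%:C)) K.
Proof.
exists (1 + 3 * expR 1); split; first by rewrite addr_ge0 // mulr_ge0 ?expR_ge0.
move=> h h8; set m := normc h in h8 *.
have m0 : 0 <= m := normc_ge0 h.
have E1 := expR_gt0 (1 : R).
split=> [x x0|x v x0 /andP[v0 v1]].
  apply: (le_trans (normc_cexp_le _)); rewrite normc_hx // -/m.
  rewrite (le_trans (exp_hx x0 h8)) // (le_trans (exp_8_4 x0)) // ler_peMl ?expR_ge0 //.
  by rewrite lerDl mulr_ge0 ?expR_ge0.
have -> : cexp (- h * (x + v)%:C) - cexp (- h * x%:C) = cexp (- h * x%:C) * (cexp (- h * v%:C) - 1).
  by rewrite rmorphD /= mulrDr cexpD; ring.
rewrite normcM.
apply: (@le_trans _ _ (expR (x / 4) * (3 * (v * expR 1)))); last first.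
  rewrite [leRHS](_ : _ = v * expR (x / 4) + expR (x / 4) * (3 * (v * expR 1))); last by ring.
  by rewrite lerDr mulr_ge0 ?expR_ge0.
rewrite ler_pM ?normc_ge0 //.
  apply: (le_trans (normc_cexp_le _)); rewrite normc_hx // -/m.
  by rewrite (le_trans (exp_hx x0 h8)) // (exp_8_4 x0).
apply: (le_trans (cexp_sub1_le _)); rewrite normc_hx // -/m ler_pM2l //.
rewrite ler_pM ?mulr_ge0 ?expR_ge0 //.
  rewrite ler_piMl //; lra.
by rewrite (le_trans (exp_hx v0 h8)) // ler_expR; lra.
Qed.

Lemma expRN_sub1 (y : R) : 0 <= y -> `|expR (- y) - 1| <= y.
Proof.
move=> y0; have := expR_ge1Dx (- y); have : expR (- y) <= 1 by rewrite expR_le1; lra.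
by move=> h1 h2; rewrite ler_norml; apply/andP; split; lra.
Qed.

Lemma tame_lin : exists K : R, 0 <= K /\ tame (fun x => x%:C) K.
Proof.
exists 8; split => //; split=> [x x0|x v x0 /andP[v0 v1]].
  rewrite normc_real ger0_norm // (le_trans (lin_le_exp x0)) // ler_pM2l //.
  exact: exp_8_4.
rewrite -(rmorphB (real_complex R)) normc_real addrAC subrr add0r ger0_norm //.
have : 1 <= expR (x / 4) by apply: expR_ge1; lra.
by nra.
Qed.

(** The weight of the difference between the series of [c n * ln n * n^(-1-e)]
    and its value at [e = 0]. *)
Lemma tame_lin_exp : exists K : R, 0 <= K /\ forall e : R, 0 <= e ->
  tame (fun x => (x * (expR (- (e * x)) - 1))%:C) (e * K).
Proof.
exists (4 * (16 * 16)); split => // e e0; split=> [x x0|x v x0 /andP[v0 v1]].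
  rewrite normc_real normrM [`|x|]ger0_norm //.
  have h1 := expRN_sub1 (mulr_ge0 e0 x0).
  apply: (@le_trans _ _ (e * (x ^+ 2))).
    by rewrite expr2 mulrCA ler_wpM2l.
  rewrite -mulrA ler_wpM2l // (le_trans (sqr_le_exp x0)) //.
  by have := exp_8_4 x0; have := expR_gt0 (x / 8); lra.
have -> : ((x + v) * (expR (- (e * (x + v))) - 1))%:C - (x * (expR (- (e * x)) - 1))%:C
  = (v * (expR (- (e * (x + v))) - 1) + x * expR (- (e * x)) * (expR (- (e * v)) - 1))%:C.
  rewrite -(rmorphB (real_complex R)); congr (_%:C).
  by rewrite (_ : - (e * (x + v)) = - (e * x) + - (e * v)); [rewrite expRD; ring|ring].
rewrite normc_real (le_trans (ler_normD _ _)) //.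
have h1 := expRN_sub1 (mulr_ge0 e0 (addr_ge0 x0 v0)).
have h2 := expRN_sub1 (mulr_ge0 e0 v0).
rewrite !normrM [`|x|]ger0_norm // [`|v|]ger0_norm // [`|expR _|]ger0_norm ?expR_ge0 //.
have h3 : expR (- (e * x)) <= 1 by rewrite expR_le1 oppr_le0 mulr_ge0.
have h4 : v * `|expR (- (e * (x + v))) - 1| <= v * (e * (x + v)) by rewrite ler_wpM2l.
have h5 : x * expR (- (e * x)) * `|expR (- (e * v)) - 1| <= x * (e * v).
  by rewrite ler_pM ?mulr_ge0 ?expR_ge0 // ler_piMr.
apply: (le_trans (lerD h4 h5)).
have -> : v * (e * (x + v)) + x * (e * v) = e * (v * (2 * x + v)) by ring.
rewrite -mulrA ler_wpM2l // mulrCA ler_wpM2l //.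
have := exp_8_4 x0; have := lin_le_exp x0.
have : 1 <= expR (x / 4) by apply: expR_ge1; lra.
lra.
Qed.

End AtOne.

(** * Dirichlet series with bounded partial sums, near s = 1 *)

Section Dseries.
Variable R : realType.
Local Notation C := (R[i]^o).
Implicit Types (n : nat) (x v : R) (h : R[i]).

Lemma limC_eq (T : Type) (F : set_system T) {FF : ProperFilter F} (f : T -> C) (l : C) :
  f x @[x --> F] --> l -> lim (f x @[x --> F]) = l.
Proof. by move=> fl; apply: cvg_lim => //; exact: norm_hausdorff. Qed.

Lemma limC_unique (T : Type) (F : set_system T) {FF : ProperFilter F} (f : T -> C) (l l' : C) :
  f x @[x --> F] --> l -> f x @[x --> F] --> l' -> l = l'.
Proof. by move=> /limC_eq <- /limC_eq <-. Qed.

Definition Dseries (c : nat -> R[i]) (s : C) : C :=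
  limn (fun N => psum (fun n => c n * npowN n s) N : C).

(** Minus the derivative at [1] of [Dseries c]. *)
Definition Dseries_ln (c : nat -> R[i]) : C :=
  limn (fun N => psum (fun n => c n * (n%:R^-1%:C * (ln n%:R)%:C)) N : C).

Lemma npowN_1h n h : (0 < n)%N -> npowN n (1 + h) = n%:R^-1%:C * cexp (- h * (ln n%:R)%:C).
Proof.
move=> n0; rewrite -npw1 // -npowN_real /npowN -cexpD; congr cexp.
rewrite rmorph1; ring.
Qed.

Lemma psum_near (V : zmodType) (u v : nat -> V) N :
  (forall n, (0 < n)%N -> u n = v n) -> psum u N = psum v N.
Proof. by move=> uv; apply: eq_big_nat => n /andP[n0 _]; exact: uv. Qed.

Lemma eq_psum_cvg (u v : nat -> R[i]) (l : C) : (forall n, (0 < n)%N -> u n = v n) ->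
  (psum u N : C) @[N --> \oo] --> l -> (psum v N : C) @[N --> \oo] --> l.
Proof. by move=> uv; rewrite (_ : psum v = psum u) //; apply/funext => N; apply: psum_near => n /uv. Qed.

Variables (c : nat -> R[i]) (A : R).
Hypothesis cA : forall N, normc (psum c N) <= A.

Lemma Dseries_cvg h : normc h <= 8^-1 ->
  (psum (fun n => c n * npowN n (1 + h)) N : C) @[N --> \oo] --> Dseries c (1 + h).
Proof.
move=> h8; have [K [_ /(_ h h8) tK]] := tame_exp R.
have [B0 H] := tame_test R; have [l [cl _]] := H c A _ _ cA tK.
suff cl' : (psum (fun n => c n * npowN n (1 + h)) N : C) @[N --> \oo] --> l.
  by rewrite /Dseries (limC_eq cl').
by apply: eq_psum_cvg cl => n n0; rewrite npowN_1h.
Qed.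

Lemma Dseries_ln_cvg :
  (psum (fun n => c n * (n%:R^-1%:C * (ln n%:R)%:C)) N : C) @[N --> \oo] --> Dseries_ln c.
Proof.
have [K [_ tK]] := tame_lin R.
have [B0 H] := tame_test R; have [l [cl _]] := H c A _ _ cA tK.
by rewrite /Dseries_ln (limC_eq cl); exact: cl.
Qed.

(** Term by term, the left-hand side is the series of [c n] against the second
    order Taylor remainder of [n^(-h)], a tame weight of size [O(h^2)]. *)
Lemma Dseries_quad : exists K : R, 0 <= K /\ forall h, normc h <= 8^-1 ->
  normc (Dseries c (1 + h) - Dseries c 1 + h * Dseries_ln c) <= K * normc h ^+ 2.
Proof.
have [K [K0 tK]] := tame_quad R.
have [B0 H] := tame_test R.
exists (`|A * (K * B0)|); split => // h h8.
have [l [cl lB]] := H c A _ _ cA (tK h h8).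
have h0 : normc (0 : R[i]) <= 8^-1 by rewrite normc0.
have c1 := Dseries_cvg h8; have c2 := Dseries_cvg h0; rewrite addr0 in c2.
have c3 := Dseries_ln_cvg.
have c4 : (psum (fun n => c n * npowN n (1 + h)) N - psum (fun n => c n * npowN n 1) N
   + h * psum (fun n => c n * (n%:R^-1%:C * (ln n%:R)%:C)) N : C) @[N --> \oo] -->
   (Dseries c (1 + h) - Dseries c 1 + h * Dseries_ln c : C).
  apply: cvgD; first exact: (cvgB c1 c2).
  by apply: cvgM; [exact: cvg_cst|exact: c3].
suff -> : Dseries c (1 + h) - Dseries c 1 + h * Dseries_ln c = l.
  apply: (le_trans lB); apply: (le_trans (ler_norm _)).
  rewrite (_ : A * _ = (A * (K * B0)) * normc h ^+ 2); last by ring.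
  by rewrite normrM ler_wpM2l // ger0_norm // sqr_ge0.
apply: limC_unique c4 _; move: cl; apply: cvg_trans; apply: near_eq_cvg.
apply: nearW => N; rewrite /psum mulr_sumr -sumrB -big_split /=.
apply: eq_big_nat => n /andP[n0 _].
have -> : npowN n (1 : R[i]) = n%:R^-1%:C.
  by rewrite -(addr0 (1 : R[i])) npowN_1h // oppr0 mul0r cexp0 mulr1.
by rewrite npowN_1h //; ring.
Qed.

Lemma cvg_normc_dnbhs0 : (normc h @[h --> (0 : C)^'] --> (0 : R)).
Proof.
have H : (fun h : C => h) @ (0 : C)^' --> (0 : C) by apply: cvg_within_filter; exact: cvg_id.
rewrite -(@normc0 R); exact: (cvgC_normc H).
Qed.

Lemma deriv_quad (f : C -> C) (a D : C) (K r : R) : 0 < r -> 0 <= K ->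
  (forall h : C, normc h <= r -> normc (f (a + h) - f a - h * D) <= K * normc h ^+ 2) ->
  (h^-1 *: (f (h *: (1 : C) + a) - f a) : C) @[h --> (0 : C)^'] --> D.
Proof.
move=> r0 K0 H; apply: (@cvgC_bound _ _ _ _ _ _ (fun h => K * normc h)); last first.
  by rewrite -(mulr0 K); apply: cvgM; [exact: cvg_cst|exact: cvg_normc_dnbhs0].
have /cvgrPdist_le/(_ _ r0) small := cvg_normc_dnbhs0.
near=> h.
have h0 : h != 0 by near: h; exists 1 => //=.
have hr : normc h <= r.
  have : `|0 - normc h| <= r by near: h.
  by rewrite sub0r normrN ger0_norm // normc_ge0.
have n0 : 0 < normc h by rewrite normc_gt0.
have -> : h^-1 *: (f (h *: (1 : C) + a) - f a) - D = h^-1 * (f (a + h) - f a - h * D).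
  rewrite /GRing.scale /= mulr1 [h + a]addrC [RHS]mulrBr mulrA mulVf // mul1r //.
rewrite normcM normcV ler_pdivrMl // (le_trans (H h hr)) // expr2; lra.
Unshelve. all: by end_near. Qed.

(** A quadratic remainder makes the difference quotient converge at linear rate. *)
Lemma deriv_quadP (f : C -> C) (a D : C) (K r : R) : 0 < r -> 0 <= K ->
  (forall h : C, normc h <= r -> normc (f (a + h) - f a - h * D) <= K * normc h ^+ 2) ->
  derivable f a 1 /\ derive1 f a = D.
Proof.
move=> r0 K0 H; have c1 := deriv_quad r0 K0 H; split.
  by apply/cvg_ex; exists D; exact: c1.
by rewrite derive1E; exact: limC_eq c1.
Qed.

Lemma Dseries_derivable : derivable (Dseries c) 1 1 /\ derive1 (Dseries c) 1 = - Dseries_ln c.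
Proof.
have [K [K0 H]] := Dseries_quad.
apply: (@deriv_quadP _ _ _ K 8^-1) => // h h8.
by rewrite mulrN opprK; exact: H.
Qed.

(** Continuity at [1+] of minus the derivative of [Dseries c], with a rate. *)
Lemma Dseries_ln_lip : exists K : R, 0 <= K /\ forall e : R, 0 <= e ->
  exists l : C, (psum (fun n => c n * (ln n%:R * npw n (1 + e))%:C) N : C) @[N --> \oo] --> l
   /\ normc (l - Dseries_ln c) <= K * e.
Proof.
have [K [K0 tK]] := tame_lin_exp R.
have [B0 H] := tame_test R.
exists (`|A * (K * B0)|); split => // e e0.
have [l [cl lB]] := H c A _ _ cA (tK e e0).
exists (l + Dseries_ln c); split; last first.
  rewrite addrK (le_trans lB) // (le_trans (ler_norm _)) //.
  by rewrite (_ : A * _ = (A * (K * B0)) * e) ?normrM ?[`|e|]ger0_norm //; ring.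
apply: cvg_trans (cvgD cl Dseries_ln_cvg); apply: near_eq_cvg.
apply: nearW => N; rewrite fctE /psum -big_split /=.
apply: eq_big_nat => n /andP[n0 _].
rewrite npwD npw1 // /npw mulNr !rmorphM rmorphB rmorph1 /=; ring.
Qed.

End Dseries.

(** * Divisor sums of arithmetic functions *)

Section Arith.

Lemma divisor_sumE (V : zmodType) (u : nat -> nat -> V) (k : nat) : (0 < k)%N ->
  divisor_sum u k = \sum_(n <- divisors k) u n (k %/ n)%N.
Proof.
move=> k0; rewrite /divisor_sum -big_filter; apply: perm_big; apply: uniq_perm.
- by rewrite filter_uniq // iota_uniq.
- exact: divisors_uniq.
move=> n; rewrite mem_filter mem_index_iota -dvdn_divisors //.
by apply/andP/idP => [[]//|nk]; rewrite nk (dvdn_gt0 k0 nk) ltnS dvdn_leq.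
Qed.

(** The divisors of [p^(k+1) m] that do not divide [p^k m] are those exactly
    divisible by [p^(k+1)]. *)
Lemma divisors_primeX (V : zmodType) (f : nat -> V) (p k m : nat) :
  prime p -> (0 < m)%N -> ~~ (p %| m)%N ->
  \sum_(n <- divisors (p ^ k.+1 * m)) f n =
  \sum_(n <- divisors (p ^ k * m)) f n + \sum_(n <- divisors m) f (p ^ k.+1 * n)%N.
Proof.
move=> pp m0 pm; have p0 := prime_gt0 pp.
have q0 j : (0 < p ^ j)%N by rewrite expn_gt0 p0.
have K0 j : (0 < p ^ j * m)%N by rewrite muln_gt0 q0 m0.
rewrite (bigID (fun n => (n %| p ^ k * m)%N)) /=; congr (_ + _).
  rewrite -big_filter; apply: perm_big; apply: uniq_perm.
  - by rewrite filter_uniq // divisors_uniq.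
  - exact: divisors_uniq.
  move=> n; rewrite mem_filter -!dvdn_divisors //.
  by apply/andP/idP => [[]//|nk]; rewrite nk (dvdn_trans nk) // expnS -mulnA dvdn_mull.
rewrite -(big_map (fun n => p ^ k.+1 * n)%N predT) -big_filter.
apply: perm_big; apply: uniq_perm.
- by rewrite filter_uniq // divisors_uniq.
- rewrite map_inj_uniq ?divisors_uniq // => a b /eqP.
  by rewrite eqn_pmul2l // => /eqP.
move=> n; rewrite mem_filter -dvdn_divisors //.
apply/andP/mapP => [[nk nK]|[r]].
  have n0 : (0 < n)%N by apply: dvdn_gt0 nK.
  have qn : (p ^ k.+1 %| n)%N.
    rewrite pfactor_dvdn // ltnNge; apply: contra nk => lk.
    have [j jn E] := pfactor_coprime pp n0.
    rewrite E mulnC dvdn_mul // ?dvdn_exp2l //.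
    move: nK; rewrite E => jk; have /(dvdn_trans (dvdn_mulr _ (dvdnn j))) := jk.
    by rewrite Gauss_dvdr // coprime_sym coprimeXl.
  exists (n %/ p ^ k.+1)%N; last by rewrite mulnC divnK.
  by rewrite -dvdn_divisors // -(@dvdn_pmul2l (p ^ k.+1)) // mulnC divnK.
rewrite -dvdn_divisors // => rm ->; split; last by rewrite dvdn_pmul2l.
apply: contra pm => h.
have : (p ^ k * p %| p ^ k * m)%N by rewrite -expnSr (dvdn_trans _ h) // dvdn_mulr.
by rewrite dvdn_pmul2l.
Qed.

(** Induction along the factorization into coprime prime powers, as suits
    multiplicative functions. *)
Lemma primepow_ind (P : nat -> Prop) : P 1%N ->
  (forall p k m, prime p -> (0 < m)%N -> ~~ (p %| m)%N -> P m -> P (p ^ k.+1 * m)%N) ->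
  forall n, (0 < n)%N -> P n.
Proof.
move=> P1 PS n; elim/ltn_ind: n => n IH n0.
have [n1|n1] := leqP n 1; first by have -> : n = 1%N by lia.
have pp := pdiv_prime n1; set p := pdiv n in pp.
have [m pm E] := pfactor_coprime pp n0.
have pn : (p %| n)%N by exact: pdiv_dvd.
have l0 : (0 < logn p n)%N by rewrite logn_gt0 mem_primes pp n0 pn.
have m0 : (0 < m)%N by move: n0; rewrite {1}E muln_gt0 => /andP[].
rewrite E mulnC -(prednK l0); apply: PS => //.
  by rewrite -prime_coprime.
apply: IH => //; rewrite [ltnRHS]E -{1}[m]muln1 ltn_pmul2l //.
by rewrite -(exp1n (logn p n)) ltn_exp2r // prime_gt1.
Qed.

Variable R : realType.

Lemma vonMangoldt_ge0 n : 0 <= vonMangoldt R n.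
Proof.
rewrite /vonMangoldt; case E : (primes n) => [|p [|]] //.
have : p \in primes n by rewrite E inE.
by rewrite mem_primes => /andP[pp _]; rewrite ln_ge0 // ler1n prime_gt0.
Qed.

Lemma vonMangoldt_le n : vonMangoldt R n <= ln n%:R.
Proof.
rewrite /vonMangoldt; case E : (primes n) => [|p [|]]; try exact: lnn_ge0.
have : p \in primes n by rewrite E inE.
rewrite mem_primes => /and3P[pp n0 pn].
by rewrite ler_ln ?posrE ?ltr0n // ?prime_gt0 // ler_nat dvdn_leq //.
Qed.

Lemma vonMangoldt1 : vonMangoldt R 1 = 0.
Proof. by []. Qed.

Lemma primes_pX p k : prime p -> primes (p ^ k.+1) = [:: p].
Proof. by move=> pp; rewrite primesX // primes_prime. Qed.

Lemma vonMangoldt_pX p k : prime p -> vonMangoldt R (p ^ k.+1) = ln p%:R.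
Proof. by move=> pp; rewrite /vonMangoldt primes_pX. Qed.

Lemma vonMangoldt_pXM p k m : prime p -> (1 < m)%N -> ~~ (p %| m)%N ->
  vonMangoldt R (p ^ k.+1 * m) = 0.
Proof.
move=> pp m1 pm.
have m0 : (0 < m)%N by apply: ltnW.
have K0 : (0 < p ^ k.+1 * m)%N by rewrite muln_gt0 expn_gt0 prime_gt0.
rewrite /vonMangoldt; case E : (primes _) => [|q [|]] //.
have : p \in primes (p ^ k.+1 * m) by rewrite mem_primes pp K0 expnS -mulnA dvdn_mulr.
rewrite E inE => /eqP pq.
have : pdiv m \in primes (p ^ k.+1 * m).
  by rewrite mem_primes pdiv_prime // K0 dvdn_mull // pdiv_dvd.
rewrite E inE => /eqP pmq; move: pm; rewrite pq -pmq pdiv_dvd //.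
Qed.

Lemma sum_vonMangoldt n : (0 < n)%N -> \sum_(m <- divisors n) vonMangoldt R m = ln n%:R.
Proof.
elim/primepow_ind => [|p k m pp m0 pm IH].
  by rewrite /divisors /= big_seq1 vonMangoldt1 ln1.
suff H j : \sum_(m0 <- divisors (p ^ j * m)) vonMangoldt R m0 = ln (p ^ j * m)%:R by [].
have p0 : (0 : R) < p%:R by rewrite ltr0n prime_gt0.
have m0' : (0 : R) < m%:R by rewrite ltr0n.
elim: j => [|j IHj]; first by rewrite expn0 mul1n.
rewrite divisors_primeX // IHj (bigD1_seq 1%N) ?divisors_uniq //=; last first.
  by rewrite -dvdn_divisors.
rewrite muln1 vonMangoldt_pX // big1_seq ?addr0; last first.
  move=> r /andP[r1]; rewrite -dvdn_divisors // => rm.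
  apply: vonMangoldt_pXM => //; first by have := dvdn_gt0 m0 rm; lia.
  by apply: contra pm => /dvdn_trans; apply.
rewrite !natrM !natrX !lnM ?posrE ?exprn_gt0 // exprS lnM ?posrE ?exprn_gt0 //.
by rewrite addrC addrA.
Qed.

Lemma moebius1 : moebius 1 = 1. Proof. by []. Qed.

Lemma moebius_le1 n : `|moebius n| <= 1.
Proof. by rewrite /moebius; case: ifP => // _; rewrite normrX normrN1 expr1n. Qed.

Lemma perm_primes_pM p m : prime p -> (0 < m)%N -> ~~ (p %| m)%N ->
  perm_eq (primes (p * m)) (p :: primes m).
Proof.
move=> pp m0 pm; apply: uniq_perm; first exact: primes_uniq.
  by rewrite /= primes_uniq andbT mem_primes pp m0.
by move=> q; rewrite inE primesM // ?prime_gt0 // primes_prime // inE.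
Qed.

Lemma moebius_pM p m : prime p -> (0 < m)%N -> ~~ (p %| m)%N ->
  moebius (p * m) = - moebius m.
Proof.
move=> pp m0 pm; have P := perm_primes_pM pp m0 pm.
rewrite /moebius (perm_all _ P) (perm_size P) /= lognM // ?prime_gt0 // logn_prime // eqxx.
rewrite (lognE p m) pp m0 (negbTE pm) addn0 eqxx /=.
rewrite (_ : all _ (primes m) = all (fun q => logn q m == 1%N) (primes m)).
  by case: ifP => _; rewrite ?oppr0 // exprS mulN1r.
apply: eq_in_all => q; rewrite mem_primes => /and3P[qp _ qm].
rewrite lognM // ?prime_gt0 // logn_prime //.
by have [pq|//] := eqVneq q p; move: pm; rewrite -pq qm.
Qed.

Lemma moebius_pXM p k m : prime p -> (0 < m)%N -> moebius (p ^ k.+2 * m) = 0.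
Proof.
move=> pp m0; rewrite /moebius ifF //; apply/negbTE/allPn; exists p.
  by rewrite mem_primes pp muln_gt0 expn_gt0 prime_gt0 // m0 expnS -mulnA dvdn_mulr.
by rewrite lognM // ?expn_gt0 ?prime_gt0 // pfactorK // addSn addSn.
Qed.

Lemma sum_moebius n : (0 < n)%N -> \sum_(m <- divisors n) moebius m = (n == 1%N)%:R.
Proof.
elim/primepow_ind => [|p k m pp m0 pm _]; first by rewrite /divisors /= big_seq1.
have -> : (p ^ k.+1 * m == 1)%N = false.
  by rewrite muln_eq1 expnS muln_eq1; have := prime_gt1 pp; case: eqP => // ->.
elim: k => [|k IHk]; last first.
  rewrite divisors_primeX // IHk add0r big1_seq // => r /andP[_].
  by rewrite -dvdn_divisors // => rm; apply: moebius_pXM => //; exact: dvdn_gt0 rm.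
rewrite divisors_primeX // expn0 mul1n -big_split /= big1_seq // => r /andP[_].
rewrite -dvdn_divisors // => rm; rewrite expn1 moebius_pM ?subrr //.
  exact: dvdn_gt0 rm.
by apply: contra pm => /dvdn_trans; apply.
Qed.

(** [vonMangoldt] requires a prime power and [moebius] a squarefree number, which
    leaves the primes. *)
Lemma moebius_vonMangoldt n :
  (moebius n)%:~R * vonMangoldt R n = if prime n then - ln n%:R else 0.
Proof.
case: ifP => [pn|np].
  have := @moebius_pM n 1 pn isT; rewrite muln1 => -> //; last by rewrite dvdn1; have := prime_gt1 pn; case: eqP => // ->.
  by rewrite moebius1 mulN1r; congr (- _); rewrite /vonMangoldt primes_prime.
have [->|n0] := posnP n; first by rewrite /vonMangoldt /= mulr0.
rewrite /vonMangoldt; case E : (primes n) => [|p [|]]; rewrite ?mulr0 //.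
have : p \in primes n by rewrite E inE.
rewrite mem_primes => /and3P[pp _ pn].
have En : n = (p ^ logn p n)%N.
  by rewrite {1}(prod_prime_decomp n0) prime_decompE E /= big_seq1.
case l : (logn p n) En => [|[|k]] En; last 1 first.
- by rewrite En -(muln1 (p ^ _)%N) moebius_pXM // mul0r.
- by move: pn; rewrite En expn0 dvdn1; have := prime_gt1 pp; case: eqP => // ->.
- by move: np; rewrite En expn1 pp.
Qed.

(** The divisor sum is multiplicative, with value [\sum_(i <= j) (f p)^i] at
    [p^j].  For [f p] in [{0, 1, -1}] this is nonnegative, and at least [1] when
    [j] is even. *)
Lemma sum_real_char (f : nat -> R) :
  (forall m n, f (m * n)%N = f m * f n) -> f 1%N = 1 ->
  (forall n, f n = 0 \/ f n = 1 \/ f n = -1) ->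
  forall n, (0 < n)%N -> 0 <= \sum_(m <- divisors n) f m /\ 1 <= \sum_(m <- divisors (n * n)) f m.
Proof.
move=> fM f1 fv n; elim/primepow_ind => [|p k m pp m0 pm [IH1 IH2]].
  by rewrite /divisors /= big_seq1 f1; split.
have pm2 : ~~ (p %| m * m)%N by rewrite Euclid_dvdM // (negbTE pm).
have m20 : (0 < m * m)%N by rewrite muln_gt0 m0.
have fX j : f (p ^ j)%N = f p ^+ j by elim: j => // j IHj; rewrite expnS fM IHj exprS.
have E j r : (0 < r)%N -> ~~ (p %| r)%N ->
  \sum_(n <- divisors (p ^ j * r)) f n = (\sum_(i < j.+1) f p ^+ i) * \sum_(n <- divisors r) f n.
  move=> r0 pr; elim: j => [|j IHj].
    by rewrite expn0 mul1n big_ord_recr big_ord0 /= add0r mul1r.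
  rewrite divisors_primeX // IHj [in RHS]big_ord_recr /= mulrDl; congr (_ + _).
  by rewrite mulr_sumr; apply: eq_bigr => i _; rewrite fM fX.
have G j : 0 <= \sum_(i < j.+1) f p ^+ i /\ 1 <= \sum_(i < j.*2.+1) f p ^+ i.
  case: (fv p) => [->|[->|->]].
  - have H i : \sum_(i0 < i.+1) (0 : R) ^+ i0 = 1.
      rewrite big_ord_recl expr0 big1 ?addr0 // => l _; by rewrite expr0n.
    by rewrite !H.
  - have H i : \sum_(i0 < i) (1 : R) ^+ i0 = i%:R.
      by under eq_bigr do rewrite expr1n; rewrite sumr_const card_ord.
    by rewrite !H ler0n ler1n.
  - have H i : \sum_(i0 < i) (-1 : R) ^+ i0 = (odd i)%:R.
      elim: i => [|i IHi]; first by rewrite big_ord0.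
      by rewrite big_ord_recr /= IHi -signr_odd; case: (odd i); rewrite /= ?expr1 ?expr0 ?subrr ?add0r.
    by rewrite !H /= odd_double /= ler0n.
rewrite E //; split; first by apply: mulr_ge0 => //; case: (G k.+1).
rewrite mulnACA -expnD addnn E //.
by rewrite -(mulr1 1) ler_pM // ?ler01 //; case: (G k.+1).
Qed.

(** The condition [primes n = [:: p]] is the form in which [vonMangoldt]
    recognizes the powers of [p]. *)
Lemma sum_primepow (V : zmodType) (g : nat -> V) (p N : nat) : prime p ->
  \sum_(1 <= n < N | primes n == [:: p]) g n = \sum_(1 <= k < N | (p ^ k < N)%N) g (p ^ k)%N.
Proof.
move=> pp.
transitivity (\sum_(1 <= n < N) \sum_(1 <= k < N | n == (p ^ k)%N) g n).
  rewrite big_mkcond; apply: eq_big_nat => n /andP[n0 nN].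
  case: eqP => [E|ne]; last first.
    rewrite big1_seq // => k /andP[/eqP En]; rewrite mem_index_iota => /andP[k0 _].
    by case: ne; rewrite En -(prednK k0) primes_pX.
  have En : n = (p ^ logn p n)%N.
    by rewrite {1}(prod_prime_decomp n0) prime_decompE E /= big_seq1.
  have l0 : (0 < logn p n)%N by rewrite logn_gt0 E inE.
  rewrite (eq_bigl (fun k => k == logn p n)).
    by rewrite big_nat1_eq l0 /= ifT // (leq_ltn_trans _ nN) // [leqRHS]En ltnW // ltn_expl // prime_gt1.
  by move=> k; rewrite {1}En eqn_exp2l ?prime_gt1 // eq_sym.
rewrite (exchange_big_dep predT) //= [RHS]big_mkcond /=.
apply: eq_big_nat => k /andP[k0 kN].
by rewrite big_nat1_eq expn_gt0 prime_gt0 //=; case: ifP.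
Qed.

End Arith.

(** * The zeta function and its derivative near s = 1 *)

Section Zeta.
Variable R : realType.
Implicit Types (n : nat) (x y e s : R).

Definition zeta s : R := limn (psum (fun n => npw n s)).
Definition zetaln s : R := limn (psum (fun n => ln n%:R * npw n s)).

Lemma lim_dom_le (M u : nat -> R) B : sumle M B ->
  (forall n, (0 < n)%N -> `|u n| <= M n) -> `|limn (psum u)| <= B.
Proof.
move=> MB uM; have := dom_tail 0 MB uM; rewrite !psum0 !subr0 => /le_trans; apply.
exact: sumle_lim.
Qed.

Lemma psum_telescope (G : nat -> R) N : (0 < N)%N ->
  psum (fun n => G n.+1 - G n) N = G N - G 1%N.
Proof. by move=> N0; rewrite /psum telescope_sumr. Qed.

Lemma zeta_cvg s : 1 < s -> psum (fun n => npw n s) @ \oo --> zeta s.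
Proof. by move=> /sum_npw[B HB]; exact: sumle_cvg HB. Qed.

Lemma le_lnn1 n : ln (n%:R : R) <= 1 + ln n%:R.
Proof. by rewrite lerDr. Qed.

Lemma zetaln_cvg s : 1 < s -> psum (fun n => ln n%:R * npw n s) @ \oo --> zetaln s.
Proof.
move=> /(sum_ln_npw 1)[B HB]; apply: (dom_cvgR HB) => n n0.
rewrite ger0_norm ?mulr_ge0 ?lnn_ge0 ?npw_ge0 // expr1.
by rewrite ler_wpM2r ?npw_ge0 // le_lnn1.
Qed.

(** [(1 - expR (- e x)) / e] is the antiderivative of [expR (- e x)] that vanishes
    at [x = 0]; with [x = ln n], its increment approximates [n^(-1-e)], and the
    increments add up to [1/e]. *)
Definition zterm e n := npw n (1 + e) - ((1 - expR (- (e * ln n.+1%:R))) / e - (1 - expR (- (e * ln n%:R))) / e).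
(** The limit of [zterm e n] as [e] tends to [0]; the sum of these terms is
    Euler's constant. *)
Definition gterm n : R := n%:R^-1 - dln R n.
(** The analogue of [zterm] for [ln n * n^(-1-e)]: the antiderivative of
    [x * expR (- e x)] that vanishes at [0] tends to [1/e^2] at infinity. *)
Definition lterm e n := ln n%:R * npw n (1 + e) -
  ((1 - (1 + e * ln n.+1%:R) * expR (- (e * ln n.+1%:R))) / e ^+ 2 -
   (1 - (1 + e * ln n%:R) * expR (- (e * ln n%:R))) / e ^+ 2).

Lemma npw_1e n e : (0 < n)%N -> npw n (1 + e) = n%:R^-1 * expR (- (e * ln n%:R)).
Proof. by move=> n0; rewrite npwD npw1 // /npw mulNr. Qed.

Lemma npw2 n : (0 < n)%N -> npw n 2 = n%:R^-1 ^+ 2 :> R.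
Proof. by move=> n0; rewrite (_ : 2 = 1 + 1) // npwD npw1 // expr2. Qed.

Lemma expN_rem y : 0 <= y -> 0 <= expR (- y) - 1 + y <= y ^+ 2 * expR y.
Proof.
move=> y0; have := expR_sub1x_le (- y).
by rewrite opprK sqrrN normrN ger0_norm.
Qed.

Lemma zterm_gterm n e : (0 < n)%N -> 0 < e <= 1 ->
  `|zterm e n - gterm n| <= e * (expR 1 * ((1 + ln n%:R) ^+ 1 * npw n 2)).
Proof.
move=> n0 /andP[e0 e1].
have d0 := dln_ge0 R n0; have /andP[_ d1] := dln_bounds R n0; have d2 := dln_le1 R n0.
have /andP[g0 g1] := dln_inv R n0; have l0 := lnn_ge0 R n.
rewrite /zterm npw_1e // npw2 // /gterm dlnE expr1.
set x := ln n%:R in l0 *; set d := dln R n in d0 d1 d2 g0 g1 *; set i := n%:R^-1 in g0 g1 d1 *.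
have i0 : 0 <= i by rewrite invr_ge0.
pose y := e * d; have y0 : 0 <= y by rewrite mulr_ge0 // ltW.
have y1 : y <= 1 by rewrite /y -(mulr1 1) ler_pM // ltW.
have -> : i * expR (- (e * x)) - ((1 - expR (- (e * (x + d)))) / e - (1 - expR (- (e * x))) / e)
   - (i - d) = (expR (- (e * x)) - 1) * (i - d) + expR (- (e * x)) * ((expR (- y) - 1 + y) / e).
  rewrite (_ : - (e * (x + d)) = - (e * x) + - y); last by rewrite /y; ring.
  by rewrite expRD /y; field; rewrite gt_eqF.
have ex : 0 <= e * x by rewrite mulr_ge0 // ltW.
have h1 := expRN_sub1 ex.
have /andP[r0 r1] := expN_rem y0.
have h2 : expR (- (e * x)) <= 1 by rewrite expR_le1; lra.
have E1 : expR y <= expR 1 by rewrite ler_expR.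
have E0 : 1 <= expR (1 : R) by apply: expR_ge1.
apply: (le_trans (ler_normD _ _)); rewrite !normrM.
rewrite [`|i - d|]ger0_norm // [`|expR (- _)|]ger0_norm ?expR_ge0 // [`|_ + y|]ger0_norm // [`|e^-1|]ger0_norm ?invr_ge0 ?(ltW e0) //.
have a1 : `|expR (- (e * x)) - 1| * (i - d) <= e * x * i ^+ 2 by rewrite ler_pM.
have a2 : expR (- (e * x)) * ((expR (- y) - 1 + y) / e) <= e * (expR 1 * i ^+ 2).
  rewrite -[leRHS]mul1r ler_pM ?expR_ge0 // ?divr_ge0 ?(ltW e0) //.
  rewrite ler_pdivrMr // (le_trans r1) //.
  have -> : e * (expR 1 * i ^+ 2) * e = (e ^+ 2 * i ^+ 2) * expR 1 by ring.
  rewrite ler_pM ?sqr_ge0 ?expR_ge0 // /y exprMn ler_wpM2l ?sqr_ge0 //.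
  by rewrite lerXn2r // nnegrE.
apply: (le_trans (lerD a1 a2)).
rewrite -mulrA -mulrDr ler_wpM2l ?(ltW e0) //.
rewrite mulrA -mulrDl ler_wpM2r ?sqr_ge0 //.
have : 0 <= (expR 1 - 1) * x by rewrite mulr_ge0 // subr_ge0.
move: (expR 1) => E; lra.
Qed.

Lemma lterm_le n e : (0 < n)%N -> 0 < e <= 1 ->
  `|lterm e n| <= (1 + expR 1) * ((1 + ln n%:R) ^+ 1 * npw n 2).
Proof.
move=> n0 /andP[e0 e1].
have d0 := dln_ge0 R n0; have /andP[_ d1] := dln_bounds R n0; have d2 := dln_le1 R n0.
have /andP[g0 g1] := dln_inv R n0; have l0 := lnn_ge0 R n.
rewrite /lterm npw_1e // npw2 // dlnE expr1.
set x := ln n%:R in l0 *; set d := dln R n in d0 d1 d2 g0 g1 *; set i := n%:R^-1 in g0 g1 d1 *.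
have i0 : 0 <= i by rewrite invr_ge0.
pose y := e * d; have y0 : 0 <= y by rewrite mulr_ge0 // ltW.
have y1 : y <= 1 by rewrite /y -(mulr1 1) ler_pM // ltW.
have ex : 0 <= e * x by rewrite mulr_ge0 // ltW.
have -> : x * (i * expR (- (e * x))) - ((1 - (1 + e * (x + d)) * expR (- (e * (x + d)))) / e ^+ 2
   - (1 - (1 + e * x) * expR (- (e * x))) / e ^+ 2) =
   expR (- (e * x)) * (x * (i - d) + x * ((expR (- y) - 1 + y) / e)
     - (1 - expR (- y) - y * expR (- y)) / e ^+ 2).
  rewrite (_ : - (e * (x + d)) = - (e * x) + - y); last by rewrite /y; ring.
  by rewrite expRD /y; field; rewrite gt_eqF.
have /andP[r0 r1] := expN_rem y0.
have h2 : expR (- (e * x)) <= 1 by rewrite expR_le1; lra.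
have E1 : expR y <= expR 1 by rewrite ler_expR.
have E0 : 1 <= expR (1 : R) by apply: expR_ge1.
have id2 : d ^+ 2 <= i ^+ 2 by rewrite lerXn2r // nnegrE.
have s1 : 0 <= (expR (- y) - 1 + y) / e <= expR 1 * i ^+ 2.
  rewrite divr_ge0 ?(ltW e0) //= ler_pdivrMr // (le_trans r1) //.
  rewrite [leRHS](_ : _ = e * i ^+ 2 * expR 1); last by ring.
  apply: ler_pM => //; rewrite ?sqr_ge0 ?expR_ge0 // /y exprMn.
  apply: ler_pM; rewrite ?sqr_ge0 // expr2 ler_piMl // ltW //.
have s2 : 0 <= (1 - expR (- y) - y * expR (- y)) / e ^+ 2 <= i ^+ 2.
  have p := expR_gt0 (- y); have q := expR_ge1Dx (- y).
  have t : expR y * expR (- y) = 1 by rewrite -expRD subrr expR0.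
  have u := expR_ge1Dx y.
  apply/andP; split; first by apply: divr_ge0; [nra|rewrite sqr_ge0].
  rewrite ler_pdivrMr ?exprn_gt0 //; apply: (@le_trans _ _ (y ^+ 2)); first by nra.
  by rewrite /y exprMn mulrC ler_wpM2r ?sqr_ge0.
rewrite normrM [`|expR (- _)|]ger0_norm ?expR_ge0 // -[leRHS]mul1r.
rewrite ler_pM ?expR_ge0 //.
have k1 : 0 <= x * (i - d) <= x * i ^+ 2 by rewrite mulr_ge0 //= ler_wpM2l.
have k2 : 0 <= x * ((expR (- y) - 1 + y) / e) <= x * (expR 1 * i ^+ 2).
  by case/andP: s1 => s1 s1'; rewrite mulr_ge0 //= ler_wpM2l.
have E2 : 0 <= expR 1 * i ^+ 2 by rewrite mulr_ge0 ?expR_ge0 ?sqr_ge0.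
have E3 : 0 <= x * i ^+ 2 by rewrite mulr_ge0 ?sqr_ge0.
have E4 : 0 <= x * (expR 1 * i ^+ 2) by rewrite mulr_ge0.
have -> : (1 + expR 1) * ((1 + x) * i ^+ 2) = i ^+ 2 + x * i ^+ 2 + expR 1 * i ^+ 2 + x * (expR 1 * i ^+ 2) by ring.
have E5 : 0 <= i ^+ 2 := sqr_ge0 _.
move: k1 k2 s2 E2 E3 E4 E5; set a := x * (i - d); set b := x * (_ / e); set c := _ / e ^+ 2.
move: (x * (expR 1 * i ^+ 2)) (expR 1 * i ^+ 2) (x * i ^+ 2) (i ^+ 2) => w u v z.
move=> /andP[? ?] /andP[? ?] /andP[? ?] ? ? ? ?.
rewrite ler_norml; apply/andP; split; lra.
Qed.

Lemma expNln_cvg e : 0 < e -> expR (- (e * ln N%:R)) @[N --> \oo] --> (0 : R).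
Proof. by move=> e0; under eq_fun do rewrite -mulNr; exact: npw_cvg0. Qed.

Lemma zterm_cvg e : 0 < e -> psum (zterm e) @ \oo --> zeta (1 + e) - e^-1.
Proof.
move=> e0; have s1 : 1 < 1 + e by rewrite ltrDl.
have c : psum (fun n => npw n (1 + e)) N - (1 - expR (- (e * ln N%:R))) / e @[N --> \oo] --> zeta (1 + e) - e^-1.
  apply: cvgB; first exact: zeta_cvg.
  rewrite -[X in _ --> X](mul1r e^-1); apply: cvgM; last exact: cvg_cst.
  by rewrite -[X in _ --> X](subr0 (1 : R)); apply: cvgB; [exact: cvg_cst|exact: expNln_cvg].
apply: cvg_trans c; apply: near_eq_cvg; exists 1%N => // N /= N0.
rewrite [RHS]sumrB -/(psum _ _) -/(psum _ _).
rewrite (@psum_telescope (fun n => (1 - expR (- (e * ln n%:R))) / e)) //.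
by rewrite ln1 mulr0 oppr0 expR0 subrr mul0r subr0.
Qed.

Lemma lterm_cvg e : 0 < e -> psum (lterm e) @ \oo --> zetaln (1 + e) - e ^- 2.
Proof.
move=> e0; have s1 : 1 < 1 + e by rewrite ltrDl.
pose q (N : nat) := (1 + e * ln N%:R) * expR (- (e * ln N%:R)).
have q0 : q N @[N --> \oo] --> (0 : R).
  apply: (@squeeze_cvgr _ _ _ _ (fun=> 0) (fun N => (1 + 2^-1^-1) * npw N (e / 2))).
  - apply: nearW => N; have p : 0 <= e * ln N%:R by rewrite mulr_ge0 ?lnn_ge0 ?ltW.
    rewrite mulr_ge0 ?expR_ge0 ?addr_ge0 //=.
    have h := @le_1x_expR R (e * ln N%:R) 2^-1; apply: (le_trans (ler_wpM2r (expR_ge0 _) (h _ p))).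
      by rewrite invr_gt0.
    by rewrite -mulrA -expRD /npw ler_wpM2l ?ler_expR //; lra.
  - exact: cvg_cst.
  - rewrite -(mulr0 (1 + 2^-1^-1)); apply: cvgM; first exact: cvg_cst.
    by apply: npw_cvg0; rewrite divr_gt0.
have c : psum (fun n => ln n%:R * npw n (1 + e)) N - (1 - q N) / e ^+ 2 @[N --> \oo] --> zetaln (1 + e) - e ^- 2.
  apply: cvgB; first exact: zetaln_cvg.
  rewrite -[X in _ --> X](mul1r (e ^- 2)); apply: cvgM; last exact: cvg_cst.
  by rewrite -[X in _ --> X](subr0 (1 : R)); apply: cvgB; [exact: cvg_cst|exact: q0].
apply: cvg_trans c; apply: near_eq_cvg; exists 1%N => // N /= N0.
rewrite [RHS]sumrB -/(psum _ _) -/(psum _ _) /q.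
rewrite (@psum_telescope (fun n => (1 - (1 + e * ln n%:R) * expR (- (e * ln n%:R))) / e ^+ 2)) //.
by rewrite ln1 mulr0 oppr0 expR0 addr0 mul1r subrr mul0r subr0.
Qed.

Lemma gterm_cvg : psum gterm @ \oo --> euler_gamma R.
Proof.
have [|B HB] := @sum_npw R 2; first by rewrite ltr1n.
have cg : cvgn (psum gterm).
  apply: dom_cvgR HB _ => n n0; have /andP[g0 g1] := dln_inv R n0.
  by rewrite ger0_norm // npw2.
suff -> : euler_gamma R = limn (psum gterm) by [].
apply: cvg_lim => //.
have c : psum gterm N + npw N 1 @[N --> \oo] --> limn (psum gterm).
  by rewrite -[limn _]addr0; apply: cvgD => //; apply: npw_cvg0.
apply: cvg_trans c; apply: near_eq_cvg; exists 1%N => // N /= N0.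
transitivity (psum gterm N + npw N 1) => //; rewrite npw1 // /gterm /psum sumrB.
rewrite -/(psum _ _) -/(psum _ _) (@psum_telescope (fun n => ln n%:R)) // ln1 subr0.
by rewrite big_nat_recr //= addrAC.
Qed.

(** [1/e] is the sum of the increments of an antiderivative, so the difference is
    the sum of the [zterm e n], which are within
    [O(e (1 + ln n) n^(-2))] of their limits. *)
Lemma zeta_asymp : exists K : R, 0 <= K /\ forall e, 0 < e <= 1 ->
  `|zeta (1 + e) - e^-1 - euler_gamma R| <= K * e.
Proof.
have [|B HB] := @sum_ln_npw R 1 2; first by rewrite ltr1n.
exists (expR 1 * B); split; first by rewrite mulr_ge0 ?expR_ge0 ?(sumle_ge0 HB).
move=> e e01; have e0 : 0 < e by case/andP: e01.
have HB' := sumleM (ltW e0) (sumleM (expR_ge0 1) HB).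
have c : psum (fun n => zterm e n - gterm n) @ \oo --> zeta (1 + e) - e^-1 - euler_gamma R.
  rewrite (_ : psum _ = psum (zterm e) - psum gterm); last first.
    by apply/funext => N; rewrite fctE /psum sumrB.
  by apply: cvgB; [exact: zterm_cvg|exact: gterm_cvg].
rewrite -(cvg_lim _ c) // [leRHS]mulrC; apply: lim_dom_le HB' _ => n n0.
exact: zterm_gterm.
Qed.

Lemma zetaln_asymp : exists K : R, 0 <= K /\ forall e, 0 < e <= 1 ->
  `|zetaln (1 + e) - e ^- 2| <= K.
Proof.
have [|B HB] := @sum_ln_npw R 1 2; first by rewrite ltr1n.
have E0 : 0 <= 1 + expR (1 : R) by rewrite addr_ge0 ?expR_ge0.
exists ((1 + expR 1) * B); split; first by rewrite mulr_ge0 ?(sumle_ge0 HB).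
move=> e e01; have e0 : 0 < e by case/andP: e01.
rewrite -(cvg_lim _ (lterm_cvg e0)) //; apply: lim_dom_le (sumleM E0 HB) _ => n n0.
exact: lterm_le.
Qed.

End Zeta.

(** * Dirichlet characters and separation of residues *)

Section Characters.
Variable R : realType.
Implicit Types (chi psi : int -> R[i]) (m n : int).

(** The polynomial ['X^e - 1] is separable and splits over the complex numbers. *)
Lemma prim_root_exists (e : nat) : (0 < e)%N -> exists w : R[i], e.-primitive_root w.
Proof.
pose p : {poly R[i]} := 'X^e - 1; have [r Dp] := closed_field_poly_normal p.
move=> e0; rewrite (monicP _) ?monicXnsubC // scale1r in Dp.
have rn1: all e.-unity_root r by apply/allP=> z; rewrite -root_prod_XsubC -Dp.
have sz_r: (e < (size r).+1)%N by rewrite -(size_prod_XsubC r id) -Dp size_XnsubC.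
have [|z] := hasP (has_prim_root e0 rn1 _ sz_r); last by exists z.
by rewrite -separable_prod_XsubC -Dp separable_Xn_sub_1 // pnatr_eq0 -lt0n.
Qed.

(** Characters of finite groups take their values in [algC].  Sending a primitive
    [e]-th root of unity of [algC] to one of [R[i]] is multiplicative on [e]-th
    roots of unity, with trivial kernel, which is all that is asked of it to
    transport a linear character. *)
Lemma root_transport (e : nat) : (0 < e)%N -> exists tau : algC -> R[i],
  (forall z1 z2, z1 ^+ e = 1 -> z2 ^+ e = 1 -> tau (z1 * z2) = tau z1 * tau z2) /\
  (forall z, z ^+ e = 1 -> tau z = 1 -> z = 1) /\ (forall z, tau z != 0).
Proof.
move=> e0; have [w wP] := C_prim_root_exists e0; have [q qP] := prim_root_exists e0.
(* The discrete logarithm in base [w], with a default value away from the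
   roots of unity. *)
pose k (z : algC) := if pselect (z ^+ e = 1) is left h then val (sval (prim_rootP wP h)) else 0%N.
have kE z : z ^+ e = 1 -> z = w ^+ k z.
  by rewrite /k; case: pselect => // h _; case: (prim_rootP wP h).
exists (fun z => q ^+ k z); split; [|split].
- move=> z1 z2 h1 h2; have h12 : (z1 * z2) ^+ e = 1 by rewrite exprMn h1 h2 mulr1.
  rewrite -exprD; apply/eqP; rewrite (eq_prim_root_expr qP) -(eq_prim_root_expr wP).
  by rewrite exprD -!kE.
- move=> z h; rewrite -[1](expr0 q) => /eqP; rewrite (eq_prim_root_expr qP).
  by rewrite -(eq_prim_root_expr wP) -kE // expr0 => /eqP.
- move=> z; apply: expf_neq0; apply/eqP => q0; have := prim_expr_order qP.
  by rewrite q0 expr0n gtn_eqF //; apply/eqP; rewrite eq_sym oner_eq0.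
Qed.

Variable d : nat.
Hypothesis hd : (2 <= d)%N.

Let d0 : (0 < d)%N. Proof. exact: ltnW. Qed.
Let dz : d%:Z != 0. Proof. by rewrite -lt0n. Qed.

Definition resid n : nat := `|(n %% d%:Z)%Z|%N.

Lemma residE n : (resid n)%:Z = (n %% d%:Z)%Z.
Proof. by rewrite /resid gez0_abs // modz_ge0. Qed.

Lemma resid_mod n : (n = resid n %[mod d%:Z])%Z.
Proof. by rewrite residE modz_mod. Qed.

Lemma resid_lt n : (resid n < d)%N.
Proof. by rewrite -ltz_nat residE ltz_pmod. Qed.

Lemma coprime_resid n : coprimez n d%:Z = coprime (resid n) d.
Proof. by rewrite /coprimez -gcdz_modl -residE. Qed.

Lemma resid_eq m n : (m = n %[mod d%:Z])%Z -> resid m = resid n.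
Proof. by rewrite /resid => ->. Qed.

Lemma eqmodM m m' n n' : (m = m' %[mod d%:Z])%Z -> (n = n' %[mod d%:Z])%Z ->
  (m * n = m' * n' %[mod d%:Z])%Z.
Proof. by move=> h1 h2; rewrite -modzMm h1 h2 modzMm. Qed.

Section OneChar.
Variable chi : int -> R[i].
Hypothesis chiP : dirichlet_character d chi.

Lemma dchM m n : chi (m * n) = chi m * chi n. Proof. by case: chiP. Qed.
Lemma dch_mod m n : (m = n %[mod d%:Z])%Z -> chi m = chi n.
Proof. by case: chiP => _ + _; apply. Qed.
Lemma dch_neq0 n : (chi n != 0) = coprimez n d%:Z. Proof. by case: chiP. Qed.
Lemma dch_eq0 n : ~~ coprimez n d%:Z -> chi n = 0.
Proof. by rewrite -dch_neq0 negbK => /eqP. Qed.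

Lemma dch1 : chi 1 = 1.
Proof.
have h : chi 1 != 0 by rewrite dch_neq0 coprimezE coprime1n.
by apply: (mulfI h); rewrite -dchM !mulr1.
Qed.

Lemma dch_resid n : chi n = chi (resid n).
Proof. by apply: dch_mod; exact: resid_mod. Qed.

Lemma dchXn (a k : nat) : chi (a ^ k)%N%:Z = chi a%:Z ^+ k.
Proof. by elim: k => [|k IH]; rewrite ?expr0 ?dch1 // expnS PoszM exprS dchM IH. Qed.

Lemma dch_root n : coprimez n d%:Z -> chi n ^+ totient d = 1.
Proof.
rewrite coprime_resid dch_resid => cn; rewrite -dchXn -dch1; apply: dch_mod.
by rewrite !modz_nat Euler_exp_totient.
Qed.

Lemma normc_dch n : normc (chi n) = (coprimez n d%:Z)%:R.
Proof.
case: (boolP (coprimez n d%:Z)) => [cn|cn]; last by rewrite dch_eq0 // normc0.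
apply/eqP; rewrite -(@pexpr_eq1 _ _ (totient d)) ?totient_gt0 ?normc_ge0 //.
by rewrite -normcX dch_root // normc1.
Qed.

Lemma normc_dch_le1 n : normc (chi n) <= 1.
Proof. by rewrite normc_dch lern1 leq_b1. Qed.

Lemma dch_conj_inv n : coprimez n d%:Z -> conjc (chi n) = (chi n)^-1.
Proof.
move=> cn; rewrite invc_norm norm_normc normc_dch cn.
by rewrite rmorph_nat expr1n invr1 mul1r.
Qed.

End OneChar.

Lemma principal_dch : dirichlet_character d (principal_character R d).
Proof.
split.
- by move=> m n; rewrite /principal_character coprimezMl -natrM mulnb.
- by move=> m n /resid_eq h; rewrite /principal_character !coprime_resid h.
- by move=> n; rewrite /principal_character pnatr_eq0 eqb0 negbK.
Qed.

Lemma dch_mul chi psi : dirichlet_character d chi -> dirichlet_character d psi ->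
  dirichlet_character d (fun n => psi n * chi n).
Proof.
move=> [c1 c2 c3] [p1 p2 p3]; split.
- by move=> m n; rewrite c1 p1 mulrACA.
- by move=> m n h; rewrite (c2 _ _ h) (p2 _ _ h).
- by move=> n; rewrite mulf_eq0 negb_or c3 p3 andbb.
Qed.

Lemma dch_conj chi : dirichlet_character d chi ->
  dirichlet_character d (fun n => conjc (chi n)).
Proof.
move=> [c1 c2 c3]; split.
- by move=> m n; rewrite c1 rmorphM.
- by move=> m n h; rewrite (c2 _ _ h).
- by move=> n; rewrite conjc_eq0 c3.
Qed.

(** A character modulo [d] is given by finitely many data: at each residue, either
    [0] or the exponent of a fixed primitive [totient d]-th root of unity. *)
Lemma finite_dch : finite_set [set chi : int -> R[i] | dirichlet_character d chi].
Proof.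
have e0 : (0 < totient d)%N by rewrite totient_gt0.
have [w wP] := prim_root_exists e0.
pose e := totient d.
pose g (f : {ffun 'I_d.+1 -> 'I_e.+1}) (n : int) : R[i] :=
  (* The exponent [e], out of the range of the discrete logarithm, encodes [0]. *)
  let k := f (inord (resid n)) in if k == e :> nat then 0 else w ^+ k.
apply: (@sub_finite_set _ _ (g @` setT)); last first.
  by apply: finite_image; exact: finite_finset.
move=> chi chiP /=.
have rP n : coprimez n d%:Z -> {i : 'I_e | chi n = w ^+ i}.
  by move=> cn; apply: prim_rootP => //; exact: dch_root.
pose k (n : nat) : nat := if pselect (coprimez n%:Z d%:Z) is left h then val (sval (rP _ h)) else e.
have ke (j : nat) : (k j < e.+1)%N.
  by rewrite /k; case: pselect => // h; case: (rP _ h) => i _ /=; rewrite ltnS ltnW.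
exists [ffun i : 'I_d.+1 => inord (k i)] => //; apply/funext => n.
rewrite /g ffunE !inordK // ?ltnS ?(ltnW (resid_lt n)) //.
have crE : coprimez n d%:Z = coprimez (resid n) d%:Z by rewrite coprime_resid.
rewrite /k; case: pselect => h.
  case: (rP _ h) => i Ei /=; rewrite ltn_eqF // -Ei -dch_resid //.
by rewrite eqxx (dch_eq0 chiP) // crE; apply/negP.
Qed.

(** The irreducible characters of the abelian group of units modulo [d] are
    linear and their kernels intersect trivially; hence one of them is nontrivial
    at the class of [m]. *)
Lemma dch_separation m : coprimez m d%:Z -> ~ (m = 1 %[mod d%:Z])%Z ->
  exists psi : int -> R[i], dirichlet_character d psi /\ psi m <> 1.
Proof.
move=> cm m1.
have e0 : (0 < totient d)%N by rewrite totient_gt0.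
have [tau [tM [t1 t0]]] := root_transport e0.
pose G := units_Zp d.
(* The class of [n] among the units, and [1] if [n] is not a unit. *)
pose u (n : int) : {unit 'Z_d} := insubd (1%g : {unit 'Z_d}) ((resid n)%:R : 'Z_d).
have uU n : coprimez n d%:Z -> ((resid n)%:R : 'Z_d) \is a GRing.unit.
  by rewrite coprime_resid unitZpE // coprime_sym.
have uE n : coprimez n d%:Z -> val (u n) = (resid n)%:R.
  by move=> cn; rewrite /u insubdK // uU.
have uM n1 n2 : coprimez n1 d%:Z -> coprimez n2 d%:Z -> u (n1 * n2) = (u n1 * u n2)%g.
  move=> c1 c2; apply: val_inj; rewrite /= !uE ?coprimezMl ?c1 ?c2 // -natrM.
  apply: ord_inj; rewrite !val_Zp_nat //; apply/eqP; rewrite -eqz_nat -!modz_nat.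
  by apply/eqP; rewrite -resid_mod PoszM; apply: eqmodM; rewrite -resid_mod.
have um : u m != 1%g.
  apply/eqP => h; apply: m1; have /= := congr1 val h; rewrite uE // => /(congr1 (@nat_of_ord _)).
  rewrite val_Zp_nat // modn_small ?resid_lt // => E.
  rewrite resid_mod E /=; by rewrite Zp_cast // modn_small.
have [i Hi] : exists i : Iirr G, 'chi_i (u m) != 'chi_i 1%g.
  apply/existsP; apply: contraNT um; rewrite negb_exists => /forallP H.
  suff : u m \in (\bigcap_i cfker 'chi[G]_i)%SET by rewrite TI_cfker_irr => /set1gP ->.
  apply/finset.bigcapP => i _; rewrite cfkerEirr finset.inE.
  by have := H i; rewrite negbK.
have lin : 'chi_i \is a linear_char by apply/char_abelianP; exact: units_Zp_abelian.
have inG x : x \in G by rewrite inE.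
have root x : 'chi_i x ^+ totient d = 1.
  by rewrite -card_units_Zp // -lin_charX // expg_cardG // lin_char1.
exists (fun n => if coprimez n d%:Z then tau ('chi_i (u n)) else 0); split; last first.
  rewrite cm => /(t1 _ (root _)) h; move: Hi; by rewrite h lin_char1 // eqxx.
split.
- move=> a b; rewrite coprimezMl; case: (boolP (coprimez a _)) => ca; last by rewrite mul0r.
  case: (boolP (coprimez b _)) => cb /=; last by rewrite mulr0.
  by rewrite uM // lin_charM // tM.
- by move=> a b /resid_eq h; rewrite !coprime_resid /u h.
- by move=> n; case: ifP => // _; rewrite ?t0 ?eqxx.
Qed.

End Characters.

(** * Orthogonality relations *)

Section Orthogonality.
Variable R : realType.
Implicit Types (chi psi : int -> R[i]) (m n : int).
Variable d : nat.
Hypothesis hd : (2 <= d)%N.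
Let d0 : (0 < d)%N. Proof. exact: ltnW. Qed.

Definition dchars : seq (int -> R[i]) :=
  finmap.enum_fset (fset_set [set chi : int -> R[i] | dirichlet_character d chi]).

Lemma mem_dchars chi : (chi \in dchars) <-> dirichlet_character d chi.
Proof.
have -> : (chi \in dchars) = (chi \in [set chi : int -> R[i] | dirichlet_character d chi]).
  by rewrite -in_fset_set //; exact: finite_dch.
by split => [/set_mem|H]; [|apply/mem_set].
Qed.

Lemma uniq_dchars : uniq dchars. Proof. exact: finmap.fset_uniq. Qed.

(** Turns the finite sum over a set in the definition of [gamma1_ap] into a sum
    over an enumeration. *)
Lemma fsbig_dchars (F : (int -> R[i]) -> R[i]) :
  \sum_(chi \in nonprincipal R d) F chi =
  \sum_(chi <- dchars | chi != principal_character R d) F chi.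
Proof.
rewrite -[RHS]big_filter [RHS]fsbig_seq.
  apply: eq_fsbigl; apply/seteqP; split => chi /=.
    by case=> h1 h2; rewrite mem_filter; apply/andP; split; [apply/eqP|apply/mem_dchars].
  by rewrite mem_filter => /andP[/eqP h2 /mem_dchars h1].
by rewrite filter_uniq // uniq_dchars.
Qed.

(** Multiplication by a character [psi] with [psi m <> 1] permutes the
    characters, and multiplies the sum by [psi m]. *)
Lemma sum_dchars_neq1 m : coprimez m d%:Z -> ~ (m = 1 %[mod d%:Z])%Z ->
  \sum_(chi <- dchars) chi m = 0.
Proof.
move=> cm m1; have [psi [psiP psim]] := dch_separation R hd cm m1.
pose h chi := fun n => psi n * chi n.
have hP : perm_eq (map h dchars) dchars.
  have inj : {in dchars &, injective h}.
    move=> a b /mem_dchars aP /mem_dchars bP hab.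
    have E n : psi n * a n = psi n * b n by exact: (congr1 (fun f => f n) hab).
    apply/funext => n; case: (boolP (coprimez n d%:Z)) => cn.
      by apply: (mulfI _ (E n)); rewrite (dch_neq0 psiP).
    by rewrite (dch_eq0 aP) // (dch_eq0 bP).
  have um : uniq (map h dchars) by rewrite map_inj_in_uniq // uniq_dchars.
  have sub : {subset map h dchars <= dchars}.
    by move=> _ /mapP[chi /mem_dchars chiP ->]; apply/mem_dchars; exact: dch_mul.
  have sz : (size dchars <= size (map h dchars))%N by rewrite size_map.
  apply: uniq_perm => //; first exact: uniq_dchars.
  by have [] := uniq_min_size um sub sz.
have E : \sum_(chi <- dchars) chi m = psi m * \sum_(chi <- dchars) chi m.
  by rewrite -{1}(perm_big _ hP) big_map mulr_sumr.
apply/eqP; move: E => /eqP; rewrite -subr_eq0 -{1}(mul1r (\sum_(chi <- _) _)) -mulrBl mulf_eq0.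
by case/orP => //; rewrite subr_eq0 => /eqP E; case: psim.
Qed.

(** Multiplication by a unit [m] with [chi m <> 1] permutes the residues, and
    multiplies the sum by [chi m]. *)
Lemma sum_dch_period chi : dirichlet_character d chi -> chi <> principal_character R d ->
  \sum_(0 <= i < d) chi i%:Z = 0.
Proof.
move=> chiP chi1.
have [m [cm chim]] : exists m, coprimez m d%:Z /\ chi m <> 1.
  apply: contrapT => H; apply: chi1; apply/funext => n; rewrite /principal_character.
  case: (boolP (coprimez n d%:Z)) => cn; last by rewrite (dch_eq0 chiP).
  by apply: contrapT => h; apply: H; exists n.
have : \sum_(0 <= i < d) chi i%:Z = chi m * \sum_(0 <= i < d) chi i%:Z.
  rewrite mulr_sumr !big_mkord.
  have lt (i : 'I_d) : (resid d (m * i%:Z) < d)%N by apply: resid_lt.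
  pose f (i : 'I_d) := Ordinal (lt i).
  have finj : injective f.
    move=> i j /(congr1 val) /= /(congr1 Posz); rewrite !residE // => /eqP.
    rewrite -subr_eq0 => h; apply/val_inj/eqP; rewrite -eqz_nat /=.
    have : (m * i%:Z == m * j%:Z %[mod d%:Z])%Z by rewrite -subr_eq0.
    rewrite eqz_mod_dvd -mulrBr Gauss_dvdzr 1?coprimez_sym // -eqz_mod_dvd.
    by rewrite !modz_nat !modn_small.
  rewrite (reindex_inj finj); apply: eq_bigr => i _.
  by rewrite -(dchM chiP) [in RHS](dch_resid hd chiP).
move=> /eqP; rewrite -subr_eq0 -{1}(mul1r (\sum_(_ <= _ < _) _)) -mulrBl mulf_eq0.
by case/orP => [|/eqP//]; rewrite subr_eq0 => /eqP E; case: chim.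
Qed.

Lemma sum_principal_period : \sum_(0 <= i < d) principal_character R d i%:Z = (totient d)%:R.
Proof.
rewrite totient_count_coprime natr_sum; apply: eq_bigr => i _.
by rewrite /principal_character coprimezE coprime_sym.
Qed.

(** Both sides are the sum of [chi i] over all characters and all residues: only
    [i = 1] contributes when the characters are summed first, and only the
    principal character when the residues are. *)
Lemma size_dchars : (size dchars)%:R = (totient d)%:R :> R[i].
Proof.
have : \sum_(0 <= i < d) \sum_(chi <- dchars) chi i%:Z = (size dchars)%:R.
  rewrite (bigD1_seq 1%N) ?mem_index_iota ?iota_uniq //= [X in _ + X]big1_seq ?addr0.
    transitivity (\sum_(chi <- dchars) (1 : R[i])).
      by apply: eq_big_seq => chi /mem_dchars; exact: dch1.
    by rewrite big_const_seq count_predT iter_addr_0.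
  move=> i /andP[i1]; rewrite mem_index_iota /= => id.
  case: (boolP (coprimez i d%:Z)) => ci.
    apply: sum_dchars_neq1 => // /eqP; rewrite !modz_nat eqz_nat !modn_small //.
    exact/negP.
  by rewrite big1_seq // => chi /andP[_ /mem_dchars chiP]; rewrite (dch_eq0 chiP).
move=> <-; rewrite exchange_big /= (bigD1_seq (principal_character R d)) ?uniq_dchars //=; last first.
  by apply/mem_dchars; exact: principal_dch.
rewrite sum_principal_period [X in _ + X]big1_seq ?addr0 // => chi /andP[/eqP h /mem_dchars chiP].
exact: sum_dch_period.
Qed.

Lemma dchars_orthogonality (a : int) (n : int) : coprimez a d%:Z ->
  \sum_(chi <- dchars) conjc (chi a) * chi n =
  if (n == a %[mod d%:Z])%Z then (totient d)%:R else 0.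
Proof.
move=> ca.
have [b ba] : exists b : int, (b * a = 1 %[mod d%:Z])%Z.
  (* An inverse [b] of [a]: then [conjc (chi a) * chi n = chi (b * n)]. *)
  have /coprimezP[[u v] /= uv] := ca; exists u.
  by rewrite -[in RHS]uv addrC modzMDl.
have cb : coprimez b d%:Z.
  have : coprimez (b * a) d%:Z by rewrite coprime_resid // (resid_eq ba) -coprime_resid // coprimezE coprime1n.
  by rewrite coprimezMl => /andP[].
have E chi : chi \in dchars -> conjc (chi a) * chi n = chi (b * n).
  move=> /mem_dchars chiP; rewrite (dch_conj_inv hd chiP ca) (dchM chiP); congr (_ * _).
  have h : chi a != 0 by rewrite (dch_neq0 chiP).
  by apply: (mulIf h); rewrite mulVf // -(dchM chiP) (dch_mod chiP ba) (dch1 chiP).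
rewrite (eq_big_seq _ E).
case: ifP => [/eqP na|na].
  rewrite -size_dchars; transitivity (\sum_(chi <- dchars) (1 : R[i])).
    apply: eq_big_seq => chi /mem_dchars chiP; rewrite -(dch1 chiP).
    by apply: (dch_mod chiP); rewrite -ba; exact: eqmodM.
  by rewrite big_const_seq count_predT iter_addr_0.
case: (boolP (coprimez n d%:Z)) => cn; last first.
  rewrite big1_seq // => chi /andP[_ /mem_dchars chiP]; rewrite (dch_eq0 chiP) //.
  by rewrite coprimezMl negb_and cn orbT.
apply: sum_dchars_neq1; first by rewrite coprimezMl cb cn.
move=> h; move/eqP: na; apply.
have : (a * (b * n) = a * 1 %[mod d%:Z])%Z by apply: eqmodM.
rewrite mulr1 => <-; rewrite mulrA [a * b]mulrC -[n in LHS]mul1r.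
by apply: eqmodM.
Qed.

(** Complete periods contribute zero. *)
Lemma dch_psum_bounded chi : dirichlet_character d chi -> chi <> principal_character R d ->
  forall N, normc (psum (fun k => chi k%:Z) N) <= d%:R.
Proof.
move=> chiP chi1 N; have S0 := sum_dch_period chiP chi1.
have c0 : chi 0 = 0.
  by rewrite (dch_eq0 chiP) // coprimezE /= /coprime gcd0n; move: hd; case: (d) => [|[|]].
have block q : \sum_(0 <= k < q * d) chi k%:Z = 0.
  elim: q => [|q IH]; first by rewrite mul0n big_geq.
  rewrite (big_cat_nat _ (n := (q * d)%N)) ?leq_pmul2r //= IH add0r.
  rewrite mulSn -{1}(add0n (q * d)%N) big_addn addnK -[RHS]S0.
  apply: eq_bigr => i _; apply: (dch_mod chiP).
  by rewrite PoszD PoszM addrC modzMDl.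
have -> : psum (fun k => chi k%:Z) N = \sum_(0 <= k < N) chi k%:Z.
  case: N => [|N]; first by rewrite /psum !big_geq.
  by rewrite /psum [RHS]big_ltn // c0 add0r.
rewrite (big_cat_nat _ (n := (N %/ d * d)%N)) ?leq_trunc_div //= block add0r.
apply: (le_trans (normc_sum _ _ _)).
apply: (@le_trans _ _ (\sum_(N %/ d * d <= i < N) (1 : R))).
  by apply: ler_sum => i _; exact: (normc_dch_le1 hd chiP).
rewrite sumr_const_nat ler_nat.
have := divn_eq N d; have := ltn_pmod N d0; lia.
Qed.

End Orthogonality.

(** * Dirichlet series twisted by a multiplicative function *)

Section Twist.
Variable R : realType.
Local Notation C := (R[i]^o).
Implicit Types (n : nat) (s e x : R) (a b : nat -> R) (f : nat -> R[i]).

Lemma cvg_congr (T : Type) (V : topologicalType) (F : set_system T) {FF : Filter F}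
  (g h : T -> V) (l : V) :
  g x @[x --> F] --> l -> (\forall x \near F, g x = h x) -> h x @[x --> F] --> l.
Proof. by move=> gl gh; apply: cvg_trans gl; exact: near_eq_cvg. Qed.

Definition twist f a s : C := limn (fun N => psum (fun n => f n * (a n * npw n s)%:C) N : C).

(** The growth condition shared by [1], [ln], [vonMangoldt] and [moebius], under
    which the series below converge absolutely for [1 < s]. *)
Definition log_bounded a := forall n, (0 < n)%N -> `|a n| <= 1 + ln n%:R.

Lemma log_bounded1 : log_bounded (fun=> 1).
Proof. by move=> n _; rewrite normr1 lerDl lnn_ge0. Qed.

Lemma log_bounded_ln : log_bounded (fun n => ln n%:R).
Proof. by move=> n _; rewrite ger0_norm ?lnn_ge0 // lerDr. Qed.

Lemma log_bounded_vonMangoldt : log_bounded (vonMangoldt R).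
Proof.
move=> n _; rewrite ger0_norm ?vonMangoldt_ge0 //.
by rewrite (le_trans (vonMangoldt_le _ _)) // lerDr.
Qed.

Lemma log_bounded_moebius : log_bounded (fun n => (moebius n)%:~R).
Proof.
move=> n _; apply: (@le_trans _ _ 1); last by rewrite lerDl lnn_ge0.
by rewrite -intr_norm -[1]/(1%:~R) ler_int moebius_le1.
Qed.

Lemma twist_bound s : 1 < s -> exists B : R, forall f a, (forall n, normc (f n) <= 1) -> log_bounded a ->
  sumle (fun n => normc (f n * (a n * npw n s)%:C)) B.
Proof.
move=> /(sum_ln_npw 1)[B HB]; exists B => f a f1 la; apply: sumle_dom HB _ => n n0.
rewrite normc_ge0 /= normcM normc_real normrM [`|npw _ _|]ger0_norm ?npw_ge0 // expr1.
rewrite -[leRHS]mul1r ler_pM ?normc_ge0 ?mulr_ge0 ?npw_ge0 //.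
by rewrite ler_wpM2r ?npw_ge0 // la.
Qed.

Lemma twist_cvg f a s : (forall n, normc (f n) <= 1) -> log_bounded a -> 1 < s ->
  (psum (fun n => f n * (a n * npw n s)%:C) N : C) @[N --> \oo] --> twist f a s.
Proof.
move=> f1 la s1; have [B HB] := twist_bound s1.
have [n n0|l [cl _]] := @dom_cvgC _ _ (fun n => f n * (a n * npw n s)%:C) _ (HB f a f1 la).
  exact: lexx.
rewrite /twist (limC_eq cl); exact: cl.
Qed.

Definition dconv a b (k : nat) : R := \sum_(n <- divisors k) a n * b (k %/ n)%N.

(** A completely multiplicative [f] factors out of the Dirichlet convolution. *)
Lemma twist_mul f a b s : (forall n, normc (f n) <= 1) ->
  (forall m n, f (m * n)%N = f m * f n) -> log_bounded a -> log_bounded b -> 1 < s ->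
  (psum (fun n => f n * (dconv a b n * npw n s)%:C) N : C) @[N --> \oo] -->
  (twist f a s * twist f b s : C).
Proof.
move=> f1 fM la lb s1; have [B HB] := twist_bound s1.
have [_ A1] := HB f a f1 la; have [_ B1] := HB f b f1 lb.
have := dirichlet_product A1 B1 (twist_cvg f1 la s1) (twist_cvg f1 lb s1).
apply: eq_psum_cvg => k k0; rewrite divisor_sumE // /dconv mulr_suml rmorph_sum mulr_sumr.
apply: eq_big_seq => n; rewrite -dvdn_divisors // => /dvdnP[m Ek].
have n0 : (0 < n)%N by move: k0; rewrite Ek muln_gt0 => /andP[].
have m0 : (0 < m)%N by move: k0; rewrite Ek muln_gt0 => /andP[].
rewrite Ek mulnK // fM npwM // !rmorphM /=; ring.
Qed.

Section Mult.
Variable f : nat -> R[i].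
Hypothesis f1 : forall n, normc (f n) <= 1.
Hypothesis fM : forall m n, f (m * n)%N = f m * f n.
Hypothesis f_1 : f 1%N = 1.
Variable s : R.
Hypothesis s1 : 1 < s.

(** The convolution identity [Lambda * 1 = log]; with [f = chi] the right-hand
    side is [- L'(s, chi)]. *)
Lemma twist_vonMangoldt :
  twist f (vonMangoldt R) s * twist f (fun=> 1) s = twist f (fun n => ln n%:R) s.
Proof.
have c := twist_mul f1 fM log_bounded_vonMangoldt log_bounded1 s1.
apply: (limC_unique c); apply: eq_psum_cvg (twist_cvg f1 log_bounded_ln s1) => n n0.
rewrite /dconv (eq_bigr (vonMangoldt R)) ?sum_vonMangoldt // => m _; exact: mulr1.
Qed.

Lemma twist_moebius :
  twist f (fun n => (moebius n)%:~R) s * twist f (fun=> 1) s = 1.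
Proof.
have c := twist_mul f1 fM log_bounded_moebius log_bounded1 s1.
apply: (limC_unique c); apply: (@cvgC_bound _ _ _ _ _ _ (fun=> 0)); last exact: cvg_cst.
(* As [mu * 1] vanishes beyond [1], the partial sums are all [1] from
   [N = 2] on. *)
exists 2%N => // N /= N2; rewrite [X in X - 1](_ : _ = 1) ?subrr ?normc0 //.
rewrite /psum (bigD1_seq 1%N) ?iota_uniq ?mem_index_iota //=.
rewrite [X in _ + X]big1_seq ?addr0.
  by rewrite f_1 mul1r npw_1n mulr1 /dconv (_ : divisors 1 = [:: 1%N]) // big_seq1 mulr1.
move=> k /andP[k1]; rewrite mem_index_iota => /andP[k0 _].
rewrite /dconv (eq_bigr (fun m => (moebius m)%:~R : R)); last by move=> m _; exact: mulr1.
by rewrite -(rmorph_sum (intmul 1)) sum_moebius //= (negbTE k1) mul0r mulr0.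
Qed.

Lemma normc_twist_moebius : normc (twist f (fun n => (moebius n)%:~R) s) <= zeta s.
Proof.
apply: (cvgC_le (twist_cvg f1 log_bounded_moebius s1)); apply: nearW => N.
apply: (@le_trans _ _ (psum (fun n => npw n s) N)).
  apply: (le_trans (normc_sum _ _ _)); apply: ler_sum => n _.
  rewrite normcM normc_real normrM [`|npw _ _|]ger0_norm ?npw_ge0 // mulrA.
  rewrite ler_piMl ?npw_ge0 // mulr_ile1 ?normc_ge0 //.
  by rewrite -intr_norm -[1]/(1%:~R) ler_int moebius_le1.
apply: nondecreasing_cvgn_le.
  by apply: psum_nd => n _; exact: npw_ge0.
by apply/cvg_ex; eexists; exact: zeta_cvg.
Qed.

End Mult.

Lemma twist_zeta s : 1 < s -> twist (fun=> 1) (fun=> 1) s = (zeta s)%:C.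
Proof.
move=> s1; apply: limC_eq; apply: cvg_trans (cvgC_real (zeta_cvg s1)); apply: near_eq_cvg; apply: nearW => N.
by rewrite /psum rmorph_sum; apply: eq_bigr => n _; rewrite !mul1r.
Qed.

Lemma twist_zetaln s : 1 < s -> twist (fun=> 1) (fun n => ln n%:R) s = (zetaln s)%:C.
Proof.
move=> s1; apply: limC_eq; apply: cvg_trans (cvgC_real (zetaln_cvg s1)); apply: near_eq_cvg; apply: nearW => N.
by rewrite /psum rmorph_sum; apply: eq_bigr => n _; rewrite !mul1r.
Qed.

Definition mangoldt_sum s : R := limn (psum (fun n => vonMangoldt R n * npw n s)).

Lemma mangoldt_sum_cvg (P : pred nat) s : 1 < s ->
  cvgn (psum (fun n => (P n)%:R * (vonMangoldt R n * npw n s))).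
Proof.
move=> /(sum_ln_npw 1)[B HB]; apply: dom_cvgR HB _ => n n0.
rewrite !normrM normr_nat [`|npw _ _|]ger0_norm ?npw_ge0 // mulrA ler_wpM2r ?npw_ge0 //.
rewrite -[leRHS]mul1r expr1 ler_pM // ?lern1 ?leq_b1 //; exact: log_bounded_vonMangoldt.
Qed.

Lemma twist_mangoldt_sum s : 1 < s -> twist (fun=> 1) (vonMangoldt R) s = (mangoldt_sum s)%:C.
Proof.
move=> s1; apply: limC_eq; have c : psum (fun n => vonMangoldt R n * npw n s) @ \oo --> mangoldt_sum s.
  have := @mangoldt_sum_cvg predT s s1; rewrite (_ : (fun n => _) = (fun n => vonMangoldt R n * npw n s)) //.
  by apply/funext => n; rewrite mul1r.
apply: cvg_trans (cvgC_real c); apply: near_eq_cvg; apply: nearW => N.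
by rewrite /psum rmorph_sum; apply: eq_bigr => n _; rewrite mul1r.
Qed.

Lemma mangoldt_sum_zeta s : 1 < s -> mangoldt_sum s * zeta s = zetaln s.
Proof.
move=> s1; apply: complexI; rewrite rmorphM /= -twist_mangoldt_sum // -twist_zeta // -twist_zetaln //.
by apply: twist_vonMangoldt => // [n|m n]; rewrite ?normc1 ?mulr1.
Qed.

Lemma near_right0 (P : R -> Prop) (r : R) : 0 < r ->
  (forall e, 0 < e -> e <= r -> P e) -> \forall e \near (0 : R)^'+, P e.
Proof.
move=> r0 H; near=> e; apply: H; first by near: e; exact: nbhs_right_gt.
by near: e; exact: nbhs_right_le.
Unshelve. all: by end_near. Qed.

Lemma cvg_eps0 : e @[e --> (0 : R)^'+] --> (0 : R).
Proof. by apply: cvg_within_filter; exact: cvg_id. Qed.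

Lemma cvg_linear0 (K : R) : K * e @[e --> (0 : R)^'+] --> (0 : R).
Proof.
have := cvgM (cvg_cst K) cvg_eps0; rewrite mulr0; exact.
Qed.

Lemma cvg_real_bound (f : R -> R) (l K : R) :
  (\forall e \near (0 : R)^'+, `|f e - l| <= K * e) -> f e @[e --> (0 : R)^'+] --> l.
Proof.
move=> H; apply/cvgrPdist_lt => eps eps0.
have /cvgrPdist_lt/(_ _ eps0) H2 := cvg_linear0 K.
apply: filterS2 H H2 => e h1 h2; rewrite distrC (le_lt_trans h1) //.
by rewrite (le_lt_trans (ler_norm _)) // -normrN -sub0r.
Qed.

Lemma ezeta_cvg : e * zeta (1 + e) @[e --> (0 : R)^'+] --> (1 : R).
Proof.
have [K [K0 H]] := zeta_asymp R.
apply: (@cvg_real_bound _ _ (`|euler_gamma R| + K)); apply: (@near_right0 _ 1) => // e e0 e1.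
have := H e; rewrite e0 e1 => /(_ isT) h.
have -> : e * zeta (1 + e) - 1 = e * ((zeta (1 + e) - e^-1 - euler_gamma R) + euler_gamma R).
  by field; rewrite gt_eqF.
rewrite normrM gtr0_norm // mulrC ler_wpM2r ?(ltW e0) //.
rewrite (le_trans (ler_normD _ _)) // addrC lerD2l (le_trans h) // ler_piMr //.
Qed.

(** The left-hand side is
    [(e * zetaln (1 + e) - zeta (1 + e)) / (e * zeta (1 + e))], whose numerator
    tends to [- gamma] since the poles [1/e] cancel. *)
Lemma mangoldt_sum_asymp : mangoldt_sum (1 + e) - e^-1 @[e --> (0 : R)^'+] --> - euler_gamma R.
Proof.
have [K [K0 H]] := zeta_asymp R; have [K' [K0' H']] := zetaln_asymp R.
have c1 : e * zetaln (1 + e) - zeta (1 + e) @[e --> (0 : R)^'+] --> - euler_gamma R.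
  apply: (@cvg_real_bound _ _ (K' + K)); apply: (@near_right0 _ 1) => // e e0 e1.
  have := H e; rewrite e0 e1 => /(_ isT) h; have := H' e; rewrite e0 e1 => /(_ isT) h'.
  have -> : e * zetaln (1 + e) - zeta (1 + e) - - euler_gamma R =
    e * (zetaln (1 + e) - e ^- 2) - (zeta (1 + e) - e^-1 - euler_gamma R).
    by field; rewrite gt_eqF.
  rewrite (le_trans (ler_normB _ _)) // normrM gtr0_norm // mulrDl lerD //.
  by rewrite mulrC ler_wpM2r // ltW.
have c2 : (e * zeta (1 + e))^-1 @[e --> (0 : R)^'+] --> (1 : R)^-1.
  by apply: cvgV => //; exact: ezeta_cvg.
have c3 : (e * zetaln (1 + e) - zeta (1 + e)) / (e * zeta (1 + e)) @[e --> (0 : R)^'+] -->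
    - euler_gamma R / 1 by exact: (cvgM c1 c2).
rewrite divr1 in c3.
apply: (cvg_congr c3); apply: (@near_right0 _ 1) => // e e0 e1 /=.
have s1 : 1 < 1 + e by rewrite ltrDl.
have z0 : 0 < zeta (1 + e).
  have c := zeta_cvg s1; rewrite (@lt_le_trans _ _ (psum (fun n => npw n (1 + e)) 2)) //.
    by rewrite psumS // psum1 add0r npw_gt0.
  apply: nondecreasing_cvgn_le; first by apply: psum_nd => n _; exact: npw_ge0.
  by apply/cvg_ex; eexists; exact: c.
rewrite -mangoldt_sum_zeta //; field; rewrite !gt_eqF //.
Qed.

End Twist.

(** * Nonvanishing at s = 1 for real characters *)

Section Lambert.
Variable R : realType.
Local Notation C := (R[i]^o).
Implicit Types (n m k N M : nat) (x y t A : R).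

Lemma bernoulli t k : 0 <= t <= 1 -> 1 - k%:R * t <= (1 - t) ^+ k.
Proof.
move=> /andP[t0 t1]; elim: k => [|k IH]; first by rewrite mul0r subr0 expr0.
rewrite exprS -natr1.
have p : 0 <= (1 - t) ^+ k by rewrite exprn_ge0 // subr_ge0.
have q : 0 <= k%:R * (t * t) by rewrite !mulr_ge0.
have : (1 - t) * (1 - k%:R * t) <= (1 - t) * (1 - t) ^+ k by rewrite ler_wpM2l // subr_ge0.
by apply: le_trans; lra.
Qed.

Section FixedX.
Variable y : R.
Hypothesis y01 : 0 < y < 1.
Let x := y ^+ 2.

Let y0 : 0 < y. Proof. by case/andP: y01. Qed.
Let y1 : y < 1. Proof. by case/andP: y01. Qed.
Let x0 : 0 < x. Proof. exact: exprn_gt0. Qed.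
Let x1 : x < 1. Proof. by rewrite expr_lt1 // ltW. Qed.
Let x10 : 0 < 1 - x. Proof. by rewrite subr_gt0. Qed.
Let xn0 n : 0 < x ^+ n. Proof. exact: exprn_gt0. Qed.
Let xnle n m : (n <= m)%N -> x ^+ m <= x ^+ n.
Proof. by move=> nm; rewrite ler_wiXn2l // ltW. Qed.
Let xn1 n : (0 < n)%N -> 0 < 1 - x ^+ n.
Proof. by move=> n0; rewrite subr_gt0 exprn_ilt1 ?ltW // -lt0n. Qed.

(** The [x]-analogue [1 + x + .. + x^(n-1)] of the integer [n]. *)
Definition qint n : R := (1 - x ^+ n) / (1 - x).

Lemma qintS n : qint n.+1 = 1 + x * qint n.
Proof. by rewrite /qint exprS; field; rewrite gt_eqF. Qed.

(** [1 - y^n] is [1 - y] times a sum of [n] powers of [y], each at least [y^n]. *)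
Lemma mulrn_exp_le n : n%:R * y ^+ n * (1 - y) <= 1 - y ^+ n.
Proof.
elim: n => [|n IH]; first by rewrite !mul0r expr0 subrr.
have yn : 0 < y ^+ n by exact: exprn_gt0.
have yn1 : y ^+ n <= 1 by rewrite exprn_ile1 // ltW.
have h := ler_wpM2l (ltW y0) IH.
have k : 0 <= (1 - y) * (1 - y ^+ n.+1).
  by rewrite mulr_ge0 // subr_ge0 ?exprn_ile1 // ltW.
rewrite -natr1 exprS in k *; lra.
Qed.

(** The inequality between arithmetic and geometric means for [1, x, .., x^n]:
    their product is [x^(n(n+1)/2)], of geometric mean [x^(n/2) = y^n].  The
    parameter [y] stands for the square root of [x]. *)
Lemma qint_ge n : n.+1%:R * y ^+ n <= qint n.+1.
Proof.
elim: n => [|n IH]; first by rewrite qintS /qint !expr0 subrr mul0r mulr0 addr0 mulr1.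
rewrite qintS; have h := ler_wpM2l (ltW x0) IH.
apply: le_trans (lerD (lexx 1) h); have k := mulrn_exp_le n.+1.
have : n.+2%:R * y ^+ n.+1 = n.+1%:R * y ^+ n.+1 + y ^+ n.+1 by rewrite -natr1; ring.
move=> ->; rewrite /x; have -> : y ^+ 2 * (n.+1%:R * y ^+ n) = n.+1%:R * y ^+ n.+1 * y.
  by rewrite [y ^+ n.+1]exprS; ring.
lra.
Qed.

Definition lambert n : R := x ^+ n / (1 - x ^+ n).
(** The Lambert series is compared with [\sum_n f n / (n (1 - x))], which is [0]
    by assumption.  These differences decrease from [1] to [0], so Abel summation
    bounds their sum against [f] uniformly in [x]. *)
Definition lambert_gap n : R := (n%:R * (1 - x))^-1 - lambert n.

Lemma lambertE n : (0 < n)%N -> lambert n = x ^+ n / (qint n * (1 - x)).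
Proof. by move=> n0; rewrite /lambert /qint divfK // gt_eqF. Qed.

Lemma qint_gt0 n : (0 < n)%N -> 0 < qint n.
Proof. by move=> n0; rewrite /qint divr_gt0 // xn1. Qed.

Lemma lambert_gap_ge0 n : (0 < n)%N -> 0 <= lambert_gap n.
Proof.
case: n => // n _; have g := qint_ge n; have g0 := qint_gt0 (ltn0Sn n).
have n0 : (0 : R) < n.+1%:R by rewrite ltr0n.
have D0 : 0 < qint n.+1 * (1 - x) by exact: mulr_gt0.
rewrite /lambert_gap lambertE // subr_ge0 ler_pdivrMr //.
have -> : (n.+1%:R * (1 - x))^-1 * (qint n.+1 * (1 - x)) = qint n.+1 / n.+1%:R.
  by field; rewrite nat1r !gt_eqF.
rewrite ler_pdivlMr // mulrC; apply: le_trans g; rewrite ler_wpM2l ?(ltW n0) //.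
rewrite /x -exprM; apply: ler_wiXn2l; [exact: ltW|exact: ltW|].
by rewrite mul2n -addnn (leq_trans (leqnSn _)) // leq_addr.
Qed.

(** Over a common denominator the difference has the sign of
    [qint n * qint n.+1 - n (n+1) x^n], and the two factors are bounded below by
    [qint_ge]. *)
Lemma lambert_gap_dec n : (0 < n)%N -> 0 <= lambert_gap n - lambert_gap n.+1.
Proof.
move=> n0; have g := qint_ge n; have g0 := qint_gt0 (ltn0Sn n).
have g' := qint_ge n.-1; rewrite prednK // in g'; have g0' := qint_gt0 n0.
have n0' : (0 : R) < n%:R by rewrite ltr0n.
have n1' : (0 : R) < n.+1%:R by rewrite ltr0n.
have -> : lambert_gap n - lambert_gap n.+1 = (qint n * qint n.+1 - n%:R * n.+1%:R * x ^+ n) /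
   ((n%:R * n.+1%:R) * (qint n * qint n.+1) * (1 - x)).
  rewrite /lambert_gap !lambertE // qintS exprS; rewrite qintS in g0.
  by rewrite -natr1 in n1' *; field; rewrite !gt_eqF.
apply: divr_ge0; last first.
  by apply/ltW/mulr_gt0 => //; apply: mulr_gt0; exact: mulr_gt0.
rewrite subr_ge0; apply: (@le_trans _ _ ((n%:R * y ^+ n.-1) * (n.+1%:R * y ^+ n))).
  have -> : n%:R * y ^+ n.-1 * (n.+1%:R * y ^+ n) = n%:R * n.+1%:R * y ^+ (n.-1 + n).
    by rewrite exprD; ring.
  rewrite ler_wpM2l ?mulr_ge0 //.
  rewrite /x -exprM; apply: ler_wiXn2l; [exact: ltW|exact: ltW|].
  by rewrite mul2n -addnn leq_add2r leq_pred.
by rewrite ler_pM // mulr_ge0 // ?exprn_ge0 // ltW.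
Qed.

Lemma lambert_gap_sumle : sumle (fun n => lambert_gap n - lambert_gap n.+1) 1.
Proof.
split => [n n0|N]; first exact: lambert_gap_dec.
have [->|N0] := posnP N; first by rewrite psum0.
have -> : psum (fun n => lambert_gap n - lambert_gap n.+1) N = lambert_gap 1%N - lambert_gap N.
  have := psum_telescope lambert_gap N0; rewrite /psum => h.
  transitivity (- (lambert_gap N - lambert_gap 1%N)); last by rewrite opprB.
  by rewrite -h /psum -sumrN; apply: eq_bigr => i _; rewrite [RHS]opprB.
have -> : lambert_gap 1%N = 1 by rewrite /lambert_gap /lambert mul1r expr1 -{1}(mul1r (1 - x)^-1) -mulrBl divff // gt_eqF.
by rewrite gerBl lambert_gap_ge0.
Qed.

Lemma xn_cvg0 : (x ^+ n) @[n --> \oo] --> (0 : R).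
Proof. by apply: cvg_expr; rewrite ger0_norm // ltW. Qed.

Lemma lambert_gap_cvg0 : lambert_gap n @[n --> \oo] --> (0 : R).
Proof.
apply: (@squeeze_cvgr _ _ _ _ (fun=> 0) (fun n => npw n (1 : R) / (1 - x))).
- exists 1%N => // n /= n0; rewrite lambert_gap_ge0 //= npw1 // /lambert_gap invfM gerBl /lambert divr_ge0 ?ltW //.
  exact: xn1.
- exact: cvg_cst.
- rewrite -[X in _ --> X](mul0r (1 - x)^-1); apply: cvgM; last exact: cvg_cst.
  exact: npw_cvg0.
Qed.

Lemma geom_le N : \sum_(1 <= n < N) x ^+ n.-1 <= (1 - x)^-1.
Proof.
have [->|N0] := posnP N; first by rewrite big_geq // invr_ge0 ltW.
rewrite big_add1 /= -[N.-1]/(N.-1) big_mkord.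
have -> : \sum_(i < N.-1) x ^+ i = qint N.-1.
  elim: (N.-1) => [|n IH]; first by rewrite big_ord0 /qint expr0 subrr mul0r.
  by rewrite big_ord_recr /= IH /qint exprS; field; rewrite gt_eqF.
by rewrite /qint ler_piMl ?gerBl ?(ltW (xn0 _)) // invr_ge0 ltW.
Qed.

Lemma geom_sum n N : (0 < n)%N -> (0 < N)%N ->
  \sum_(1 <= m < N) x ^+ (n * m) = lambert n - x ^+ (n * N) / (1 - x ^+ n).
Proof.
move=> n0; elim: N => // -[|N] IH _.
  by rewrite big_geq // muln1 /lambert subrr.
rewrite big_nat_recr //= IH // /lambert [(n * N.+2)%N]mulnS exprD.
by field; rewrite gt_eqF // xn1.
Qed.

Variable f : nat -> R.
Variable A : R.
Hypothesis fM : forall m n, f (m * n)%N = f m * f n.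
Hypothesis f1 : f 1%N = 1.
Hypothesis fv : forall n, f n = 0 \/ f n = 1 \/ f n = -1.
Hypothesis fA : forall N, `|psum f N| <= A.
Hypothesis f0 : psum (fun n => f n / n%:R) @ \oo --> (0 : R).

Let fn1 n : `|f n| <= 1.
Proof. by case: (fv n) => [->|[->|->]]; rewrite ?normr0 ?normrN1 ?normr1. Qed.

Lemma lambert_lim : exists l : R, psum (fun n => f n * lambert n) @ \oo --> l /\ `|l| <= A.
Proof.
have cA N : normc (psum (fun n => (f n)%:C) N) <= A.
  by rewrite /psum -(rmorph_sum (real_complex R)) normc_real fA.
have [n n0||l [cl lA]] := @bv_test R (fun n => (f n)%:C) (fun n => (lambert_gap n)%:C) A 1 _ cA lambert_gap_sumle.
- by rewrite -rmorphB normc_real ger0_norm // lambert_gap_dec.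
- exact: (cvgC_real lambert_gap_cvg0).
exists (- complex.Re l); split; last by rewrite normrN (le_trans (ler_normc_Re _)) // -(mulr1 A).
have c2 : complex.Re (psum (fun n => (f n)%:C * (lambert_gap n)%:C) N) @[N --> \oo] --> complex.Re l.
  exact: cvgC_Re cl.
have d1 : (1 - x)^-1 * psum (fun n => f n / n%:R) N @[N --> \oo] --> (1 - x)^-1 * 0.
  by apply: cvgM; [exact: cvg_cst|exact: f0].
have c1 : (1 - x)^-1 * psum (fun n => f n / n%:R) N - complex.Re (psum (fun n => (f n)%:C * (lambert_gap n)%:C) N)
   @[N --> \oo] --> (1 - x)^-1 * 0 - complex.Re l.
  exact: (cvgB d1 c2).
rewrite mulr0 sub0r in c1; apply: (cvg_congr c1); apply: nearW => N.
have -> : psum (fun n => (f n)%:C * (lambert_gap n)%:C) N = (psum (fun n => f n * lambert_gap n) N)%:C.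
  by rewrite /psum (rmorph_sum (real_complex R)); apply: eq_bigr => n _; rewrite rmorphM.
rewrite /= /psum mulr_sumr -sumrB; apply: eq_bigr => n _.
by rewrite /lambert_gap invfM; ring.
Qed.

Definition lambert_term n m : R := f n * x ^+ (n * m).

(** Expanding [x^n / (1 - x^n)] as a geometric series and collecting the powers of
    [x] turns the Lambert series into [\sum_k (\sum_(n | k) f n) x^k]. *)
Lemma lambert_divisor_sum : exists l : R, psum (divisor_sum lambert_term) @ \oo --> l /\ l <= A.
Proof.
have [l [cl lA]] := lambert_lim; exists l; split; last exact: le_trans (ler_norm _) lA.
pose u n m : R[i] := (lambert_term n m)%:C.
have absb N : square_sum (fun n m => normc (u n m)) N <= (1 - x)^-1 * (1 - x)^-1.
  apply: (@le_trans _ _ ((\sum_(1 <= n < N) x ^+ n.-1) * (\sum_(1 <= m < N) x ^+ m.-1))).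
    rewrite mulr_suml; apply: ler_sum_nat => n /andP[n0 _].
    rewrite mulr_sumr; apply: ler_sum_nat => m /andP[m0 _].
    rewrite /u normc_real /lambert_term normrM [`|x ^+ _|]ger0_norm ?(ltW (xn0 _)) // -exprD.
    have nm : (n.-1 + m.-1 <= n * m)%N by clear - n0 m0; nia.
    by apply: le_trans (xnle nm); rewrite ler_piMl // ltW.
  by rewrite ler_pM ?geom_le //; apply: sumr_ge0 => i _; exact: ltW.
have sqE N : (0 < N)%N -> square_sum lambert_term N = psum (fun n => f n * lambert n) N -
    psum (fun n => f n * (x ^+ (n * N) / (1 - x ^+ n))) N.
  move=> N0; rewrite /psum -sumrB /square_sum; apply: eq_big_nat => n /andP[n0 _].
  by rewrite -mulrBr -geom_sum // mulr_sumr.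
have Eb N : (0 < N)%N -> `|psum (fun n => f n * (x ^+ (n * N) / (1 - x ^+ n))) N| <= x ^+ N * ((1 - x)^-1 * (1 - x)^-1).
  move=> N0; rewrite (le_trans (ler_norm_sum _ _ _)) //.
  apply: (@le_trans _ _ (x ^+ N * ((1 - x)^-1 * \sum_(1 <= n < N) x ^+ n.-1))).
    rewrite !mulr_sumr; apply: ler_sum_nat => n /andP[n0 _].
    rewrite normrM -[leRHS]mul1r ler_pM // ger0_norm; last by rewrite divr_ge0 ?ltW // xn1.
    rewrite [leRHS]mulrCA [leRHS]mulrC ler_pM ?invr_ge0 ?(ltW (xn1 _)) ?(ltW (xn0 _)) //.
      by rewrite -exprD xnle //; clear - n0 N0; nia.
    rewrite lef_pV2 ?posrE ?xn1 // lerD2l lerN2 -[leRHS]expr1; exact: xnle.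
  by rewrite ler_wpM2l ?(ltW (xn0 _)) // ler_wpM2l ?invr_ge0 ?(ltW x10) // geom_le.
have cE : psum (fun n => f n * (x ^+ (n * N) / (1 - x ^+ n))) N @[N --> \oo] --> (0 : R).
  apply: norm_cvg0; apply: (@squeeze_cvgr _ _ _ _ (fun=> 0) (fun N => x ^+ N * ((1 - x)^-1 * (1 - x)^-1))).
  - exists 1%N => // N /= N0; rewrite normr_ge0; exact: Eb.
  - exact: cvg_cst.
  - rewrite -[X in _ --> X](mul0r ((1 - x)^-1 * (1 - x)^-1)); apply: cvgM; last exact: cvg_cst.
    exact: xn_cvg0.
have csq : square_sum lambert_term @ \oo --> l.
  have c : psum (fun n => f n * lambert n) N - psum (fun n => f n * (x ^+ (n * N) / (1 - x ^+ n))) N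
    @[N --> \oo] --> l - 0 by exact: (cvgB cl cE).
  by rewrite subr0 in c; apply: (cvg_congr c); exists 1%N => // N N0; exact: (esym (sqE N N0)).
have csqC : (square_sum u N : C) @[N --> \oo] --> (l%:C : C).
  apply: (cvg_congr (cvgC_real csq)); apply: nearW => N.
  rewrite /square_sum (rmorph_sum (real_complex R)); apply: eq_bigr => n _.
  by rewrite (rmorph_sum (real_complex R)).
have c : complex.Re (psum (divisor_sum u) N) @[N --> \oo] --> l.
  exact: (cvgC_Re (hyperbola_cvg absb csqC)).
apply: (cvg_congr c); apply: nearW => N.
rewrite /= /psum /divisor_sum (_ : \sum_(1 <= n < N) _ = (\sum_(1 <= n < N) divisor_sum lambert_term n)%:C) //.
rewrite (rmorph_sum (real_complex R)); apply: eq_bigr => n _.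
by rewrite /divisor_sum (rmorph_sum (real_complex R)).
Qed.

(** In that power series every coefficient is nonnegative and those of the
    [x^(m^2)] are at least [1]. *)
Lemma lambert_sum_le M : \sum_(1 <= m < M) x ^+ (m * m) <= A.
Proof.
have [l [cl lA]] := lambert_divisor_sum; apply: le_trans lA.
have hE k : (0 < k)%N -> divisor_sum lambert_term k = (\sum_(n <- divisors k) f n) * x ^+ k.
  move=> k0; rewrite divisor_sumE // mulr_suml; apply: eq_big_seq => n.
  by rewrite -dvdn_divisors // => nk; rewrite /lambert_term mulnC divnK.
have h0 k : (0 < k)%N -> 0 <= divisor_sum lambert_term k.
  by move=> k0; rewrite hE // mulr_ge0 ?(ltW (xn0 _)) //; have [] := sum_real_char fM f1 fv k0.
have nd := psum_nd h0.
apply: (@le_trans _ _ (psum (divisor_sum lambert_term) (M * M))).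
  elim: M => [|[|M] IH]; first by rewrite big_geq // psum0.
    by rewrite big_geq // psum1.
  rewrite big_nat_recr //=.
  apply: (@le_trans _ _ (psum (divisor_sum lambert_term) (M.+1 * M.+1).+1)).
    rewrite psumS // lerD // hE // ler_peMl ?(ltW (xn0 _)) //.
    by have [] := sum_real_char fM f1 fv (ltn0Sn M).
  by apply: nd; rewrite ltn_mul.
rewrite -(cvg_lim _ cl) //; apply: nondecreasing_cvgn_le => //.
by apply/cvg_ex; exists l.
Qed.

End FixedX.

Lemma real_char_nonvanishing (f : nat -> R) A :
  (forall m n, f (m * n)%N = f m * f n) -> f 1%N = 1 ->
  (forall n, f n = 0 \/ f n = 1 \/ f n = -1) ->
  (forall N, `|psum f N| <= A) ->
  ~ psum (fun n => f n / n%:R) @ \oo --> (0 : R).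
Proof.
move=> fM f1 fv fA f0.
have A0 : 0 <= A by rewrite (le_trans _ (fA 0%N)).
pose M := (Num.bound (2 * A)).+1.
have MA : 2 * A < M%:R.
  by rewrite (lt_trans (archi_boundP _)) ?mulr_ge0 // ltr_nat.
have M0 : (0 : R) < M%:R by rewrite ltr0n.
have M1 : (1 : R) <= M%:R by rewrite ler1n.
(* With [x = (1 - t)^2], Bernoulli's inequality gives
   [x^(m^2) >= 1 - 2 M^2 t = 1/2] for [m <= M], so that the sum of the
   [x^(m^2)] is at least [M/2 > A]. *)
pose t : R := (4 * M%:R ^+ 2)^-1.
have t0 : 0 < t by rewrite invr_gt0 mulr_gt0 // exprn_gt0.
have t1 : t < 1.
  by rewrite invf_lt1 ?mulr_gt0 ?exprn_gt0 //; have : 1 <= M%:R ^+ 2 :> R; [rewrite expr_ge1 // ltW|lra].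
have y01 : 0 < 1 - t < 1 by apply/andP; split; lra.
have := lambert_sum_le y01 fM f1 fv fA f0 M.+1.
apply/negP; rewrite -ltNge.
have b : 2^-1 <= ((1 - t) ^+ 2) ^+ (M * M).
  rewrite -exprM; have := @bernoulli t (2 * (M * M)); rewrite (ltW t0) (ltW t1) => /(_ isT).
  apply: le_trans; rewrite !natrM /t le_eqVlt; apply/orP; left; apply/eqP.
  by field; rewrite gt_eqF.
apply: (@lt_le_trans _ _ (\sum_(1 <= m < M.+1) (2^-1 : R))).
  by rewrite sumr_const_nat subSS subn0 -[ltRHS]mulr_natr; lra.
apply: ler_sum_nat => m /andP[m0 mM]; apply: (le_trans b).
have x1 : (1 - t) ^+ 2 <= 1 by rewrite exprn_ile1 // ?subr_ge0 ?gerBl ltW.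
by apply: ler_wiXn2l; rewrite ?exprn_ge0 ?subr_ge0 ?(ltW t1) // leq_mul.
Qed.

End Lambert.

(** * Sums over the powers of one prime *)

Section PrimePow.
Variable R : realType.
Local Notation C := (R[i]^o).
Implicit Types (s e : R).

(** The conditions [n < N] and [k < N] cut the powers of [p] at different places,
    which makes no difference in the limit for nonnegative terms. *)
Lemma sum_primepow_cvg (g : nat -> R) (p : nat) (l : R) : prime p -> (forall n, 0 <= g n) ->
  psum (fun k => g (p ^ k)%N) @ \oo --> l ->
  \sum_(1 <= n < N | primes n == [:: p]) g n @[N --> \oo] --> l.
Proof.
move=> pp g0 cl; under eq_fun do rewrite sum_primepow //.
have nd := psum_nd (fun k (_ : (0 < k)%N) => g0 (p ^ k)%N).
have le_l N : psum (fun k => g (p ^ k)%N) N <= l.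
  rewrite -(cvg_lim _ cl) //; apply: nondecreasing_cvgn_le => //; by apply/cvg_ex; exists l.
apply/cvgrPdist_lt => eps eps0; have /cvgrPdist_lt/(_ _ eps0)[K _ HK] := cl.
exists (p ^ K)%N => // N /= NK; have := HK K (leqnn K).
rewrite /= ger0_norm ?subr_ge0 ?le_l // => h.
have le1 : \sum_(1 <= k < N | (p ^ k < N)%N) g (p ^ k)%N <= psum (fun k => g (p ^ k)%N) N.
  by rewrite /psum big_mkcond /=; apply: ler_sum => k _; case: ifP.
rewrite ger0_norm; last by rewrite subr_ge0 (le_trans le1).
apply: le_lt_trans h; rewrite lerD2l lerN2.
have KN : (K <= N)%N by rewrite (leq_trans _ NK) // ltnW // ltn_expl // prime_gt1.
rewrite /psum (big_nat_widen 1 K N) // big_mkcond [leRHS]big_mkcond /=.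
apply: ler_sum => k _; case: ifP => kK; last by case: ifP.
by rewrite ifT // (leq_trans _ NK) // ltn_exp2l // prime_gt1.
Qed.

Lemma npwX p k s : (0 < p)%N -> npw (p ^ k) s = npw p s ^+ k.
Proof.
by move=> p0; elim: k => [|k IH]; [rewrite npw_1n|rewrite expnS npwM ?expn_gt0 ?p0 // IH exprS].
Qed.

Lemma npw_lt1 p s : (1 < p)%N -> 0 < s -> npw p s < 1.
Proof.
move=> p1 s0; rewrite -expR0 ltr_expR mulNr oppr_lt0 mulr_gt0 // ln_gt0 //.
by rewrite ltr1n.
Qed.

Lemma geom_psum_cvg (w : R) : 0 <= w < 1 -> psum (fun k => w ^+ k) @ \oo --> w / (1 - w).
Proof.
move=> /andP[w0 w1]; have w10 : 0 < 1 - w by rewrite subr_gt0.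
have c : (w - w ^+ N) / (1 - w) @[N --> \oo] --> (w - 0) / (1 - w).
  apply: cvgM; last exact: cvg_cst.
  by apply: cvgB; [exact: cvg_cst|apply: cvg_expr; rewrite ger0_norm].
have E N : psum (fun k => w ^+ k) N.+1 = (w - w ^+ N.+1) / (1 - w).
  elim: N => [|N IH]; first by rewrite psum1 expr1 subrr mul0r.
  by rewrite psumS // IH [w ^+ N.+2]exprS; field; rewrite gt_eqF.
rewrite subr0 in c; apply: (cvg_congr c); exists 1%N => // N /= N0.
by case: N N0 => // N _; exact: (esym (E N)).
Qed.

Lemma npw_primepow_cvg p s : prime p -> 0 < s ->
  \sum_(1 <= n < N | primes n == [:: p]) npw n s @[N --> \oo] --> npw p s / (1 - npw p s).
Proof.
move=> pp s0; apply: sum_primepow_cvg => // [n|]; first exact: npw_ge0.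
have c := geom_psum_cvg (w := npw p s); apply: (cvg_congr (c _)).
  by rewrite npw_ge0 npw_lt1 // prime_gt1.
by apply: nearW => N; apply: eq_bigr => k _; rewrite npwX // prime_gt0.
Qed.

End PrimePow.

(** * The von Mangoldt series of one character near s = 1 *)

Section Nonvanishing.
Variable R : realType.
Local Notation C := (R[i]^o).
Implicit Types (s e : R) (chi psi : int -> R[i]).
Variable d : nat.
Hypothesis hd : (2 <= d)%N.

Definition natchar chi : nat -> R[i] := fun n => chi n%:Z.
Local Notation chi0 := (principal_character R d).

Section OneC.
Variable chi : int -> R[i].
Hypothesis chiP : dirichlet_character d chi.
Local Notation f := (natchar chi).

Lemma natchar_le1 n : normc (f n) <= 1. Proof. exact: (normc_dch_le1 hd chiP). Qed.
Lemma natcharM m n : f (m * n)%N = f m * f n.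
Proof. by rewrite /natchar PoszM (dchM chiP). Qed.
Lemma natchar1 : f 1%N = 1. Proof. exact: (dch1 chiP). Qed.

End OneC.

Lemma cvgC_linear0 (F : R -> C) (l : C) (K r : R) : 0 < r ->
  (forall e, 0 < e -> e <= r -> normc (F e - l) <= K * e) -> F e @[e --> (0 : R)^'+] --> l.
Proof.
move=> r0 H; apply: (@cvgC_bound _ _ _ _ _ _ (fun e => K * e)); last exact: cvg_linear0.
exact: (near_right0 r0).
Qed.

Section OneN.
Variable chi : int -> R[i].
Hypothesis chiP : dirichlet_character d chi.
Hypothesis chi1 : chi <> chi0.
Local Notation f := (natchar chi).
Let f1 := natchar_le1 chiP.
Let fM := natcharM chiP.
Let f_1 := natchar1 chiP.
Let fA : forall N, normc (psum f N) <= d%:R := dch_psum_bounded hd chiP chi1.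

Lemma twist_Dseries e : twist f (fun=> 1) (1 + e) = Dseries f (1 + e%:C).
Proof.
rewrite /twist /Dseries; congr (limn _); apply/funext => N; apply: eq_bigr => n _.
by rewrite mul1r -npowN_real rmorphD rmorph1.
Qed.

Lemma twist1_quad : exists K : R, 0 <= K /\ forall e, 0 < e -> e <= 8^-1 ->
  normc (twist f (fun=> 1) (1 + e) - Dseries f 1 + e%:C * Dseries_ln f) <= K * e ^+ 2.
Proof.
have [K [K0 H]] := Dseries_quad fA; exists K; split => // e e0 e8.
have ne : normc e%:C = e by rewrite normc_real gtr0_norm.
by rewrite twist_Dseries; have := H e%:C; rewrite ne; apply.
Qed.

Lemma twist1_cvg : (twist f (fun=> 1) (1 + e) : C) @[e --> (0 : R)^'+] --> Dseries f 1.
Proof.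
have [K [K0 H]] := twist1_quad.
apply: (@cvgC_linear0 _ _ (K + normc (Dseries_ln f)) 8^-1); first by rewrite invr_gt0.
move=> e e0 e8.
have -> : twist f (fun=> 1) (1 + e) - Dseries f 1 =
  (twist f (fun=> 1) (1 + e) - Dseries f 1 + e%:C * Dseries_ln f) - e%:C * Dseries_ln f by ring.
apply: (le_trans (normcB _ _)); rewrite normcM normc_real gtr0_norm // mulrDl lerD //.
  by rewrite (le_trans (H e e0 e8)) // ler_wpM2l // expr2 ler_piMl; lra.
by rewrite mulrC.
Qed.

Lemma twist_ln_cvg : (twist f (fun n => ln n%:R) (1 + e) : C) @[e --> (0 : R)^'+] --> Dseries_ln f.
Proof.
have [K [K0 H]] := Dseries_ln_lip fA.
apply: (@cvgC_linear0 _ _ K 1) => // e e0 _.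
have [l [cl lB]] := H e (ltW e0).
by have -> : twist f (fun n => ln n%:R) (1 + e) = l by exact: (limC_eq cl).
Qed.

Lemma twist1_neq0 e : 0 < e -> twist f (fun=> 1) (1 + e) != 0.
Proof.
move=> e0; have s1 : 1 < 1 + e by rewrite ltrDl.
have := twist_moebius f1 fM f_1 s1; apply: contra_eq_neq => ->.
by rewrite mulr0 eq_sym oner_neq0.
Qed.

(** Here [Dseries_ln] is [- L'(1, chi)], so the limit is [- L'/L(1, chi)]. *)
Lemma logderiv_cvg : Dseries f 1 != 0 ->
  (twist f (vonMangoldt R) (1 + e) : C) @[e --> (0 : R)^'+] --> (Dseries_ln f / Dseries f 1 : C).
Proof.
move=> L0.
have c2 : ((twist f (fun=> 1) (1 + e))^-1 : C) @[e --> (0 : R)^'+] --> ((Dseries f 1)^-1 : C).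
  by apply: cvgV; [exact: L0|exact: twist1_cvg].
have c3 : (twist f (fun n => ln n%:R) (1 + e) / twist f (fun=> 1) (1 + e) : C) @[e --> (0 : R)^'+] --> (Dseries_ln f / Dseries f 1 : C).
  exact: (cvgM twist_ln_cvg c2).
apply: (cvg_congr c3); apply: (@near_right0 _ _ 1) => // e e0 _.
have s1 : 1 < 1 + e by rewrite ltrDl.
by rewrite -(twist_vonMangoldt f1 fM s1) mulfK // twist1_neq0.
Qed.

(** A double zero would give [L(1 + e) = O(e^2)]; but [1 / L(1 + e)], the series of
    [mu(n) chi(n)], is at most [zeta (1 + e) = O(1/e)]. *)
Lemma Dseries_ln_neq0 : Dseries f 1 = 0 -> Dseries_ln f != 0.
Proof.
move=> L0; apply/eqP => D0; have [K [K0 H]] := twist1_quad.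
have c : (e * zeta (1 + e)) * (K * e) @[e --> (0 : R)^'+] --> (1 * 0 : R).
  exact: (cvgM (@ezeta_cvg R) (@cvg_linear0 R K)).
rewrite mulr0 in c.
have : (1 : R) <= 0; last by rewrite ler10.
apply: (ler_cvg_to (@cvg_cst _ _ _ _ _) c); apply: (@near_right0 _ _ 8^-1) => [|e e0 e8]; first by rewrite invr_gt0.
have s1 : 1 < 1 + e by rewrite ltrDl.
have h := H e e0 e8; rewrite L0 D0 mulr0 addr0 subr0 in h.
have h2 := normc_twist_moebius f1 s1.
have /(congr1 (@normc R)) := twist_moebius f1 fM f_1 s1; rewrite normcM normc1 => E.
rewrite -[leLHS]E (_ : e * _ * _ = zeta (1 + e) * (K * e ^+ 2)); last by ring.
by rewrite ler_pM ?normc_ge0.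
Qed.

(** The zero being simple, [L(1 + e)] is equivalent to [e * L'(1)], so
    [- L'/L(1 + e)] is equivalent to [- 1/e]. *)
Lemma zero_residue : Dseries f 1 = 0 ->
  (e%:C * twist f (vonMangoldt R) (1 + e) : C) @[e --> (0 : R)^'+] --> (-1 : C).
Proof.
move=> L0; have D0 := Dseries_ln_neq0 L0; have [K [K0 H]] := twist1_quad.
have c1 : (e^-1%:C * twist f (fun=> 1) (1 + e) : C) @[e --> (0 : R)^'+] --> (- Dseries_ln f : C).
  apply: (@cvgC_linear0 _ _ K 8^-1); first by rewrite invr_gt0.
  move=> e e0 e8; have h := H e e0 e8; rewrite L0 subr0 in h.
  have -> : e^-1%:C * twist f (fun=> 1) (1 + e) - - Dseries_ln f =
    e^-1%:C * (twist f (fun=> 1) (1 + e) + e%:C * Dseries_ln f).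
    by rewrite opprK mulrDr mulrA -rmorphM mulVf ?gt_eqF // rmorph1 mul1r.
  rewrite normcM normc_real gtr0_norm ?invr_gt0 // ler_pdivrMl // (le_trans h) //.
  by rewrite expr2; lra.
have c2 : ((e^-1%:C * twist f (fun=> 1) (1 + e))^-1 : C) @[e --> (0 : R)^'+] --> ((- Dseries_ln f)^-1 : C).
  by apply: cvgV; [rewrite oppr_eq0; exact: D0|exact: c1].
have c3 : (twist f (fun n => ln n%:R) (1 + e) / (e^-1%:C * twist f (fun=> 1) (1 + e)) : C) @[e --> (0 : R)^'+] --> (Dseries_ln f / - Dseries_ln f : C).
  exact: (cvgM twist_ln_cvg c2).
rewrite invrN mulrN (divff D0) in c3.
apply: (cvg_congr c3); apply: (@near_right0 _ _ 1) => // e e0 _.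
have s1 : 1 < 1 + e by rewrite ltrDl.
rewrite -(twist_vonMangoldt f1 fM s1) (fmorphV (real_complex R)) invfM invrK.
by rewrite mulrCA mulfK // twist1_neq0.
Qed.

End OneN.

(** The terms lost by restricting to [n] coprime to [d] are those at the powers of
    the primes dividing [d]. *)
Lemma vonMangoldt_coprime n : (0 < n)%N ->
  (coprime n d)%:R * vonMangoldt R n =
  vonMangoldt R n - \sum_(p <- primes d) (primes n == [:: p])%:R * ln p%:R.
Proof.
move=> n0; case: (boolP [exists q : 'I_n.+1, primes n == [:: nat_of_ord q]]) => [/existsP[q /eqP E]|H].
  set p := nat_of_ord q in E *; have pn : p \in primes n by rewrite E inE.
  have cE : coprime n d = (p \notin primes d).
    by rewrite coprime_sym coprime_has_primes ?E //= ?orbF // ltnW.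
  rewrite /vonMangoldt E; case: (boolP (p \in primes d)) => pd; rewrite cE pd /=.
    rewrite mul0r (bigD1_seq p) ?primes_uniq //= eqxx mul1r [\sum_(i <- primes d | i != p) _]big1_seq ?addr0 ?subrr //.
    by move=> r /andP[rp _]; rewrite eqseq_cons eq_sym (negbTE rp) mul0r.
  rewrite mul1r [X in _ - X]big1_seq ?subr0 // => r /andP[_ rd].
  rewrite eqseq_cons; case: eqP => [pr|]; last by rewrite mul0r.
  by move: pd; rewrite pr rd.
have L0 : vonMangoldt R n = 0.
  rewrite /vonMangoldt; case E : (primes n) => [|p [|]] //.
  move: H; rewrite negb_exists => /forallP.
  have : p \in primes n by rewrite E inE.
  rewrite mem_primes => /and3P[_ _ pn] /(_ (inord p)).
  by rewrite inordK ?E ?eqxx // ltnS dvdn_leq.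
rewrite L0 mulr0 big1_seq ?subr0 // => p /andP[_ pd].
case: eqP => [E|]; last by rewrite mul0r.
move: H; rewrite negb_exists => /forallP.
have : p \in primes n by rewrite E inE.
rewrite mem_primes => /and3P[_ _ pn] /(_ (inord p)).
by rewrite inordK ?E ?eqxx // ltnS dvdn_leq.
Qed.

Lemma principal_vonMangoldt s : 1 < s -> twist (natchar chi0) (vonMangoldt R) s =
  (mangoldt_sum s - \sum_(p <- primes d) ln p%:R * (npw p s / (1 - npw p s)))%:C.
Proof.
move=> s1; have s0 : 0 < s by rewrite (lt_trans ltr01).
have c1 : psum (fun n => vonMangoldt R n * npw n s) @ \oo --> mangoldt_sum s.
  have := @mangoldt_sum_cvg R predT s s1; rewrite (_ : (fun n => _) = (fun n => vonMangoldt R n * npw n s)) //.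
  by apply/funext => n; rewrite mul1r.
have c2 : \sum_(p <- primes d) ln p%:R * (\sum_(1 <= n < N | primes n == [:: p]) npw n s) @[N --> \oo]
   --> \sum_(p <- primes d) ln p%:R * (npw p s / (1 - npw p s)).
  have : {in primes d, forall p, prime p} by move=> p; rewrite mem_primes => /andP[].
  elim: (primes d) => [|p r IH] pr.
    by rewrite big_nil; under eq_fun do rewrite big_nil; exact: cvg_cst.
  rewrite big_cons; under eq_fun do rewrite big_cons.
  apply: cvgD; last by apply: IH => q qr; apply: pr; rewrite inE qr orbT.
  apply: cvgM; first exact: cvg_cst.
  by apply: npw_primepow_cvg => //; apply: pr; rewrite inE eqxx.
apply: limC_eq; apply: (cvg_congr (cvgC_real (cvgB c1 c2))); apply: nearW => N /=.
rewrite /psum; transitivity ((\sum_(1 <= n < N) (coprime n d)%:R * vonMangoldt R n * npw n s)%:C).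
  congr (_%:C); rewrite [LHS](_ : _ = \sum_(1 <= n < N) vonMangoldt R n * npw n s
     - \sum_(p <- primes d) ln p%:R * \sum_(1 <= n < N | primes n == [:: p]) npw n s) //.
  under [X in _ - X]eq_bigr do rewrite mulr_sumr big_mkcond.
  rewrite exchange_big -sumrB; apply: eq_big_nat => n /andP[n0 _].
  rewrite vonMangoldt_coprime // mulrBl mulr_suml; congr (_ - _); apply: eq_bigr => p _.
  by case: eqP => _; rewrite ?mul1r ?mul0r.
rewrite (rmorph_sum (real_complex R)); apply: eq_bigr => n _.
rewrite /natchar /principal_character coprimezE /= -mulrA rmorphM /=.
by rewrite (rmorph_nat (real_complex R)).
Qed.

End Nonvanishing.

(** * Residue classes, and nonvanishing for all characters *)

Section Main.
Variable R : realType.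
Local Notation C := (R[i]^o).
Implicit Types (s e : R) (chi psi : int -> R[i]).

Lemma npw_1e_cvg n : npw n (1 + e) @[e --> (0 : R)^'+] --> npw n 1.
Proof.
apply: (@cvg_real_bound _ _ _ (npw n 1 * ln n%:R)); apply: (@near_right0 _ _ 1) => // e e0 _.
have y0 : 0 <= e * ln n%:R by rewrite mulr_ge0 ?lnn_ge0 // ltW.
have -> : npw n (1 + e) - npw n 1 = npw n 1 * (expR (- (e * ln n%:R)) - 1).
  by rewrite npwD [npw n e]/npw mulNr; ring.
rewrite normrM ger0_norm ?npw_ge0 // -mulrA ler_wpM2l ?npw_ge0 //.
by rewrite [leRHS]mulrC expRN_sub1.
Qed.

Lemma cvg_sum_seq (K : numFieldType) (V : normedModType K) (I : Type) (r : seq I) (P : pred I)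
  (T : Type) (F : set_system T) {FF : Filter F} (u : I -> T -> V) (v : I -> V) :
  (forall i, P i -> u i x @[x --> F] --> v i) ->
  \sum_(i <- r | P i) u i x @[x --> F] --> \sum_(i <- r | P i) v i.
Proof.
move=> uv; elim: r => [|i r IH].
  by rewrite big_nil; under eq_fun do rewrite big_nil; exact: cvg_cst.
rewrite big_cons; under eq_fun do rewrite big_cons.
by case: ifP => Pi; [apply: cvgD; [exact: uv|exact: IH]|exact: IH].
Qed.

Lemma cvg_sum_seq_in (K : numFieldType) (V : normedModType K) (I : eqType) (r : seq I)
  (T : Type) (F : set_system T) {FF : Filter F} (u : I -> T -> V) (v : I -> V) :
  (forall i, i \in r -> u i x @[x --> F] --> v i) ->
  \sum_(i <- r) u i x @[x --> F] --> \sum_(i <- r) v i.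
Proof.
move=> uv; rewrite big_seq; under eq_fun do rewrite big_seq; exact: cvg_sum_seq.
Qed.

Variable d : nat.
Hypothesis hd : (2 <= d)%N.
Local Notation chi0 := (principal_character R d).

Definition mangoldt_ap (a : int) s : R :=
  limn (psum (fun n => (congruent_to a d n)%:R * (vonMangoldt R n * npw n s))).

(** Orthogonality, summed against [Lambda(n) n^(-s)]. *)
Lemma dchars_sum (a : int) s : 1 < s -> coprimez a d%:Z ->
  \sum_(chi <- dchars R d) conjc (chi a) * twist (natchar chi) (vonMangoldt R) s =
  ((totient d)%:R * mangoldt_ap a s)%:C.
Proof.
move=> s1 ca.
have c1 : (\sum_(chi <- dchars R d) conjc (chi a) *
     psum (fun n => natchar chi n * (vonMangoldt R n * npw n s)%:C) N : C) @[N --> \oo] -->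
   (\sum_(chi <- dchars R d) conjc (chi a) * twist (natchar chi) (vonMangoldt R) s : C).
  apply: cvg_sum_seq_in => chi /(mem_dchars hd) chiP.
  apply: cvgM; first exact: cvg_cst.
  apply: twist_cvg; [exact: (natchar_le1 hd chiP)|exact: log_bounded_vonMangoldt|exact: s1].
have c2 : (((totient d)%:R * psum (fun n => (congruent_to a d n)%:R * (vonMangoldt R n * npw n s)) N)%:C : C)
   @[N --> \oo] --> (((totient d)%:R * mangoldt_ap a s)%:C : C).
  apply: cvgC_real; apply: cvgM; first exact: cvg_cst.
  exact: (@mangoldt_sum_cvg R (congruent_to a d) s s1).
apply: (limC_unique c1); apply: (cvg_congr c2); apply: nearW => N.
rewrite /psum mulr_sumr (rmorph_sum (real_complex R)).
under [RHS]eq_bigr do rewrite mulr_sumr.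
rewrite exchange_big; apply: eq_bigr => n _ /=.
under [RHS]eq_bigr do rewrite mulrA.
rewrite -mulr_suml /natchar dchars_orthogonality // -/(congruent_to a d n).
case: (congruent_to a d n); last by rewrite !mul0r mulr0.
by rewrite mul1r rmorphM /= (rmorph_nat (real_complex R)).
Qed.

Lemma mangoldt_ap_ge0 (a : int) s : 1 < s -> 0 <= mangoldt_ap a s.
Proof.
move=> s1; apply: limr_ge; first exact: (@mangoldt_sum_cvg R (congruent_to a d) s s1).
apply: nearW => N; apply: sumr_ge0 => n _.
by rewrite !mulr_ge0 ?vonMangoldt_ge0 ?npw_ge0.
Qed.

Lemma prime_term_cvg (p : nat) : prime p ->
  ln p%:R * (npw p (1 + e) / (1 - npw p (1 + e))) @[e --> (0 : R)^'+] --> ln p%:R / (p%:R - 1).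
Proof.
move=> pp; have p0 := prime_gt0 pp; have p1 := prime_gt1 pp.
have p0' : (0 : R) < p%:R by rewrite ltr0n.
have p1' : (0 : R) < p%:R - 1 by rewrite subr_gt0 ltr1n.
have -> : ln p%:R / (p%:R - 1) = ln p%:R * (npw p 1 / (1 - npw p 1)) :> R.
  by rewrite npw1 //; field; rewrite !gt_eqF.
apply: cvgM; first exact: cvg_cst.
apply: cvgM; first exact: npw_1e_cvg.
apply: cvgV; first by rewrite subr_eq0 gt_eqF // npw_lt1.
by apply: cvgB; [exact: cvg_cst|exact: npw_1e_cvg].
Qed.

(** The contribution of [gamma] and of the primes dividing [d] to [gamma1_ap]. *)
Definition gamma_principal : R := euler_gamma R + \sum_(p <- primes d) ln p%:R / (p%:R - 1).

Lemma principal_cvg :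
  (twist (natchar chi0) (vonMangoldt R) (1 + e) - e^-1%:C : C) @[e --> (0 : R)^'+] --> ((- gamma_principal)%:C : C).
Proof.
have c : (mangoldt_sum (1 + e) - e^-1) - \sum_(p <- primes d) ln p%:R * (npw p (1 + e) / (1 - npw p (1 + e)))
   @[e --> (0 : R)^'+] --> - euler_gamma R - \sum_(p <- primes d) ln p%:R / (p%:R - 1).
  apply: cvgB; first exact: mangoldt_sum_asymp.
  apply: cvg_sum_seq_in => p; rewrite mem_primes => /andP[pp _]; exact: prime_term_cvg.
rewrite /gamma_principal opprD; apply: (cvg_congr (cvgC_real c)); apply: (@near_right0 _ _ 1) => // e e0 _.
have s1 : 1 < 1 + e by rewrite ltrDl.
by rewrite principal_vonMangoldt // -(rmorphB (real_complex R)) addrAC.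
Qed.

Lemma principal_residue :
  (e%:C * twist (natchar chi0) (vonMangoldt R) (1 + e) : C) @[e --> (0 : R)^'+] --> (1 : C).
Proof.
have c0 : (e%:C : C) @[e --> (0 : R)^'+] --> ((0 : R)%:C : C).
  by apply: cvgC_real; exact: cvg_eps0.
have c1 : (1 + e%:C * (twist (natchar chi0) (vonMangoldt R) (1 + e) - e^-1%:C) : C) @[e --> (0 : R)^'+]
   --> (1 + 0%:C * (- gamma_principal)%:C : C).
  by apply: cvgD; [exact: cvg_cst|exact: (cvgM c0 principal_cvg)].
rewrite mul0r addr0 in c1; apply: (cvg_congr c1); apply: (@near_right0 _ _ 1) => // e e0 _.
by rewrite mulrBr -rmorphM divff ?gt_eqF // rmorph1 addrCA subrr addr0.
Qed.

Lemma Dseries_conj (f : nat -> R[i]) (A : R) : (forall N, normc (psum f N) <= A) ->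
  Dseries (fun n => conjc (f n)) 1 = conjc (Dseries f 1).
Proof.
move=> fA; have h0 : normc (0 : R[i]) <= 8^-1 by rewrite normc0.
have c := Dseries_cvg fA h0; rewrite addr0 in c.
apply: limC_eq; apply: (@cvgC_bound _ _ _ _ _ _ (fun N => normc (psum (fun n => f n * npowN n 1) N - Dseries f 1))).
  apply: nearW => N; rewrite -[leRHS]normc_conj rmorphB /= /psum (rmorph_sum (@conjc R)).
  rewrite le_eqVlt; apply/orP; left; apply/eqP; congr (normc (_ - _)); apply: eq_bigr => n _.
  have -> : npowN n (1 : R[i]) = (npw n 1)%:C by rewrite -npowN_real rmorph1.
  rewrite rmorphM; congr (_ * _); exact: esym (conjc_real _).
exact/cvgC_norm.
Qed.

Lemma real_nonvanishing chi : dirichlet_character d chi -> chi <> chi0 ->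
  (fun n => conjc (chi n)) = chi -> Dseries (natchar chi) 1 != 0.
Proof.
move=> chiP chi1 cj; apply/eqP => L0.
have fA := dch_psum_bounded hd chiP chi1.
pose f n : R := complex.Re (chi n%:Z).
have fE n : chi n%:Z = (f n)%:C.
  have := congr1 (fun g => g n%:Z) cj; rewrite /f /=; case: (chi n) => a b /= [] h.
  by have -> : b = 0; [lra|].
have fM m n : f (m * n)%N = f m * f n.
  by apply: complexI; rewrite rmorphM /= -!fE PoszM (dchM chiP).
have f1 : f 1%N = 1 by apply: complexI; rewrite -fE (dch1 chiP).
have fv n : f n = 0 \/ f n = 1 \/ f n = -1.
  have : `|f n| = (coprimez n%:Z d%:Z)%:R by rewrite -normc_real -fE (normc_dch hd chiP).
  case: coprimez => /=; last by move/eqP; rewrite normr_eq0 => /eqP; left.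
  by move/eqP; rewrite eqr_norml ler01 andbT => /orP[/eqP|/eqP]; right; [left|right].
have psE N : psum (fun n => chi n%:Z) N = (psum f N)%:C.
  by rewrite /psum (rmorph_sum (real_complex R)); apply: eq_bigr => n _; rewrite fE.
apply: (real_char_nonvanishing fM f1 fv (A := d%:R)).
  by move=> N; rewrite -normc_real -psE.
have h0 : normc (0 : R[i]) <= 8^-1 by rewrite normc0.
have c := Dseries_cvg fA h0; rewrite addr0 L0 in c.
have cr : complex.Re (psum (fun n => natchar chi n * npowN n 1) N) @[N --> \oo] --> complex.Re (0 : R[i]).
  exact: (cvgC_Re c).
apply: (cvg_congr cr); apply: nearW => N.
rewrite (_ : psum _ N = (psum (fun n => f n / n%:R) N)%:C) //.
rewrite /psum (rmorph_sum (real_complex R)); apply: eq_big_nat => n /andP[n0 _].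
by rewrite /natchar fE -[1]/((1 : R)%:C) npowN_real npw1 // rmorphM.
Qed.

(** If [L(1, chi) = 0] and [chi] is not real, then [chi] and its conjugate
    both contribute [-1] to the sum of the residues, the principal character
    contributes [1], and no other character contributes more than [0]; but that
    sum is nonnegative. *)
Lemma nonvanishing chi : dirichlet_character d chi -> chi <> chi0 -> Dseries (natchar chi) 1 != 0.
Proof.
move=> chiP chi1; apply/eqP => L0.
pose psi := fun n => conjc (chi n).
have psiP : dirichlet_character d psi := dch_conj chiP.
have [cj|cj] := eqVneq psi chi.
  by have := real_nonvanishing chiP chi1 cj; rewrite L0 eqxx.
have psi1 : psi <> chi0.
  move=> E; apply: chi1; apply/funext => n; have := congr1 (fun g => conjc (g n)) E.
  by rewrite /psi conjcK => ->; rewrite /principal_character rmorph_nat.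
have M0 : Dseries (natchar psi) 1 = 0.
  by rewrite (Dseries_conj (dch_psum_bounded hd chiP chi1)) L0 conjc0.
(* The residue at [1] of the von Mangoldt series of [xi]. *)
pose v (xi : int -> R[i]) : R := if xi == chi0 then 1 else if Dseries (natchar xi) 1 == 0 then -1 else 0.
have c1 : (\sum_(xi <- dchars R d) e%:C * twist (natchar xi) (vonMangoldt R) (1 + e) : C)
   @[e --> (0 : R)^'+] --> (\sum_(xi <- dchars R d) (v xi)%:C : C).
  apply: cvg_sum_seq_in => xi /(mem_dchars hd) xiP; rewrite /v.
  case: eqP => [->|xi1]; first exact: principal_residue.
  case: eqP => [X0|/eqP X0]; first by rewrite rmorphN rmorph1; exact: (zero_residue hd xiP xi1 X0).
  have c0 : (e%:C : C) @[e --> (0 : R)^'+] --> ((0 : R)%:C : C).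
    by apply: cvgC_real; exact: cvg_eps0.
  have := cvgM c0 (logderiv_cvg hd xiP xi1 X0); rewrite mul0r; exact.
have c2 : complex.Re (\sum_(xi <- dchars R d) e%:C * twist (natchar xi) (vonMangoldt R) (1 + e))
   @[e --> (0 : R)^'+] --> \sum_(xi <- dchars R d) v xi.
  have := cvgC_Re c1; rewrite -(rmorph_sum (real_complex R)); exact.
have : 0 <= \sum_(xi <- dchars R d) v xi.
  apply: (ler_cvg_to (@cvg_cst _ _ _ _ _) c2); apply: (@near_right0 _ _ 1) => // e e0 _.
  have s1 : 1 < 1 + e by rewrite ltrDl.
  have c11 : coprimez 1 d%:Z by rewrite coprimezE coprime1n.
  have E : \sum_(xi <- dchars R d) twist (natchar xi) (vonMangoldt R) (1 + e) =
      ((totient d)%:R * mangoldt_ap 1 (1 + e))%:C.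
    rewrite -dchars_sum //; apply: eq_big_seq => xi /(mem_dchars hd) xiP.
    by rewrite (dch1 xiP) conjc1 mul1r.
  by rewrite -mulr_sumr E -rmorphM /= !mulr_ge0 ?mangoldt_ap_ge0 ?(ltW e0).
apply/negP; rewrite -ltNge.
have m0 : chi0 \in dchars R d by apply/(mem_dchars hd); exact: principal_dch.
have m1 : chi \in dchars R d by apply/(mem_dchars hd).
have m2 : psi \in dchars R d by apply/(mem_dchars hd).
rewrite (bigD1_seq chi0) ?uniq_dchars //= -big_filter.
rewrite (bigD1_seq chi) ?filter_uniq ?uniq_dchars //=; last by rewrite mem_filter m1 andbT; apply/eqP.
rewrite -big_filter (bigD1_seq psi) ?filter_uniq ?uniq_dchars //=; last first.
  by rewrite !mem_filter m2 cj andbT; apply/eqP.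
rewrite {1}/v eqxx {1}/v (introF eqP chi1) L0 eqxx {1}/v (introF eqP psi1) M0 eqxx.
have : \sum_(i <- [seq i <- [seq i <- dchars R d | i != chi0] | i != chi] | i != psi) v i <= 0.
  rewrite big_seq_cond; apply: sumr_le0 => xi /andP[]; rewrite !mem_filter => /and3P[_ x0 _] _.
  by rewrite /v (negbTE x0); case: ifP => // _; rewrite lerN10.
lra.
Qed.

End Main.

(** * The logarithmic derivative of an Euler product *)

Section Product.
Variable R : realType.
Local Notation C := (R[i]^o).
Variable P : pred nat.
Hypothesis P1 : forall p, P p -> (1 < p)%N.

(** The index set is a predicate, so that the residue class enters only when the
    product is specialized to [zeta_ap]. *)
Definition eprod (s : C) : C :=
  limn (fun N => (\prod_(1 <= p < N | P p) (1 - npowN p s)^-1) : C).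

Variable s : R.
Hypothesis s1 : 1 < s.
Let t := (s + 1) / 2.
Let r := Num.min ((s - 1) / 2) 1.
Let r0 : 0 < r. Proof. by rewrite /r lt_min ltr01 andbT; have := s1; lra. Qed.
Let t1 : 1 < t. Proof. by rewrite /t; have := s1; lra. Qed.
Let ts : t <= s. Proof. by rewrite /t; have := s1; lra. Qed.

(** Dominates [p^(-s-h)], its first two derivatives in [h], and so every error
    term below, uniformly for [normc h <= r]: the real part of [s + h] is then at
    least [t], halfway between [1] and [s]. *)
Definition majorant (n : nat) : R := (1 + ln n%:R) ^+ 2 * npw n t.

Let majorant_ge0 n : 0 <= majorant n.
Proof. by rewrite mulr_ge0 ?npw_ge0 // exprn_ge0 // addr_ge0 // lnn_ge0. Qed.

Let ln_le_m n : ln (n%:R : R) * npw n t <= majorant n.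
Proof.
rewrite ler_wpM2r ?npw_ge0 //; have l := lnn_ge0 R n.
by rewrite expr2; nra.
Qed.

Let one_le_m n : npw n t <= majorant n.
Proof.
rewrite ler_peMl ?npw_ge0 //; have l := lnn_ge0 R n.
by rewrite expr2; nra.
Qed.

Let ln2_le_m n : ln (n%:R : R) ^+ 2 * npw n t <= majorant n.
Proof.
rewrite ler_wpM2r ?npw_ge0 //; have l := lnn_ge0 R n.
by rewrite !expr2; nra.
Qed.

Let w (p : nat) : R := npw p s.
Definition shift_pow (h : R[i]) (p : nat) : R[i] := npowN p (s%:C + h).

Lemma shift_powE h p : shift_pow h p = (w p)%:C * cexp (- h * (ln p%:R)%:C).
Proof.
by rewrite /shift_pow /w -npowN_real /npowN -cexpD; congr cexp; ring.
Qed.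

Let w_t p : w p <= npw p t. Proof. exact: le_npw. Qed.
Let w_ge0 p : 0 <= w p. Proof. exact: npw_ge0. Qed.
Let pow_growth h p : normc h <= r -> w p * expR (normc h * ln p%:R) <= npw p t.
Proof.
rewrite /r le_min => /andP[hr _]; rewrite /w /npw -expRD ler_expR.
have l := lnn_ge0 R p; rewrite -mulrDl ler_wpM2r //.
by rewrite /t; lra.
Qed.

Let normc_hl (h : R[i]) (p : nat) :
  normc (- h * (ln (p%:R : R))%:C) = normc h * ln (p%:R : R).
Proof. by rewrite normcM normcN normc_real ger0_norm // lnn_ge0. Qed.

Lemma normc_shift_pow h p : normc h <= r -> normc (shift_pow h p) <= npw p t.
Proof.
move=> hr; rewrite shift_powE normcM normc_real ger0_norm //.
apply: le_trans (pow_growth p hr); rewrite ler_wpM2l //.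
by rewrite (le_trans (normc_cexp_le _)) // normc_hl.
Qed.

Lemma npw_half p : (1 < p)%N -> npw p t <= 2^-1.
Proof.
move=> p1; apply: (@le_trans _ _ (npw p 1)); first exact/le_npw/ltW.
by rewrite npw1 ?(ltnW p1) // lef_pV2 ?posrE ?ltr0n ?(ltnW p1) // ler_nat.
Qed.

Lemma half_le_1shift_pow h p : (1 < p)%N -> normc h <= r -> 2^-1 <= normc (1 - shift_pow h p).
Proof.
move=> p1 hr; have := ler_dist_normc 1 (shift_pow h p); rewrite normc1.
have := normc_shift_pow p hr; have := npw_half p1; have := ler_norm (1 - normc (shift_pow h p)).
by lra.
Qed.

Lemma one_sub_shift_pow_neq0 h p : (1 < p)%N -> normc h <= r -> 1 - shift_pow h p != 0.
Proof. by move=> p1 hr; rewrite -normc_gt0; apply: lt_le_trans (half_le_1shift_pow p1 hr). Qed.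

Lemma inv_1shift_pow_le h p : (1 < p)%N -> normc h <= r -> normc (1 - shift_pow h p)^-1 <= 2.
Proof.
move=> p1 hr; have a := half_le_1shift_pow p1 hr.
by rewrite normcV -[leRHS]invrK lef_pV2 ?posrE ?invr_gt0 // (lt_le_trans _ a).
Qed.

Lemma shift_pow_diff h p : normc h <= r -> normc (shift_pow h p - (w p)%:C) <= 3 * (normc h * majorant p).
Proof.
move=> hr; have l := lnn_ge0 R p; have n0 := normc_ge0 h.
have -> : shift_pow h p - (w p)%:C = (w p)%:C * (cexp (- h * (ln p%:R)%:C) - 1) by rewrite shift_powE; ring.
rewrite normcM normc_real ger0_norm //.
apply: (le_trans (ler_wpM2l (w_ge0 p) (cexp_sub1_le _))); rewrite normc_hl.
have -> : w p * (3 * (normc h * ln p%:R * expR (normc h * ln p%:R))) =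
  3 * (normc h * (ln p%:R * (w p * expR (normc h * ln p%:R)))) by ring.
rewrite ler_wpM2l // ler_wpM2l // (le_trans _ (ln_le_m p)) // ler_wpM2l //.
exact: pow_growth.
Qed.

Lemma shift_pow_diff2 h p : normc h <= r ->
  normc (shift_pow h p - (w p)%:C + h * (ln p%:R)%:C * (w p)%:C) <= 5 * (normc h ^+ 2 * majorant p).
Proof.
move=> hr; have l := lnn_ge0 R p; have n0 := normc_ge0 h.
have -> : shift_pow h p - (w p)%:C + h * (ln p%:R)%:C * (w p)%:C =
  (w p)%:C * (cexp (- h * (ln p%:R)%:C) - 1 - (- h * (ln p%:R)%:C)) by rewrite shift_powE; ring.
rewrite normcM normc_real ger0_norm //.
apply: (le_trans (ler_wpM2l (w_ge0 p) (cexp_sub1w_le _))); rewrite normc_hl.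
have -> : w p * (5 * ((normc h * ln p%:R) ^+ 2 * expR (normc h * ln p%:R))) =
  5 * (normc h ^+ 2 * (ln p%:R ^+ 2 * (w p * expR (normc h * ln p%:R)))) by ring.
rewrite ler_wpM2l // ler_wpM2l ?sqr_ge0 // (le_trans _ (ln2_le_m p)) // ler_wpM2l ?sqr_ge0 //.
exact: pow_growth.
Qed.

(** The factors of the products at [s + h] and at [s] have the ratio
    [1 + factor_err h p]: differentiating the product amounts to expanding
    [\prod_p (1 + factor_err h p)] to first order in [h]. *)
Definition factor_err (h : R[i]) (p : nat) : R[i] :=
  if P p then (shift_pow h p - (w p)%:C) / (1 - shift_pow h p) else 0.
(** Minus the derivative of [factor_err h p] at [h = 0]. *)
Definition logderiv_term (p : nat) : R := if P p then ln p%:R * (w p / (1 - w p)) else 0.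

Let shift_pow0 p : shift_pow 0 p = (w p)%:C.
Proof. by rewrite shift_powE oppr0 mul0r cexp0 mulr1. Qed.

Let h00 : normc (0 : R[i]) <= r. Proof. by rewrite normc0 ltW. Qed.

Lemma factor_err_le h p : normc h <= r -> normc (factor_err h p) <= 6 * (normc h * majorant p).
Proof.
move=> hr; have n0 : 0 <= 6 * (normc h * majorant p) by rewrite mulr_ge0 // mulr_ge0 ?normc_ge0 ?majorant_ge0.
rewrite /factor_err; case: ifP => [/P1 p1|_]; last by rewrite normc0.
rewrite normcM [leRHS](_ : _ = 3 * (normc h * majorant p) * 2); last by ring.
by rewrite ler_pM ?normc_ge0 ?shift_pow_diff ?inv_1shift_pow_le.
Qed.

Lemma factor_err_le2 h p : normc h <= r ->
  normc (factor_err h p + h * (logderiv_term p)%:C) <= 22 * (normc h ^+ 2 * majorant p).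
Proof.
move=> hr; have n0 := normc_ge0 h.
have m0 : 0 <= normc h ^+ 2 * majorant p by rewrite mulr_ge0 ?sqr_ge0 ?majorant_ge0.
rewrite /factor_err /logderiv_term; case: ifP => [/P1 p1|_]; last by rewrite mulr0 addr0 normc0 mulr_ge0.
have a := one_sub_shift_pow_neq0 p1 hr.
have b := one_sub_shift_pow_neq0 p1 h00; rewrite shift_pow0 in b.
have ib := inv_1shift_pow_le p1 h00; rewrite shift_pow0 in ib.
have ia := inv_1shift_pow_le p1 hr.
have -> : (shift_pow h p - (w p)%:C) / (1 - shift_pow h p) + h * (ln p%:R * (w p / (1 - w p)))%:C =
  (shift_pow h p - (w p)%:C + h * (ln p%:R)%:C * (w p)%:C) / (1 - shift_pow h p)
  - (h * (ln p%:R)%:C * (w p)%:C) * (shift_pow h p - (w p)%:C) * ((1 - (w p)%:C)^-1 * (1 - shift_pow h p)^-1).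
  rewrite !(rmorphM (real_complex R)) (fmorphV (real_complex R)) (rmorphB (real_complex R)) rmorph1 /=.
  by field; rewrite a b.
apply: (le_trans (normcB _ _)).
rewrite [leRHS](_ : _ = 5 * (normc h ^+ 2 * majorant p) * 2 + (normc h * 1) * (3 * (normc h * majorant p)) * (2 * 2)); last by ring.
apply: lerD.
  by rewrite normcM ler_pM ?normc_ge0 ?shift_pow_diff2.
have p0 : (0 : R) < p%:R by rewrite ltr0n (ltn_trans _ p1).
have lw : normc (h * (ln p%:R)%:C * (w p)%:C) <= normc h * 1.
  rewrite -mulrA normcM ler_wpM2l // -(rmorphM (real_complex R)) normc_real.
  rewrite ger0_norm ?mulr_ge0 ?lnn_ge0 //.
  apply: (@le_trans _ _ (p%:R * npw p 1)).
    by rewrite ler_pM ?lnn_ge0 // ?(ltW (ln_sublinear p0)) // le_npw // ltW.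
  by rewrite npw1 ?(ltnW p1) // divff // gt_eqF.
rewrite normcM [normc (h * _ * _ * _)]normcM [normc (_^-1 * _)]normcM.
apply: ler_pM; rewrite ?mulr_ge0 ?normc_ge0 //.
  by apply: ler_pM; rewrite ?normc_ge0 ?shift_pow_diff.
by apply: ler_pM; rewrite ?normc_ge0.
Qed.

Let cond_prod (F : nat -> R[i]) N :
  \prod_(1 <= p < N | P p) F p = \prod_(1 <= p < N) (1 + (if P p then F p - 1 else 0)).
Proof.
rewrite big_mkcond; apply: eq_bigr => p _; case: ifP => _; first by rewrite addrC subrK.
by rewrite addr0.
Qed.

Lemma majorant_sum : exists B, sumle majorant B.
Proof. exact: sum_ln_npw. Qed.

Lemma eprod_cvg h : normc h <= r ->
  (\prod_(1 <= p < N | P p) (1 - npowN p (s%:C + h))^-1 : C) @[N --> \oo] --> eprod (s%:C + h).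
Proof.
move=> hr; have [B HB] := majorant_sum.
have [n n0|l cl] := @prod_cvg R (fun p => if P p then (1 - shift_pow h p)^-1 - 1 else 0) _ _ (sumleM (ler0n R 2) HB).
  case: ifP => [/P1 p1|_]; last by rewrite normc0 mulr_ge0 ?majorant_ge0.
  have -> : (1 - shift_pow h n)^-1 - 1 = (1 - shift_pow h n)^-1 * shift_pow h n.
    by field; rewrite one_sub_shift_pow_neq0.
  rewrite normcM ler_pM ?normc_ge0 ?inv_1shift_pow_le //.
  exact: le_trans (normc_shift_pow _ hr) (one_le_m _).
have cl' : (\prod_(1 <= p < N | P p) (1 - npowN p (s%:C + h))^-1 : C) @[N --> \oo] --> l.
  by under eq_fun do rewrite cond_prod; exact: cl.
by rewrite /eprod (limC_eq cl'); exact: cl'.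
Qed.

(** Its inverse is the limit of the products of the [1 - p^(-s)]. *)
Lemma eprod_neq0 : eprod s%:C != 0.
Proof.
have c1 := eprod_cvg h00; rewrite addr0 in c1.
have [B HB] := majorant_sum.
have [n n0|l cl] := @prod_cvg R (fun p => if P p then (1 - (w p)%:C) - 1 else 0) _ _ HB.
  case: ifP => [_|_]; last by rewrite normc0.
  rewrite addrAC subrr add0r normcN normc_real ger0_norm //.
  exact: le_trans (w_t _) (one_le_m _).
have c2 : (\prod_(1 <= p < N | P p) (1 - (w p)%:C) : C) @[N --> \oo] --> l.
  by under eq_fun do rewrite cond_prod; exact: cl.
have c3 : ((1 : R[i]) : C) @[N --> \oo] --> (eprod s%:C * l : C).
  apply: (cvg_congr (cvgM c1 c2)); apply: nearW => N /=.
  rewrite -big_split /= big1 // => p /P1 p1.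
  have b := one_sub_shift_pow_neq0 p1 h00; rewrite shift_pow0 in b.
  by rewrite npowN_real mulVf.
have c4 : ((1 : R[i]) : C) @[N --> \oo] --> (1 : C) by exact: cvg_cst.
apply/eqP => z0; have E : eprod s%:C * l = 1 by exact: (limC_unique c3 c4).
by have := oner_neq0 R[i]; rewrite -E z0 mul0r eqxx.
Qed.

Lemma logderiv_term_cvg : psum logderiv_term @ \oo --> limn (psum logderiv_term).
Proof.
have [B HB] := majorant_sum; apply: (dom_cvgR (sumleM (ler0n R 2) HB)) => n n0.
rewrite /logderiv_term; case: ifP => [/P1 p1|_]; last by rewrite normr0 mulr_ge0 ?majorant_ge0.
have b := half_le_1shift_pow p1 h00; rewrite shift_pow0 in b.
rewrite -(rmorph1 (real_complex R)) -(rmorphB (real_complex R)) normc_real in b.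
have l := lnn_ge0 R n; have wn := w_ge0 n.
have w12 : w n <= 2^-1 by apply: le_trans (w_t n) (npw_half p1).
have d0 : 0 < 1 - w n by lra.
have wd : 0 <= w n / (1 - w n) by apply: divr_ge0 => //; exact: ltW.
rewrite ger0_norm; last by apply: mulr_ge0.
rewrite mulrA ler_pdivrMr //.
have : ln n%:R * w n <= majorant n by apply: le_trans (ln_le_m n); rewrite ler_wpM2l.
by have := majorant_ge0 n; nra.
Qed.

Lemma exp_rem2 (T T1 : R) : 0 <= T <= T1 -> expR T - 1 - T <= T1 ^+ 2 * expR T1.
Proof.
move=> /andP[T0 TT]; have /andP[_] := expR_sub1x_le T; move=> /le_trans; apply.
by rewrite ger0_norm // ler_pM ?sqr_ge0 ?expR_ge0 ?ler_expR // lerXn2r ?nnegrE // (le_trans T0).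
Qed.

(** The error of [\prod_p (1 + factor_err h p) - 1] is split in two: passing from
    the product to the sum of the [factor_err h p] costs the second order part of
    an exponential, and linearizing each [factor_err h p] costs
    [22 (normc h)^2 majorant p]. *)
Lemma eprod_quad : exists K : R, 0 <= K /\ forall h, normc h <= r ->
  normc (eprod (s%:C + h) - eprod s%:C - h * (- (limn (psum logderiv_term))%:C * eprod s%:C)) <= K * normc h ^+ 2.
Proof.
have [B HB] := majorant_sum; have B0 := sumle_ge0 HB.
(* [6], with square [36], and [22] are the constants of [factor_err_le] and
   [factor_err_le2]. *)
pose K := 36 * B ^+ 2 * expR (6 * B) + 22 * B.
have K0 : 0 <= K by rewrite addr_ge0 ?mulr_ge0 ?sqr_ge0 ?expR_ge0.
exists (K * normc (eprod s%:C)); split; first by rewrite mulr_ge0 ?normc_ge0.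
move=> h hr; have n0 := normc_ge0 h.
have n1 : normc h <= 1 by move: hr; rewrite /r le_min => /andP[].
set Z0 := eprod s%:C; set Zh := eprod (s%:C + h); set U := limn _.
have Z00 : Z0 != 0 := eprod_neq0.
pose PN N := \prod_(1 <= p < N) (1 + factor_err h p).
have cP : (PN N : C) @[N --> \oo] --> (Zh / Z0 : C).
  have c1 := eprod_cvg hr; have c2 := eprod_cvg h00; rewrite addr0 in c2.
  have c3 : ((\prod_(1 <= p < N | P p) (1 - npowN p s%:C)^-1)^-1 : C) @[N --> \oo] --> (Z0^-1 : C).
    by apply: cvgV; [exact: Z00|exact: c2].
  apply: (cvg_congr (cvgM c1 c3)); apply: nearW => N /=.
  rewrite [X in _ / X]prodfV invrK -big_split /= big_mkcond /=; apply: eq_bigr => p _.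
  rewrite /factor_err; case: ifP => [/P1 p1|_]; last by rewrite addr0.
  have a := one_sub_shift_pow_neq0 p1 hr.
  by rewrite -/(shift_pow h p) npowN_real -/(w p); field.
have cU : (psum (fun p => (logderiv_term p)%:C) N : C) @[N --> \oo] --> (U%:C : C).
  apply: (cvg_congr (cvgC_real logderiv_term_cvg)); apply: nearW => N.
  by rewrite /psum (rmorph_sum (real_complex R)).
have HN N : normc (PN N - 1 + h * psum (fun p => (logderiv_term p)%:C) N) <= K * normc h ^+ 2.
  have [_ h2] := @prod_sub1_le R (factor_err h) (fun n => 6 * (normc h * majorant n)) N (fun n _ => factor_err_le n hr).
  have TE : psum (fun n => 6 * (normc h * majorant n)) N = 6 * (normc h * psum majorant N).
    by rewrite /psum -!mulr_sumr.
  have pB : psum majorant N <= B by case: HB.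
  have p0 : 0 <= psum majorant N by apply: sumr_ge0 => i _; exact: majorant_ge0.
  have h3 : expR (psum (fun n => 6 * (normc h * majorant n)) N) - 1 - psum (fun n => 6 * (normc h * majorant n)) N
      <= 36 * B ^+ 2 * expR (6 * B) * normc h ^+ 2.
    apply: (le_trans (@exp_rem2 _ (6 * (normc h * B)) _)).
      rewrite TE mulr_ge0 ?mulr_ge0 //= ler_pM2l // ler_wpM2l //.
    rewrite [leRHS](_ : _ = (6 * (normc h * B)) ^+ 2 * expR (6 * B)); last by ring.
    rewrite ler_wpM2l ?sqr_ge0 // ler_expR ler_pM2l // ler_piMl //.
  have h4 : normc (psum (factor_err h) N + h * psum (fun p => (logderiv_term p)%:C) N) <= 22 * B * normc h ^+ 2.
    rewrite /psum mulr_sumr -big_split /=.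
    apply: (le_trans (normc_sum _ _ _)).
    apply: (@le_trans _ _ (22 * (normc h ^+ 2 * psum majorant N))).
      by rewrite /psum !mulr_sumr; apply: ler_sum => p _; exact: factor_err_le2.
    by rewrite -[leRHS]mulrA [B * _]mulrC ler_pM2l // ler_wpM2l ?sqr_ge0.
  have -> : PN N - 1 + h * psum (fun p => (logderiv_term p)%:C) N =
    (PN N - 1 - psum (factor_err h) N) + (psum (factor_err h) N + h * psum (fun p => (logderiv_term p)%:C) N) by ring.
  apply: (le_trans (le_normcD _ _)); rewrite /K mulrDl.
  by apply: lerD => //; apply: le_trans h2 h3.
have cL : (PN N - 1 + h * psum (fun p => (logderiv_term p)%:C) N : C) @[N --> \oo] --> (Zh / Z0 - 1 + h * U%:C : C).
  have d1 : (h * psum (fun p => (logderiv_term p)%:C) N : C) @[N --> \oo] --> (h * U%:C : C).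
    by apply: cvgM; [exact: cvg_cst|exact: cU].
  have d2 : (PN N - 1 : C) @[N --> \oo] --> (Zh / Z0 - 1 : C).
    exact: (cvgB cP (cvg_cst _)).
  exact: (cvgD d2 d1).
have HL : normc (Zh / Z0 - 1 + h * U%:C) <= K * normc h ^+ 2.
  by apply: (cvgC_le cL); apply: nearW => N; exact: HN.
have -> : Zh - Z0 - h * (- U%:C * Z0) = (Zh / Z0 - 1 + h * U%:C) * Z0 by field.
rewrite normcM mulrAC ler_wpM2r ?normc_ge0 //.
Qed.

Lemma eprod_logderiv : derive1 eprod s%:C / eprod s%:C = - (limn (psum logderiv_term))%:C.
Proof.
have [K [K0 H]] := eprod_quad.
have [_ ->] := deriv_quadP r0 K0 H.
by rewrite mulfK // eprod_neq0.
Qed.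

End Product.

(** * From the Euler product to the Euler constants *)

Section Assembly.
Variable R : realType.
Local Notation C := (R[i]^o).
Implicit Types (s e : R) (chi : int -> R[i]).

(** Only the prime powers [p^k] with [2 <= k] contribute. *)
Definition highpow_term s (n : nat) : R := (1 + (moebius n)%:~R) * vonMangoldt R n * npw n s.
(** The sum of [ln p * p^(- k s)] over [2 <= k]. *)
Definition prime_tail s (p : nat) : R :=
  if prime p then ln p%:R * (npw p s ^+ 2 / (1 - npw p s)) else 0.

Lemma highpow_coef_ge0 n : 0 <= (1 + (moebius n)%:~R) * vonMangoldt R n.
Proof.
rewrite mulr_ge0 ?vonMangoldt_ge0 // -lerBlDl sub0r.
have := moebius_le1 n; rewrite ler_norml => /andP[h _].
by rewrite -(rmorphN1 (intmul 1)) ler_int.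
Qed.

(** Attributes the coefficient to the prime [p] of which [n] is a power, so that
    sums over [n] can be grouped by primes. *)
Lemma highpow_coef_sum n N : (0 < n)%N -> (n < N)%N ->
  (1 + (moebius n)%:~R) * vonMangoldt R n =
  \sum_(1 <= p < N | prime p) (if (primes n == [:: p]) && (n != p) then ln p%:R else 0).
Proof.
move=> n0 nN; rewrite mulrDl mul1r moebius_vonMangoldt.
have H0 : (forall p, primes n <> [:: p]) -> vonMangoldt R n + (if prime n then - ln n%:R else 0) =
    \sum_(1 <= p < N | prime p) (if (primes n == [:: p]) && (n != p) then ln p%:R else 0).
  move=> H; rewrite big1; last by move=> p _; case: eqP => // /H.
  have -> : vonMangoldt R n = 0.
    by rewrite /vonMangoldt; case E : (primes n) => [|p [|]] //; case: (H p).
  rewrite ifF ?addr0 //; apply/negP => pn; apply: (H n); exact: primes_prime.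
have [l E] : exists l, primes n = l by exists (primes n).
case: l E => [|p [|q r]] E.
- by apply: H0 => q; rewrite E.
- have : p \in primes n by rewrite E inE.
  rewrite mem_primes => /and3P[pp _ pn].
  have pN : (1 <= p < N)%N by rewrite prime_gt0 // (leq_ltn_trans _ nN) // dvdn_leq.
  rewrite big_mkcond (bigD1_seq p) ?iota_uniq ?mem_index_iota //= pp.
  rewrite [\sum_(i <- _ | _) _]big1 ?addr0; last first.
    by move=> q qp; rewrite E eqseq_cons eq_sym (negbTE qp); case: prime.
  rewrite /vonMangoldt E eqxx /=; case: eqP => [->|np]; first by rewrite pp subrr.
  rewrite ifF ?addr0 //; apply/negP => pn'; apply: np.
  by move: E; rewrite primes_prime // => -[].
- by apply: H0 => q'; rewrite E.
Qed.

Lemma geom2_le (y : R) N : 0 <= y <= 2^-1 ->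
  \sum_(1 <= k < N | (1 < k)%N) y ^+ k <= 2 * y ^+ 2.
Proof.
move=> /andP[y0 y1].
suff H K : \sum_(1 <= k < K | (1 < k)%N) y ^+ k <= 2 * y ^+ 2 - 2 * y ^+ 2 * y ^+ K.-2.
  by apply: (le_trans (H N)); rewrite gerBl !mulr_ge0 ?exprn_ge0.
elim: K => [|[|[|K] IH]].
- by rewrite big_geq // expr0 mulr1 subrr.
- by rewrite big_geq // expr0 mulr1 subrr.
- by rewrite big_mkcond big_nat1 /= expr0 mulr1 subrr.
rewrite big_mkcond big_nat_recr //= -big_mkcond /= (le_trans (lerD IH (lexx _))) //=.
have -> : y ^+ K.+2 = y ^+ 2 * y ^+ K by rewrite -exprD.
have q0 : 0 <= y ^+ 2 * y ^+ K by rewrite mulr_ge0 ?exprn_ge0.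
rewrite [y ^+ K.+1]exprS; have : 0 <= y ^+ 2 * y ^+ K * (1 - 2 * y) by rewrite mulr_ge0 //; lra.
lra.
Qed.

(** Grouped by primes, the sum is at most
    [\sum_p ln p \sum_(2 <= k) p^(-k) <= 2 \sum_p ln p / p^2]. *)
Lemma highpow_term_sumle : exists B, sumle (highpow_term 1) B.
Proof.
have [|B HB] := @sum_ln_npw R 1 2; first by rewrite ltr1n.
exists (2 * B); split=> [n n0|N]; first exact: mulr_ge0 (highpow_coef_ge0 n) (npw_ge0 _ _).
have -> : psum (highpow_term 1) N = \sum_(1 <= p < N | prime p) ln p%:R *
    \sum_(1 <= n < N | primes n == [:: p]) (if n != p then n%:R^-1 else 0).
  under [RHS]eq_bigr do rewrite mulr_sumr big_mkcond.
  rewrite exchange_big /=; apply: eq_big_nat => n /andP[n0 nN].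
  rewrite /highpow_term (highpow_coef_sum n0 nN) mulr_suml npw1 //; apply: eq_bigr => p _.
  by case: (primes n == [:: p]); case: (n != p); rewrite /= ?mul0r ?mulr0.
apply: (@le_trans _ _ (\sum_(1 <= p < N) 2 * ((1 + ln p%:R) ^+ 1 * npw p 2))); last first.
  by rewrite -mulr_sumr ler_pM2l //; case: HB => _ /(_ N).
rewrite big_mkcond; apply: ler_sum_nat => p /andP[p0 _].
have l := lnn_ge0 R p.
case: ifP => [pp|_]; last by rewrite expr1 !mulr_ge0 ?npw_ge0 // addr_ge0.
rewrite sum_primepow // expr1 mulrCA ler_pM ?lnn_ge0 ?lerDr //.
  by apply: sumr_ge0 => k _; case: ifP.
rewrite npw2 // (le_trans _ (@geom2_le _ N _)) //; last first.
  by rewrite invr_ge0 ler0n /= lef_pV2 ?posrE ?ltr0n // ler_nat prime_gt1.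
rewrite big_mkcond [leRHS]big_mkcond /=; apply: ler_sum_nat => k /andP[k0 _].
have y0 : 0 <= (p%:R^-1 : R) ^+ k by rewrite exprn_ge0 // invr_ge0.
case: ifP => _; last by case: ifP.
case: k k0 y0 => // -[|k] _ y0; first by rewrite expn1 eqxx.
by case: ifP => // _; rewrite natrX exprVn.
Qed.

Lemma prime_tail1 p : prime p -> prime_tail 1 p = ln p%:R / (p%:R * (p%:R - 1)).
Proof.
move=> pp; rewrite /prime_tail pp npw1 ?prime_gt0 //.
have p0' : (0 : R) < p%:R by rewrite ltr0n prime_gt0.
have p1' : (0 : R) < p%:R - 1 by rewrite subr_gt0 ltr1n prime_gt1.
by field; rewrite !gt_eqF.
Qed.

Lemma prime_tail_sumle : exists B, sumle (prime_tail 1) B.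
Proof.
have [|B HB] := @sum_ln_npw R 1 2; first by rewrite ltr1n.
exists (2 * B); apply: sumle_dom (sumleM (ler0n R 2) HB) _ => p p0.
have l := lnn_ge0 R p; have w0 := npw_ge0 p (2 : R).
rewrite /prime_tail; case: ifP => [pp|_]; last by rewrite lexx !mulr_ge0 // addr_ge0.
have w1 : npw p 1 <= 2^-1 :> R.
  by rewrite npw1 // lef_pV2 ?posrE ?ltr0n // ler_nat prime_gt1.
rewrite npw2 // -npw1 //; set y := npw p 1 in w1 *.
have d0 : 0 < 1 - y by lra.
have y2 : 0 <= y ^+ 2 := sqr_ge0 _.
have h0 : 0 <= y ^+ 2 / (1 - y) by apply: divr_ge0 => //; exact: ltW.
have h : y ^+ 2 / (1 - y) <= 2 * y ^+ 2 by rewrite ler_pdivrMr //; nra.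
rewrite mulr_ge0 //= [leRHS]mulrCA expr1 ler_pM // lerDr //.
Qed.

Variables (a : int) (d : nat).
Hypothesis hd : (2 <= d)%N.
Hypothesis had : coprimez a d%:Z.
Local Notation cg := (congruent_to a d).

Definition highpow_ap s : R := limn (psum (fun n => (cg n)%:R * highpow_term s n)).
Definition prime_tail_ap s : R := limn (psum (fun p => (cg p)%:R * prime_tail s p)).

Lemma prime_seriesE N : prime_series R d a N = psum (fun p => (cg p)%:R * prime_tail 1 p) N.
Proof.
rewrite /prime_series /psum big_mkcond; apply: eq_bigr => p _.
case: ifP => [/andP[pp ->]|]; first by rewrite prime_tail1 // mul1r.
by rewrite /prime_tail; case: prime; case: cg; rewrite ?mulr0 ?mul0r.
Qed.

Lemma mangoldt_seriesE N : mangoldt_series R d a N = psum (fun n => (cg n)%:R * highpow_term 1 n) N.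
Proof.
rewrite /mangoldt_series /psum big_mkcond; apply: eq_big_nat => n /andP[n0 _].
by case: cg; rewrite ?mul1r ?mul0r // /highpow_term npw1.
Qed.

Let cgM (M u : nat -> R) n : `|u n| <= M n -> `|(cg n)%:R * u n| <= M n.
Proof. by case: cg => h; rewrite ?mul1r // mul0r normr0 (le_trans _ h). Qed.

(** The terms decrease in [s], so those at [s = 1] dominate. *)
Lemma highpow_ap_cvg :
  cvgn (psum (fun n => (cg n)%:R * highpow_term 1 n)) /\ highpow_ap (1 + e) @[e --> (0 : R)^'+] --> highpow_ap 1.
Proof.
have [B HB] := highpow_term_sumle; apply: (tannery HB).
  apply: (@near_right0 _ _ 1) => // e e0 _ n n0; apply: cgM.
  rewrite /highpow_term ger0_norm; last exact: mulr_ge0 (highpow_coef_ge0 n) (npw_ge0 _ _).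
  rewrite ler_wpM2l ?highpow_coef_ge0 //.
  by apply: le_npw; rewrite lerDl ltW.
move=> n n0; apply: cvgM; first exact: cvg_cst.
by apply: cvgM; [exact: cvg_cst|exact: npw_1e_cvg].
Qed.

Lemma prime_tail_ap_cvg :
  cvgn (psum (fun n => (cg n)%:R * prime_tail 1 n)) /\ prime_tail_ap (1 + e) @[e --> (0 : R)^'+] --> prime_tail_ap 1.
Proof.
have [B HB] := prime_tail_sumle; apply: (tannery HB).
  apply: (@near_right0 _ _ 1) => // e e0 _ p p0; apply: cgM.
  rewrite /prime_tail; case: ifP => [pp|_]; last by rewrite normr0.
  have w1 : npw p 1 < 1 :> R by rewrite npw_lt1 // prime_gt1.
  have w2 : npw p (1 + e) <= npw p 1 by apply: le_npw; rewrite lerDl ltW.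
  have d1 : 0 < 1 - npw p (1 : R) by rewrite subr_gt0.
  have d2 : 0 < 1 - npw p (1 + e) by rewrite subr_gt0 (le_lt_trans w2).
  have q2 : 0 <= npw p (1 + e) ^+ 2 / (1 - npw p (1 + e)).
    by apply: divr_ge0; [exact: sqr_ge0|exact: ltW].
  rewrite ger0_norm; last by apply: mulr_ge0 => //; exact: lnn_ge0.
  rewrite ler_wpM2l ?lnn_ge0 // ler_pM ?sqr_ge0 ?invr_ge0 ?(ltW d2) //.
    by rewrite lerXn2r // nnegrE npw_ge0.
  by rewrite lef_pV2 ?posrE // lerD2l lerN2.
move=> p p0; apply: cvgM; first exact: cvg_cst.
rewrite /prime_tail; case: ifP => [pp|_]; last exact: cvg_cst.
apply: cvgM; first exact: cvg_cst.
apply: cvgM; first by rewrite expr2; under eq_fun do rewrite expr2; apply: cvgM; exact: npw_1e_cvg.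
apply: cvgV; first by rewrite subr_eq0 gt_eqF // npw_lt1 // prime_gt1.
by apply: cvgB; [exact: cvg_cst|exact: npw_1e_cvg].
Qed.

Let Pa : pred nat := fun p => prime p && cg p.
Let Pa1 p : Pa p -> (1 < p)%N. Proof. by move=> /andP[/prime_gt1]. Qed.

(** Termwise in [n]: at a prime [n], with [w = n^(-s)], the identity is
    [w / (1 - w) = w + w^2 / (1 - w)]; elsewhere [Lambda] and [(1 + mu) Lambda]
    agree. *)
Lemma logderiv_split s : 1 < s -> limn (psum (logderiv_term Pa s)) = mangoldt_ap d a s - highpow_ap s + prime_tail_ap s.
Proof.
move=> s1.
have c1 := @mangoldt_sum_cvg R cg s s1.
have c2 : cvgn (psum (fun n => (cg n)%:R * highpow_term s n)).
  have [B HB] := highpow_term_sumle; apply: (dom_cvgR HB) => n n0; apply: cgM.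
  rewrite /highpow_term ger0_norm; last exact: mulr_ge0 (highpow_coef_ge0 n) (npw_ge0 _ _).
  by rewrite ler_wpM2l ?highpow_coef_ge0 // le_npw // ltW.
have c3 : cvgn (psum (logderiv_term Pa s)).
  by apply/cvg_ex; eexists; exact: (logderiv_term_cvg Pa1 s1).
have E n : (0 < n)%N -> (cg n)%:R * prime_tail s n = logderiv_term Pa s n - (cg n)%:R * (vonMangoldt R n * npw n s)
   + (cg n)%:R * highpow_term s n.
  move=> n0; rewrite /logderiv_term /Pa /prime_tail /highpow_term mulrDl mul1r moebius_vonMangoldt.
  case: cg; rewrite ?andbT ?andbF ?mul0r ?mul1r ?subr0 ?addr0 //.
  case: ifP => [pp|_]; last by rewrite addr0 sub0r addNr.
  have d0 : 0 < 1 - npw n s by rewrite subr_gt0 npw_lt1 ?prime_gt1 // (lt_trans ltr01).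
  by field; rewrite gt_eqF.
have c4 : psum (logderiv_term Pa s) N - psum (fun n => (cg n)%:R * (vonMangoldt R n * npw n s)) N +
   psum (fun n => (cg n)%:R * highpow_term s n) N @[N --> \oo] --> limn (psum (logderiv_term Pa s)) - mangoldt_ap d a s + highpow_ap s.
  by apply: cvgD c2; exact: (cvgB c3 c1).
suff -> : prime_tail_ap s = limn (psum (logderiv_term Pa s)) - mangoldt_ap d a s + highpow_ap s by ring.
apply: cvg_lim => //; apply: (cvg_congr c4); apply: nearW => N.
rewrite /psum -sumrB -big_split /=; apply: eq_big_nat => n /andP[n0 _].
by rewrite (E n n0).
Qed.

Lemma dirichletLE chi : dirichletL chi = Dseries (natchar chi).
Proof. by []. Qed.

Lemma zeta_apE : @zeta_ap R d a = eprod Pa.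
Proof. by []. Qed.

Lemma dirichletL_deriv chi : nonprincipal R d chi ->
  [/\ derivable (dirichletL chi) 1 1, dirichletL chi 1 != 0 &
      derive1 (dirichletL chi) 1 = - Dseries_ln (natchar chi)].
Proof.
move=> [chiP chi1]; have [D1 D2] := Dseries_derivable (dch_psum_bounded hd chiP chi1).
split; [exact: D1|exact: (nonvanishing hd chiP chi1)|exact: D2].
Qed.

(** The limit of the decomposition over characters given by [dchars_sum]; the pole
    comes from the principal character alone. *)
Lemma mangoldt_ap_cvg :
  ((mangoldt_ap d a (1 + e) - ((totient d)%:R * e)^-1)%:C : C) @[e --> (0 : R)^'+] --> (- gamma1_ap R d a : C).
Proof.
pose chi0 := principal_character R d.
have phi0 : ((totient d)%:R : R) != 0 by rewrite pnatr_eq0 -lt0n totient_gt0 ltnW.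
have m0 : chi0 \in dchars R d by apply/(mem_dchars hd); exact: principal_dch.
have c0a : conjc (chi0 a) = 1 by rewrite /chi0 /principal_character had conjc1.
have c1 : ((twist (natchar chi0) (vonMangoldt R) (1 + e) - e^-1%:C) +
   \sum_(chi <- dchars R d | chi != chi0) conjc (chi a) * twist (natchar chi) (vonMangoldt R) (1 + e) : C)
   @[e --> (0 : R)^'+] --> ((- gamma_principal R d)%:C +
    \sum_(chi <- dchars R d | chi != chi0) conjc (chi a) * (Dseries_ln (natchar chi) / Dseries (natchar chi) 1) : C).
  apply: cvgD; first exact: (principal_cvg hd).
  rewrite -big_filter; under eq_fun do rewrite -big_filter.
  apply: cvg_sum_seq_in => chi; rewrite mem_filter => /andP[/eqP chi1 /(mem_dchars hd) chiP].
  apply: cvgM; first exact: cvg_cst.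
  exact: (logderiv_cvg hd chiP chi1 (nonvanishing hd chiP chi1)).
have c2 : (((totient d)%:R^-1)%:C * ((twist (natchar chi0) (vonMangoldt R) (1 + e) - e^-1%:C) +
   \sum_(chi <- dchars R d | chi != chi0) conjc (chi a) * twist (natchar chi) (vonMangoldt R) (1 + e)) : C)
   @[e --> (0 : R)^'+] --> (((totient d)%:R^-1)%:C * ((- gamma_principal R d)%:C +
    \sum_(chi <- dchars R d | chi != chi0) conjc (chi a) * (Dseries_ln (natchar chi) / Dseries (natchar chi) 1)) : C).
  by apply: cvgM; [exact: cvg_cst|exact: c1].
have -> : - gamma1_ap R d a = ((totient d)%:R^-1)%:C * ((- gamma_principal R d)%:C +
    \sum_(chi <- dchars R d | chi != chi0) conjc (chi a) * (Dseries_ln (natchar chi) / Dseries (natchar chi) 1)).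
  rewrite /gamma1_ap fsbig_dchars // -mulrN opprD (fmorphV (real_complex R)) (rmorph_nat (real_complex R)).
  congr (_ * (_ + _)); first by rewrite -(rmorphN (real_complex R)).
  rewrite -sumrN -big_filter -[RHS]big_filter; apply: eq_big_seq => chi.
  rewrite mem_filter => /andP[/eqP chi1 /(mem_dchars hd) chiP].
  have [_ _ ->] := dirichletL_deriv (conj chiP chi1 : nonprincipal R d chi).
  by rewrite mulNr mulrN opprK dirichletLE.
apply: (cvg_congr c2); apply: (@near_right0 _ _ 1) => // e e0 _.
have s1 : 1 < 1 + e by rewrite ltrDl.
have E := dchars_sum hd s1 had; rewrite (bigD1_seq chi0) ?uniq_dchars //= c0a mul1r in E.
rewrite addrAC E -(rmorphB (real_complex R)) -(rmorphM (real_complex R)); congr (_%:C).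
by field; rewrite phi0 gt_eqF.
Qed.

Lemma cvg_right1 (F : R -> C) (l : C) :
  F (1 + e) @[e --> (0 : R)^'+] --> l -> F s @[s --> (1 : R)^'+] --> l.
Proof.
move=> H.
have sh : (s - 1) @[s --> (1 : R)^'+] --> (0 : R)^'+.
  move=> A /= [r /= r0 rA]; exists r => //= s sr s1.
  by apply: rA; rewrite /= ?subr_gt0 // sub0r normrN distrC.
have := cvg_comp _ _ sh H; apply: cvg_trans; apply: near_eq_cvg.
by apply: nearW => s /=; rewrite addrC subrK.
Qed.

Lemma zeta_ap_quot_cvg : zeta_ap_quot d a s @[s --> (1 : R)^'+] -->
  (gamma1_ap R d a - (limn (@prime_series R d a))%:C + (limn (@mangoldt_series R d a))%:C : C).
Proof.
apply: cvg_right1.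
have -> : prime_series R d a = psum (fun p => (cg p)%:R * prime_tail 1 p).
  by apply/funext => N; exact: prime_seriesE.
have -> : mangoldt_series R d a = psum (fun n => (cg n)%:R * highpow_term 1 n).
  by apply/funext => N; exact: mangoldt_seriesE.
have [_ cQ] := highpow_ap_cvg; have [_ cP] := prime_tail_ap_cvg.
have c1 : (- (mangoldt_ap d a (1 + e) - ((totient d)%:R * e)^-1)%:C - (prime_tail_ap (1 + e))%:C + (highpow_ap (1 + e))%:C : C)
   @[e --> (0 : R)^'+] --> (- - gamma1_ap R d a - (prime_tail_ap 1)%:C + (highpow_ap 1)%:C : C).
  have d1 : ((highpow_ap (1 + e))%:C : C) @[e --> (0 : R)^'+] --> ((highpow_ap 1)%:C : C) by exact: cvgC_real.
  have d2 : ((prime_tail_ap (1 + e))%:C : C) @[e --> (0 : R)^'+] --> ((prime_tail_ap 1)%:C : C) by exact: cvgC_real.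
  exact: (cvgD (cvgB (cvgN mangoldt_ap_cvg) d2) d1).
rewrite opprK in c1; apply: (cvg_congr c1); apply: (@near_right0 _ _ 1) => // e e0 _.
have s1 : 1 < 1 + e by rewrite ltrDl.
rewrite /zeta_ap_quot zeta_apE (eprod_logderiv Pa1 s1) logderiv_split // (_ : 1 + e - 1 = e); last by ring.
rewrite -!(rmorphN (real_complex R)) -!(rmorphD (real_complex R)); congr (_%:C).
ring.
Qed.

End Assembly.

Theorem theorem1 (R : realType) (a : int) (d : nat)
    (hd : (2 <= d)%N) (had : coprimez a d%:Z) :
  [/\ cvg (@zeta_ap_quot R d a s @[s --> (1 : R)^'+]),
      cvgn (@prime_series R d a),
      cvgn (@mangoldt_series R d a),
      (forall chi : int -> R[i], nonprincipal R d chi ->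
        derivable (dirichletL chi) 1 1 /\ dirichletL chi 1 != 0)
    & gamma_ap R d a =
        gamma1_ap R d a
        - (limn (@prime_series R d a))%:C
        + (limn (@mangoldt_series R d a))%:C].
Proof.
have c := @zeta_ap_quot_cvg R a d hd had.
split.
- by apply/cvg_ex; eexists; exact: c.
- have [cP _] := prime_tail_ap_cvg R a d; rewrite (_ : prime_series R d a = psum (fun p => (congruent_to a d p)%:R * prime_tail 1 p)) //.
  by apply/funext => N; exact: prime_seriesE.
- have [cQ _] := highpow_ap_cvg R a d; rewrite (_ : mangoldt_series R d a = psum (fun n => (congruent_to a d n)%:R * highpow_term 1 n)) //.
  by apply/funext => N; exact: mangoldt_seriesE.
- by move=> chi chiP; have [D L _] := dirichletL_deriv hd chiP.
- exact: (limC_eq c).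
Qed.
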